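(* Let $N\ge 2$ and $\lambda_*:=-(N-2)^2/4$. Let $V$ be a real-valued continuous function on $(0,\infty)$ such that, for some $\theta>0$ and some $\lambda_1,\lambda_2\in[\lambda_*,\infty)$, $$\lim_{r\to 0}r^{-\theta}\left|r^2V(r)-\lambda_1\right|=0,\qquad \lim_{r\to\infty}r^{\theta}\left|r^2V(r)-\lambda_2\right|=0 .$$ Let $H:=-\Delta+V(|x|)$ on ${\bf R}^N$ and consider the ordinary differential equation $$\text{(O)}\qquad U''+\frac{N-1}{r}U'-V(r)\,U=0\quad\text{in }(0,\infty).$$ (1) There exists a unique solution $U$ of (O) with the property $U(r)\sim r^{A^+(\lambda_1)}$ as $r\to 0$. (2) For any solution $w$ of (O) satisfying, as $r\to 0$, $$w(r)=o\left(r^{A^-(\lambda_1)}\right)\ \text{if }\lambda_1>\lambda_*,\qquad w(r)=o\left(r^{-\frac{N-2}{2}}|\log r|\right)\ \text{if }\lambda_1=\lambda_*,$$ there exists a constant $c$ such that $w(r)=c\,U(r)$ on $(0,\infty)$, where $U$ is the solution in (1). (3) Assume that $H$ is nonnegative. Then $U(r)>0$ on $(0,\infty)$, and for some $c_*>0$: (a) $U(r)\sim c_*r^{A^+(\lambda_2)}$ as $r\to\infty$ if $H$ is subcritical and $\lambda_2>\lambda_*$; (b) $U(r)\sim c_*r^{A^-(\lambda_2)}$ as $r\to\infty$ if $H$ is critical and $\lambda_2>\lambda_*$; (c) $U(r)\sim c_*r^{-\frac{N-2}{2}}\log r$ as $r\to\infty$ if $H$ is subcritical and $\lambda_2=\lambda_*$;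 (d) $U(r)\sim c_*r^{-\frac{N-2}{2}}$ as $r\to\infty$ if $H$ is critical and $\lambda_2=\lambda_*$. (4) Assume that $H$ is subcritical. Let $W\in C_0([0,\infty))$ be such that $W\ge 0$ and $W\not\equiv 0$ on $[0,\infty)$, and set $H_\mu:=-\Delta+V(|x|)-\mu W(|x|)$ for $\mu\in{\bf R}$. Then there exists $\mu_*>0$ such that (a) $H_\mu$ is subcritical if $\mu<\mu_*$; (b) $H_\mu$ is critical if $\mu=\mu_*$; (c) $H_\mu$ is supercritical if $\mu>\mu_*$.
   Context: For $\lambda\in[\lambda_*,\infty)$, $A^\pm(\lambda):=\frac{-(N-2)\pm\sqrt{D_\lambda}}{2}$ with $D_\lambda:=(N-2)^2+4\lambda\ge 0$; these are the roots of $\alpha^2+(N-2)\alpha-\lambda=0$. A Schrödinger operator $H=-\Delta+V$ is called nonnegative if $\int_{{\bf R}^N}\left[|\nabla\phi|^2+V\phi^2\right]dx\ge 0$ for all $\phi\in C_0^\infty({\bf R}^N\setminus\{0\})$. If $H$ is not nonnegative it is called supercritical. A nonnegative $H$ is called subcritical if for every $W\in C_0^\infty({\bf R}^N)$ the operator $H-\epsilon W$ is nonnegative for all small enough $\epsilon>0$; a nonnegative $H$ which is not subcritical is called critical. $f(r)\sim g(r)$ as $r\to 0$ (resp. $r\to\infty$) means $f(r)/g(r)\to 1$ as $r\to 0$ (resp. $r\to\infty$). $C_0([0,\infty))$ is the space of continuous functions on $[0,\infty)$ with compact support. *)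

(* Defs.v *)
From HB Require Import structures.
From mathcomp Require Import all_boot all_order all_algebra.
From mathcomp Require Import all_classical all_reals all_analysis.

Set Implicit Arguments.
Unset Strict Implicit.
Unset Printing Implicit Defensive.

Import Order.TTheory GRing.Theory Num.Theory.
Import numFieldNormedType.Exports.

Local Open Scope classical_set_scope.
Local Open Scope ring_scope.

(* [n.-tuple T] is a measurable type in the library, but it carries no product
   measure: the n-fold power of a sigma-finite [mu] is built by recursion,
   transporting [mu \x _] along [cons : T * T^n -> T^n.+1]. *)
Section cons_measure.
Context d (T : measurableType d) (R : realType) (n : nat).
Variable mu : {sigma_finite_measure set T -> \bar R}.
Variable m : {sigma_finite_measure set (n.-tuple T) -> \bar R}.

Definition tcons (p : T * n.-tuple T) : n.+1.-tuple T :=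
  [the n.+1.-tuple T of p.1 :: p.2].

Lemma measurable_tcons : measurable_fun setT tcons.
Proof. exact: measurable_cons. Qed.

Definition cons_measure : set (n.+1.-tuple T) -> \bar R :=
  pushforward (mu \x m)%E tcons.

Let cons_measure0 : cons_measure set0 = 0%E.
Proof. by rewrite /cons_measure /pushforward preimage_set0 measure0. Qed.

Let cons_measure_ge0 A : (0 <= cons_measure A)%E.
Proof. by rewrite /cons_measure /pushforward measure_ge0. Qed.

Let cons_measure_sigma_additive : semi_sigma_additive cons_measure.
Proof.
move=> F mF tF mUF; rewrite /cons_measure /pushforward preimage_bigcup.
apply: measure_semi_sigma_additive.
- by move=> k; rewrite -[X in measurable X]setTI; exact: measurable_tcons.
- apply/trivIsetP => /= i j _ _ ij; rewrite -preimage_setI.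
  by move/trivIsetP : tF => /(_ _ _ _ _ ij) ->//; rewrite preimage_set0.
- rewrite -preimage_bigcup -[X in measurable X]setTI.
  exact: measurable_tcons.
Qed.

HB.instance Definition _ := isMeasure.Build _ _ _ cons_measure
  cons_measure0 cons_measure_ge0 cons_measure_sigma_additive.

Lemma sigma_finite_cons_measure : sigma_finite setT cons_measure.
Proof.
have /sigma_finiteP[F [TF ndF Foo]] := sigma_finiteT mu.
have /sigma_finiteP[G [TG ndG Goo]] := sigma_finiteT m.
pose g (t : n.+1.-tuple T) : T * n.-tuple T := (thead t, [tuple of behead t]).
have mg : measurable_fun setT g.
  apply: measurable_fun_pair; first exact: measurable_tnth.
  exact: measurable_behead.
have gK : cancel tcons g by move=> [x t]; congr pair; exact: val_inj.
exists (fun i => g @^-1` (F i `*` G i)).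
  rewrite -preimage_bigcup; apply/esym/seteqP; split => // t _.
  have [i _ Fi] : (\bigcup_i F i) (g t).1 by rewrite -TF.
  have [j _ Gj] : (\bigcup_i G i) (g t).2 by rewrite -TG.
  exists (maxn i j) => //; split => /=.
  - by move: Fi; exact/subsetPset/ndF/leq_maxl.
  - by move: Gj; exact/subsetPset/ndG/leq_maxr.
move=> i; have [mF Fi] := Foo i; have [mG Gi] := Goo i; split.
  by rewrite -[X in measurable X]setTI; apply: mg => //; exact: measurableX.
rewrite /cons_measure /pushforward -comp_preimage (_ : g \o tcons = id).
  by rewrite preimage_id product_measure1E// lte_mul_pinfty// ge0_fin_numE.
by apply/funext => p; rewrite /comp gK.
Qed.

HB.instance Definition _ := Measure_isSigmaFinite.Build _ _ _ cons_measure
  sigma_finite_cons_measure.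

End cons_measure.

Fixpoint power_measure d (T : measurableType d) (R : realType)
    (mu : {sigma_finite_measure set T -> \bar R}) (n : nat) :
    {sigma_finite_measure set (n.-tuple T) -> \bar R} :=
  if n is n'.+1 then cons_measure mu (power_measure mu n') else dirac [tuple].

(* This determines [power_measure mu n], by uniqueness of the product measure. *)
Lemma power_measure_box d (T : measurableType d) (R : realType)
    (mu : {sigma_finite_measure set T -> \bar R}) (n : nat)
    (A : 'I_n -> set T) : (forall i, measurable (A i)) ->
  power_measure mu n [set t | forall i, A i (tnth t i)] =
  (\prod_(i < n) mu (A i))%E.
Proof.
elim: n A => [|n IH] A mA.
  rewrite big_ord0 /= diracE mem_set//=.
  by case.
rewrite big_ord_recl /= -IH//.
rewrite /cons_measure /pushforward.
rewrite (_ : _ @^-1` _ =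
    A ord0 `*` [set t : n.-tuple T | forall i, A (lift ord0 i) (tnth t i)]).
  rewrite product_measure1E//.
  rewrite (_ : [set t | _] =
    \bigcap_(i in setT) ((@tnth n T)^~ i @^-1` A (lift ord0 i))).
    apply: fin_bigcap_measurable => // i _.
    by rewrite -[X in measurable X]setTI; exact: measurable_tnth.
  by apply/seteqP; split => t /= h i; [move=> _; exact: h|exact: (h i I)].
apply/seteqP; split => -[x t] /=.
  move=> h; split; first exact: (h ord0).
  by move=> i; have := h (lift ord0 i); rewrite tnthS.
move=> [hx ht] i; have [j ->|->] := unliftP ord0 i; last by [].
by rewrite tnthS.
Qed.

Section Schrodinger.
Context {R : realType} {N : nat}.
Implicit Types (f phi q W : 'rV[R]_N -> R).

Definition lebesgue_tuple : {measure set _ -> \bar R} :=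
  power_measure (@lebesgue_measure R) N.

Definition row_of_tuple (t : N.-tuple (measurableTypeR R)) : 'rV[R]_N :=
  \row_i tnth t i.

(* The library norm on ['rV[R]_N] is the sup norm. *)
Definition enorm (x : 'rV[R]_N) : R := Num.sqrt (\sum_i x ord0 i ^+ 2).

Definition partial (i : 'I_N) f : 'rV[R]_N -> R :=
  fun x => 'D_(delta_mx ord0 i) f x.

Definition iter_partial (s : seq 'I_N) f := foldr partial f s.

(* ['D_v] is total, so the existence of each partial derivative is required
   separately. *)
Definition smooth f :=
  forall s : seq 'I_N, continuous (iter_partial s f) /\
    forall i x, derivable (iter_partial s f) x (delta_mx ord0 i).

Definition C0infty (Omega : set 'rV[R]_N) : set ('rV[R]_N -> R) :=
  [set f | [/\ smooth f, compact (closure [set x | f x != 0]) &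
               closure [set x | f x != 0] `<=` Omega]].

(* A potential [q] stands for the operator -Laplacian + q. *)
Definition energy q phi : \bar R :=
  (\int[lebesgue_tuple]_t
     (let x := row_of_tuple t in
      (\sum_i partial i phi x ^+ 2) + q x * phi x ^+ 2)%R%:E)%E.

Definition nonnegative q :=
  forall phi, C0infty [set x | x != 0] phi -> (0 <= energy q phi)%E.

Definition supercritical q := ~ nonnegative q.

Definition subcritical q := nonnegative q /\
  forall W, C0infty setT W ->
    exists2 eps0 : R, 0 < eps0 &
      forall eps, 0 < eps < eps0 -> nonnegative (fun x => q x - eps * W x).

Definition critical q := nonnegative q /\ ~ subcritical q.

End Schrodinger.

Section radial_ode.
Context {R : realType}.
Implicit Types (V U W : R -> R) (F : set_system R).

Definition radial N (V : R -> R) : 'rV[R]_N -> R := fun x => V (enorm x).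

(* Functions on (0,oo) are total functions on [R] whose values outside (0,oo)
   are irrelevant. *)
Definition ode_solution (N : nat) V U :=
  forall r, 0 < r ->
    [/\ derivable U r 1, derivable (derive1 U) r 1 &
        derive1 (derive1 U) r + (N%:R - 1) / r * derive1 U r - V r * U r = 0].

Definition asymp F (f g : R -> R) := f r / g r @[r --> F] --> (1 : R).

Definition lambda_star (N : nat) : R := - (N%:R - 2) ^+ 2 / 4.

Definition discr (N : nat) (lambda : R) : R := (N%:R - 2) ^+ 2 + 4 * lambda.

Definition Aplus (N : nat) (lambda : R) : R :=
  (- (N%:R - 2) + Num.sqrt (discr N lambda)) / 2.

Definition Aminus (N : nat) (lambda : R) : R :=
  (- (N%:R - 2) - Num.sqrt (discr N lambda)) / 2.

(* Continuity and support are those of the restriction to [0,oo). *)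
Definition C0_halfline W :=
  {within `[0, +oo[, continuous W} /\
  compact (closure [set r | 0 <= r /\ W r != 0]).

End radial_ode.

Arguments radial {R} N V x.

(* Main.v *)
Require Import Defs.
From mathcomp Require Import all_boot all_order all_algebra.
From mathcomp Require Import all_classical all_reals all_analysis.
From mathcomp Require Import measurable_realfun ring lra.

Set Implicit Arguments.
Unset Strict Implicit.
Unset Printing Implicit Defensive.

Import Order.TTheory GRing.Theory Num.Theory.
Import numFieldNormedType.Exports.

Local Open Scope classical_set_scope.
Local Open Scope ring_scope.

(** With r = e^t and U(r) = r^{-(N-2)/2} y(t), the radial equation becomes
    y'' = Q y with Q(t) = ((N-2)/2)^2 + e^{2t} V(e^t), and Q converges
    exponentially fast to kappa_1^2 and kappa_2^2 at -oo and +oo, where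
    kappa_i = sqrt D_{lambda_i} / 2.  At each end this gives a recessive
    solution ~ e^{-kappa |t|} and a dominant one ~ e^{kappa |t|} / (2 kappa)
    (or |t|, if kappa = 0); U corresponds to the solution y recessive at -oo.
    If H is nonnegative, so is the form int eta'^2 + Q eta^2 on the line;
    hence no nonzero solution has two zeros, and y > 0.  Expand y at +oo.
    If its dominant coefficient is nonzero, the mean of the logarithmic
    derivatives of y and of the solution recessive at +oo satisfies a Riccati
    inequality with room to spare, and H is subcritical.  If it is zero, then
    after any small compactly supported decrease of Q the solution that agrees
    with y near -oo becomes negative, and H is critical.  In (4), mu_* is the
    supremum of the mu for which H_mu is nonnegative; subcriticality below mu_*
    follows from the convexity of the nonnegative potentials. *)

(** * Calculus on the line *)

(** The form lives on R^N and is tested by smooth functions supported off the origin, while the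
    arguments live on the line; two transfers shape the proof. From R^N to the line radial test
    functions suffice: with the weight |x|^-N polar integration follows from the divergence theorem,
    the area of the sphere staying an unidentified positive constant, and C^1 profiles are
    approximated by smooth ones. From the line back to R^N the test functions are arbitrary, and
    instead of spherical harmonics a Riccati inequality is turned into a radial vector field and a
    square is completed. The room in that inequality is c^2 / (4 (y u)^2), with c the Wronskian of y
    and of the solution u recessive at +oo. A perturbation W may sit at the origin, where it enters
    as e^{2t} W; it is absorbed because y u grows at most linearly in |t| at -oo. If y changed sign,
    its combination with the solution dominant at -oo having a zero far to the left would have a
    second zero; this is why y > 0. In (4) the potential W is only continuous, hence not admissible
    in the definition of subcriticality, and is compared with a smooth majorant. *)

Section Calculus.
Context {R : realType}.
Implicit Types (f g F : R -> R) (x a b : R).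

Lemma der_cst (c x : R) : is_derive x 1 (fun _ : R => c) 0.
Proof. exact: is_derive_cst. Qed.

Lemma der_id x : is_derive x 1 (fun y : R => y) 1.
Proof. exact: is_derive_id. Qed.

Lemma derD f g x a b : is_derive x 1 f a -> is_derive x 1 g b ->
  is_derive x 1 (fun y => f y + g y) (a + b).
Proof. by move=> fa gb; exact: is_deriveD. Qed.

Lemma derN f x a : is_derive x 1 f a -> is_derive x 1 (fun y => - f y) (- a).
Proof. by move=> fa; exact: is_deriveN. Qed.

Lemma derM f g x a b : is_derive x 1 f a -> is_derive x 1 g b ->
  is_derive x 1 (fun y => f y * g y) (a * g x + f x * b).
Proof.
move=> fa gb; have h := is_deriveM fa gb; apply: is_derive_eq.
by rewrite /GRing.scale /= addrC (mulrC a).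
Qed.

Lemma derX f n x a : is_derive x 1 f a ->
  is_derive x 1 (fun y => f y ^+ n.+1) (n.+1%:R * f x ^+ n * a).
Proof.
move=> fa; elim: n => [|n IH].
  by apply: is_derive_eq; rewrite expr0 !mul1r.
under [X in is_derive _ _ X]eq_fun do rewrite exprS.
have h := derM fa IH; apply: is_derive_eq.
by rewrite (mulrS 1 n.+1) !exprS; ring.
Qed.

Lemma derV f x a : f x != 0 -> is_derive x 1 f a ->
  is_derive x 1 (fun y => (f y)^-1) (- a / f x ^+ 2).
Proof.
move=> f0 fa; have h := is_deriveV f0 fa; apply: is_derive_eq.
by rewrite /GRing.scale /= !mulNr mulrC.
Qed.

Lemma der_comp f g x a b : is_derive (g x) 1 f a -> is_derive x 1 g b ->
  is_derive x 1 (fun y => f (g y)) (a * b).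
Proof. by move=> fa gb; exact: (is_derive1_comp fa gb). Qed.

Lemma der_exp f x a : is_derive x 1 f a ->
  is_derive x 1 (fun y => expR (f y)) (expR (f x) * a).
Proof. by move=> fa; apply: der_comp. Qed.

Lemma der_ln f x a : 0 < f x -> is_derive x 1 f a ->
  is_derive x 1 (fun y => ln (f y)) (a / f x).
Proof.
by move=> f0 fa; rewrite mulrC; apply: der_comp fa; exact: is_derive1_ln.
Qed.

Lemma derivable1_is_derive f x a : derivable f x 1 -> derive1 f x = a ->
  is_derive x 1 f a.
Proof. by move=> df <-; rewrite derive1E; exact: derivableP. Qed.

Lemma der_cont f x a : is_derive x 1 f a -> {for x, continuous f}.
Proof. by move=> [h _]; apply/differentiable_continuous/derivable1_diffP. Qed.

Definition prim_of F f := forall x, is_derive x 1 F (f x).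

Lemma prim_cont F f : prim_of F f -> continuous F.
Proof. by move=> h x; exact: (der_cont (h x)). Qed.

End Calculus.

(** The rule is selected by the shape of the function while the derivative is an existential
    variable; [der] thus leaves the identity with the announced value, plus the side conditions of
    inverses and logarithms. *)
Ltac der1 :=
  match goal with
  | |- is_derive _ _ (fun _ => ?c) _ => exact: der_cst
  | |- is_derive _ _ (fun y => y) _ => exact: der_id
  | |- is_derive _ _ (fun y => @?f y + @?g y) _ => eapply (derD (f := f) (g := g))
  | |- is_derive _ _ (fun y => - (@?f y)) _ => eapply (derN (f := f))
  | |- is_derive _ _ (fun y => @?f y * @?g y) _ => eapply (derM (f := f) (g := g))
  | |- is_derive _ _ (fun y => (@?f y) ^+ _.+1) _ => eapply (derX (f := f))
  | |- is_derive _ _ (fun y => (@?f y)^-1) _ => eapply (derV (f := f))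
  | |- is_derive _ _ (fun y => expR (@?f y)) _ => eapply (der_exp (f := f))
  | |- is_derive _ _ (fun y => ln (@?f y)) _ => eapply (der_ln (f := f))
  | H : is_derive ?x _ ?f _ |- is_derive ?x _ ?f _ => exact: H
  | H : is_derive ?x _ ?f _ |- is_derive ?x _ (fun y => ?f y) _ => exact: H
  | H : prim_of ?f _ |- is_derive _ _ ?f _ => exact: H
  | H : prim_of ?f _ |- is_derive _ _ (fun y => ?f y) _ => exact: H
  | H : prim_of ?f _ |- is_derive _ _ (fun y => ?f (@?g y)) _ =>
      eapply (der_comp (f := f) (g := g)); [exact: H |]
  end.
Ltac der := eapply is_derive_eq; [repeat der1 | ].

(** * Mean value inequalities, zeros and primitives *)

Section MeanValue.
Context {R : realType}.
Implicit Types (f g F : R -> R) (x a b : R).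

Lemma le_der f df a b : a <= b ->
  (forall x, a <= x <= b -> is_derive x 1 f (df x)) ->
  (forall x, a <= x <= b -> 0 <= df x) -> f a <= f b.
Proof.
rewrite le_eqVlt => /predU1P[->//|ab] fd df0.
have [||c] := @MVT R f df a b ab.
- by move=> x /[!in_itv]/= /andP[/ltW ax /ltW xb]; apply: fd; rewrite ax.
- apply/continuous_within_itvP => //; split.
  + move=> x /[!in_itv]/= /andP[/ltW ax /ltW xb].
    by apply: (der_cont (a := (df x))); apply: fd; rewrite ax.
  + apply: cvg_at_right_filter.
    by apply: (der_cont (a := (df a))); apply: fd; rewrite lexx ltW.
  + apply: cvg_at_left_filter.
    by apply: (der_cont (a := (df b))); apply: fd; rewrite lexx ltW.
move=> /[!in_itv]/= /andP[ac cb] e; rewrite -subr_ge0 e mulr_ge0//.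
  by apply: df0; rewrite !ltW.
by rewrite subr_ge0 ltW.
Qed.

Lemma le_der2 f g df dg a b : a <= b ->
  (forall x, a <= x <= b -> is_derive x 1 f (df x)) ->
  (forall x, a <= x <= b -> is_derive x 1 g (dg x)) ->
  (forall x, a <= x <= b -> df x <= dg x) -> f b - f a <= g b - g a.
Proof.
move=> ab fd gd h.
have := le_der (f := fun x => g x - f x) (df := fun x => dg x - df x) ab.
have -> : (g a - f a <= g b - f b) = (f b - f a <= g b - g a).
  by apply/idP/idP; lra.
apply.
  by move=> x xab; have := fd x xab; have := gd x xab => ? ?; der; ring.
by move=> x xab; rewrite subr_ge0; exact: h.
Qed.

Lemma norm_der f g df dg a b : a <= b ->
  (forall x, a <= x <= b -> is_derive x 1 f (df x)) ->
  (forall x, a <= x <= b -> is_derive x 1 g (dg x)) ->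
  (forall x, a <= x <= b -> `|df x| <= dg x) -> `|f b - f a| <= g b - g a.
Proof.
move=> ab fd gd h; rewrite ler_norml; apply/andP; split; last first.
  apply: (le_der2 ab fd gd) => x /h; exact: le_trans (ler_norm _).
rewrite lerNl.
suff : (- f b) - (- f a) <= g b - g a by rewrite opprB opprK addrC.
apply: (le_der2 (f := fun x => - f x) (g := g) (df := fun x => - df x) (dg := dg)) => //.
  by move=> x /fd ?; der.
move=> x /h; apply: le_trans; rewrite -normrN; exact: ler_norm.
Qed.

Lemma cst_der f a b : a <= b ->
  (forall x, a <= x <= b -> is_derive x 1 f 0) -> f a = f b.
Proof.
move=> ab fd.
apply/eqP; rewrite eq_sym -subr_eq0 -normr_le0.
have h : `|f b - f a| <= (fun=> 0 : R) b - (fun=> 0 : R) a.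
  apply: (norm_der (f := f) (g := fun=> 0) (df := fun=> 0) (dg := fun=> 0) ab) => //.
  by rewrite normr0.
by rewrite (le_trans h)// subr0.
Qed.

Lemma cst_prim f a b : prim_of f (fun=> 0) -> f a = f b.
Proof.
by move=> h; case: (leP a b) => [|/ltW] ab; [|apply/esym]; apply: cst_der.
Qed.

Lemma lt_der f df a b : a < b ->
  (forall x, a <= x <= b -> is_derive x 1 f (df x)) ->
  (forall x, a <= x <= b -> 0 < df x) -> f a < f b.
Proof.
move=> ab fd df0; rewrite lt_neqAle; apply/andP; split; last first.
  by apply: le_der fd _ => [|x /df0]; exact: ltW.
apply/eqP => e; have [||c] := @MVT R f df a b ab.
- by move=> x /[!in_itv]/= /andP[/ltW ax /ltW xb]; apply: fd; rewrite ax.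
- apply/continuous_within_itvP => //; split.
  + move=> x /[!in_itv]/= /andP[/ltW ax /ltW xb].
    by apply: (der_cont (a := (df x))); apply: fd; rewrite ax.
  + apply: cvg_at_right_filter.
    by apply: (der_cont (a := (df a))); apply: fd; rewrite lexx ltW.
  + apply: cvg_at_left_filter.
    by apply: (der_cont (a := (df b))); apply: fd; rewrite lexx ltW.
move=> /[!in_itv]/= /andP[ac cb]; rewrite e subrr => /esym/eqP.
rewrite mulf_eq0 subr_eq0 (gt_eqF ab) orbF gt_eqF//.
by apply: df0; rewrite !ltW.
Qed.

Lemma ivt0 f a b : a <= b -> continuous f -> f a * f b <= 0 ->
  exists2 c, a <= c <= b & f c = 0.
Proof.
move=> ab cf fab; have [||c] := @IVT R f a b 0 ab.
- by apply: continuous_subspaceT.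
- rewrite ge_min le_max.
  case: (ltP 0 (f a)) => fa; case: (leP 0 (f b)) => fb /=; rewrite ?orbT//=.
  + by rewrite andbT; move: fab; rewrite pmulr_rle0.
  + by rewrite (ltW fb) (ltW fa).
  + move: fab; rewrite orbF; case: (ltgtP (f a) 0) fa => // fa _.
    by rewrite leNgt nmulr_rgt0// fb.
by rewrite in_itv/= => h e; exists c.
Qed.

Lemma bounded_seg f a b : a <= b -> continuous f ->
  exists2 M, 0 < M & forall x, a <= x <= b -> `|f x| <= M.
Proof.
move=> ab cf; have [|c cab h] := @EVT_max R (fun x => `|f x|) a b ab.
  apply: continuous_subspaceT => x; apply: continuous_comp; first exact: cf.
  exact: norm_continuous.
exists (`|f c| + 1) => [|x xab]; first by rewrite ltr_wpDl.
by rewrite (le_trans (h x _)) ?in_itv// lerDl.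
Qed.

(** The fundamental theorem differentiates at [x] only integrals that start strictly to the left of
    [x]. The integrals from [- n], normalised at 0, agree where they are both valid because their
    difference has derivative 0; they are glued by letting the starting point depend on [x]. *)
Lemma prim_exists f : continuous f ->
  exists F, F 0 = 0 /\ prim_of F f.
Proof.
move=> cf.
pose I (n x : R) : R :=
  (\int[lebesgue_measure]_(t in `[(- n)%R, x]) f t)%R.
have dI n x : - n < x -> is_derive x 1 (I n) (f x).
  move=> nx.
  have xx : x < x + 1 by rewrite ltrDl.
  have intf : lebesgue_measure.-integrable `[(- n), (x + 1)] (EFin \o f).
    apply: continuous_compact_integrable; first exact: segment_compact.
    exact: continuous_subspaceT.
  have [dIx eIx] := continuous_FTC1_closed xx intf nx (cf x).
  exact: derivable1_is_derive dIx eIx.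
pose G n x := I n x - I n 0.
have dG n x : - n < x -> is_derive x 1 (G n) (f x).
  move=> nx; have ? := dI _ _ nx; rewrite /G; der; ring.
have GG m n x : `|x| < m -> `|x| < n -> G m x = G n x.
  move=> xm xn; pose D y := G m y - G n y.
  have dD y : - m < y -> - n < y -> is_derive y 1 D 0.
    move=> my ny; have ? := dG _ _ my; have ? := dG _ _ ny.
    by rewrite /D; der; ring.
  have m0 : 0 < m by rewrite (le_lt_trans _ xm).
  have n0 : 0 < n by rewrite (le_lt_trans _ xn).
  have D0 : D 0 = 0 by rewrite /D /G !subrr.
  suff : D x = 0 by rewrite /D => /eqP; rewrite subr_eq0 => /eqP.
  rewrite -D0; move: xm xn; rewrite !ltr_norml => /andP[? ?] /andP[? ?].
  case: (leP x 0) => x0; [|apply/esym]; apply: cst_der; rewrite ?(ltW x0)//.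
    by move=> y /andP[? ?]; apply: dD; lra.
  by move=> y /andP[? ?]; apply: dD; lra.
exists (fun x => G (`|x| + 1) x); split; first by rewrite /G subrr.
move=> x; have xx : - (`|x| + 2) < x.
  by have := ler_norm (- x); rewrite normrN; lra.
apply: near_eq_is_derive (dG (`|x| + 2) x xx).
have : \forall y \near x, ball x 1 y by exact: nbhsx_ballx.
apply: filterS => y; rewrite /ball/= => xy; apply: GG; last by rewrite ltrDl.
rewrite -[y](subrK x) (le_lt_trans (ler_normD _ _))// distrC.
by move: xy; lra.
Qed.

End MeanValue.

(** * The equation y'' = Q y *)

Section ODE.
Context {R : realType}.
Implicit Types (y dy z dz Q f g : R -> R).

Definition sol Q y dy := prim_of y dy /\ prim_of dy (fun t => Q t * y t).

(* The energy y^2 + y'^2 grows at most exponentially in both directions. *)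
Lemma ode_zero y dy g (M a b t0 : R) :
  a <= t0 <= b -> (forall t, a <= t <= b -> is_derive t 1 y (dy t)) ->
  (forall t, a <= t <= b -> is_derive t 1 dy (g t)) ->
  (forall t, a <= t <= b -> `|g t| <= M * `|y t|) ->
  y t0 = 0 -> dy t0 = 0 -> forall t, a <= t <= b -> y t = 0.
Proof.
move=> /andP[at0 t0b] dyP gP gM y0 dy0 t /andP[ate teb].
pose E s := y s ^+ 2 + dy s ^+ 2.
pose dE s := 2 * y s * dy s + 2 * dy s * g s.
have dEP s : a <= s <= b -> is_derive s 1 E (dE s).
  by move=> sab; have ? := dyP s sab; have ? := gP s sab; rewrite /E /dE; der; ring.
have ME s : a <= s <= b -> `|dE s| <= (1 + `|M|) * E s.
  move=> sab; have h := gM s sab; rewrite /dE /E.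
  have h' : `|g s| <= `|M| * `|y s|.
    by rewrite (le_trans h)// ler_wpM2r// ler_norm.
  rewrite (le_trans (ler_normD _ _))// !normrM !(ger0_norm (ler0n R 2)).
  rewrite -(real_normK (num_real (y s))) -(real_normK (num_real (dy s))).
  have := normr_ge0 (y s); have := normr_ge0 (dy s); have := normr_ge0 M.
  move: h'; set p := `|y s|; set q := `|dy s|; set m := `|M|; set r := `|g s|.
  move=> h' m0 q0 p0.
  have h1 : q * r <= q * (m * p) by rewrite ler_wpM2l.
  have h2 : 2 * (p * q) <= p ^+ 2 + q ^+ 2 by have := sqr_ge0 (p - q); lra.
  have h3 : m * (2 * (p * q)) <= m * (p ^+ 2 + q ^+ 2) by rewrite ler_wpM2l.
  by lra.
have E0 s : 0 <= E s by rewrite addr_ge0 ?sqr_ge0.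
have Et0 : E t0 = 0 by rewrite /E y0 dy0 expr0n addr0.
set K := 1 + `|M| in ME.
suff : E t <= 0.
  move=> Et; have := sqr_ge0 (y t); have := sqr_ge0 (dy t) => h1 h2.
  by apply/eqP; rewrite -sqrf_eq0 eq_le sqr_ge0 andbT; move: Et; rewrite /E; lra.
(* Multiplied by [expR (- K * s)] the energy is nonincreasing, multiplied by [expR (K * s)] it is
   nondecreasing; each weight propagates the zero at [t0] in one direction. *)
case: (leP t0 t) => [t0t|/ltW tt0].
  have := @le_der R (fun s => - (E s * expR (- K * s)))
    (fun s => - ((dE s - K * E s) * expR (- K * s))) t0 t t0t.
  have /[swap]/[apply] : forall x, t0 <= x <= t -> is_derive x 1
      (fun s => - (E s * expR (- K * s))) (- ((dE x - K * E x) * expR (- K * x))).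
    move=> x /andP[? ?]; have ? : is_derive x 1 E (dE x) by apply: dEP; lra.
    by der; ring.
  rewrite Et0 mul0r oppr0 oppr_ge0 => h.
  rewrite -(pmulr_lle0 _ (expR_gt0 (- K * t))); apply: h => x /andP[? ?].
  rewrite oppr_ge0 pmulr_lle0 ?expR_gt0// subr_le0.
  by rewrite (le_trans (ler_norm _))// ME//; lra.
have := @le_der R (fun s => E s * expR (K * s))
  (fun s => (dE s + K * E s) * expR (K * s)) t t0 tt0.
have /[swap]/[apply] : forall x, t <= x <= t0 -> is_derive x 1
    (fun s => E s * expR (K * s)) ((dE x + K * E x) * expR (K * x)).
  move=> x /andP[? ?]; have ? : is_derive x 1 E (dE x) by apply: dEP; lra.
  by der; ring.
rewrite Et0 mul0r => h.
rewrite -(pmulr_lle0 _ (expR_gt0 (K * t))); apply: h => x /andP[? ?].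
apply: mulr_ge0 (expR_ge0 _); have : `|dE x| <= K * E x by apply: ME; lra.
by rewrite ler_norml => /andP[]; lra.
Qed.

Lemma sol_eq Q y dy z dz t0 : continuous Q -> sol Q y dy -> sol Q z dz ->
  y t0 = z t0 -> dy t0 = dz t0 -> y = z /\ dy = dz.
Proof.
move=> cQ [hy hdy] [hz hdz] e0 e1.
have e : y = z.
  apply/funext => t; apply/eqP; rewrite -subr_eq0; apply/eqP.
  pose a := Num.min t t0; pose b := Num.max t t0.
  have ab : a <= b by rewrite le_max !ge_min lexx.
  have [M M0 QM] := bounded_seg ab cQ.
  apply: (@ode_zero (fun s => y s - z s) (fun s => dy s - dz s)
    (fun s => Q s * (y s - z s)) M a b t0).
  - by rewrite ge_min le_max lexx !orbT.
  - by move=> s _; der.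
  - by move=> s _; der; ring.
  - by move=> s sab; rewrite normrM ler_wpM2r// QM.
  - by rewrite e0 subrr.
  - by rewrite e1 subrr.
  - by rewrite ge_min le_max lexx.
split=> //; apply/funext => t.
have [_ <-] := hy t; have [_ <-] := hz t; by rewrite e.
Qed.

(** The sequences [v] and [w], obtained by shifting [u] down and up by the remaining geometric tail,
    are monotone and enclose [u]; the limit is the supremum of [v]. *)
Lemma geometric_cvg (u : nat -> R) (C : R) :
  (forall n, `|u n.+1 - u n| <= C * 2^-1 ^+ n) ->
  forall n, `|lim (u @ \oo) - u n| <= 2 * C * 2^-1 ^+ n.
Proof.
move=> uC.
pose v n := u n - 2 * C * 2^-1 ^+ n; pose w n := u n + 2 * C * 2^-1 ^+ n.
have C0 : 0 <= C by have := uC 0; rewrite expr0 mulr1; exact: le_trans.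
have vS : nondecreasing_seq v.
  apply/nondecreasing_seqP => n; have := uC n; rewrite ler_norml => /andP[+ _].
  by rewrite /v exprS; set p := _ ^+ n; lra.
have wS : nonincreasing_seq w.
  apply/nonincreasing_seqP => n; have := uC n; rewrite ler_norml => /andP[_].
  by rewrite /w exprS; set p := _ ^+ n; lra.
have vw n m : v n <= w m.
  apply: (le_trans (vS _ _ (leq_maxl n m))).
  apply: (le_trans _ (wS _ _ (leq_maxr n m))).
  have : 0 <= 2 * C * 2^-1 ^+ (maxn n m) by rewrite !mulr_ge0// exprn_ge0.
  by rewrite /v /w; lra.
pose l := sup (range v).
have hl n : `|l - u n| <= 2 * C * 2^-1 ^+ n.
  have h1 : v n <= l.
    apply: ub_le_sup; last by exists n.
    by exists (w 0) => _ [m _ <-].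
  have h2 : l <= w n.
    apply: ge_sup; first by exists (v 0), 0%N.
    by move=> _ [m _ <-].
  by rewrite ler_norml; move: h1 h2; rewrite /v /w => ? ?; apply/andP; split; lra.
suff -> : lim (u @ \oo) = l by [].
apply/cvg_lim; first exact: Rhausdorff.
have h0 : (fun n => 2 * C * 2^-1 ^+ n) @ \oo --> (0 : R).
  rewrite -(mulr0 (2 * C)); apply: cvgMl_tmp; apply: cvg_expr.
  by rewrite ger0_norm//; lra.
apply/cvgrPdist_le => e e0.
move/cvgrPdist_le : h0 => /(_ e e0); apply: filterS => n.
rewrite sub0r normrN => h; apply: (le_trans (hl n)).
exact: le_trans (ler_norm _) h.
Qed.

(** The primitive of [f] vanishing at 0. The arbitrary value at a discontinuous [f] makes [J] total,
    so that iterates can be formed before they are known to be continuous. *)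
Let J f : R -> R :=
  if pselect (continuous f) is left cf then sval (cid (prim_exists cf)) else f.

Let JP f : continuous f -> J f 0 = 0 /\ prim_of (J f) f.
Proof. by rewrite /J; case: pselect => // cf _; case: cid. Qed.

Let J_cont f : continuous f -> continuous (J f).
Proof. by move=> /JP[_ /prim_cont]. Qed.

(** In the norm weighted by [expR (L * |t|)] one integration gains a factor 1/L, because the weight
    is its own derivative up to [L]. *)
Let J_lip f g (A L c : R) : continuous f -> continuous g -> 0 < L -> 0 <= c ->
  (forall t, `|t| <= A -> `|f t - g t| <= c * expR (L * `|t|)) ->
  forall t, `|t| <= A -> `|J f t - J g t| <= c / L * expR (L * `|t|).
Proof.
move=> cf cg L0 c0 fg t tA; have [f0 hf] := JP cf; have [g0 hg] := JP cg.
have e0 : (fun s => J f s - J g s) 0 = 0 by rewrite f0 g0 subrr.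
have cL : 0 <= c / L by rewrite divr_ge0// ltW.
have cancel x : c / L * (L * x) = c * x by field; rewrite gt_eqF.
move: tA; case: (leP 0 t) => [t0|/ltW t0] tA.
  rewrite (ger0_norm t0) in tA *.
  have := @norm_der R (fun s => J f s - J g s) (fun s => c / L * expR (L * s))
    (fun s => f s - g s) (fun s => c * expR (L * s)) 0 t t0.
  rewrite e0 subr0 mulr0 expR0 mulr1 => h; apply: (le_trans (h _ _ _)).
  - by move=> x _; der.
  - by move=> x _; der; rewrite mul0r add0r mulr1 mul0r add0r (mulrC _ L) cancel.
  - by move=> x /andP[x0 xt]; have := fg x; rewrite (ger0_norm x0); apply; lra.
  - by lra.
rewrite (ler0_norm t0) in tA *.
have := @norm_der R (fun s => J f s - J g s) (fun s => - (c / L * expR (- L * s)))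
  (fun s => f s - g s) (fun s => c * expR (- L * s)) t 0 t0.
rewrite e0 sub0r normrN mulr0 expR0 mulr1 => h; apply: (le_trans (h _ _ _)).
- by move=> x _; der.
- move=> x _; der; rewrite mul0r add0r mulr1 mul0r add0r -mulrN -[RHS]cancel.
  ring.
- move=> x /andP[tx x0]; have := fg x; rewrite (ler0_norm x0) mulrN mulNr.
  by apply; lra.
- by rewrite mulNr mulrN; lra.
Qed.

(** * Picard iteration for the twice integrated equation *)

Section Picard.
Variables (Q : R -> R) (c0 c1 : R).
Hypothesis cQ : continuous Q.

Let l t := c0 + c1 * t.
Let step f t := l t + J (J (fun s => Q s * f s)) t.
Let u n := iter n step l.

Let l_cont : continuous l.
Proof. by move=> t; apply: (@der_cont R _ _ c1); rewrite /l; der; ring. Qed.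

Let Qf_cont f : continuous f -> continuous (fun s => Q s * f s).
Proof. by move=> cf t; apply: cvgM; [exact: cQ|exact: cf]. Qed.

Let step_cont f : continuous f -> continuous (step f).
Proof.
move=> cf t; apply: cvgD; first exact: l_cont.
by apply: J_cont; apply: J_cont; exact: Qf_cont.
Qed.

Let u_cont n : continuous (u n).
Proof. by elim: n => [|n IH]; [exact: l_cont|exact: step_cont]. Qed.

Let step_lip (A : R) : exists2 L : R, 0 < L & forall f g (c : R),
  continuous f -> continuous g -> 0 <= c ->
  (forall t, `|t| <= A -> `|f t - g t| <= c * expR (L * `|t|)) ->
  forall t, `|t| <= A -> `|step f t - step g t| <= c / 2 * expR (L * `|t|).
Proof.
case: (leP 0 A) => A0; last first.
  exists 1 => // f g c _ _ _ _ t tA.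
  by have := normr_ge0 t; rewrite leNgt (le_lt_trans tA A0).
have AA : - A <= A by lra.
have [M M0 QM] := bounded_seg AA cQ.
exists (1 + 2 * M) => [|f g c cf cg c0' fg t tA]; first lra.
(* With this choice [2 * M <= L * L]: the factor [M] of the potential and two integrations together
   contract by 1/2 on the whole interval, however long. *)
set L := 1 + 2 * M in fg *; have L0 : 0 < L by rewrite /L; lra.
have h1 : forall s, `|s| <= A ->
    `|J (fun s => Q s * f s) s - J (fun s => Q s * g s) s| <=
      M * c / L * expR (L * `|s|).
  apply: J_lip => //; try exact: Qf_cont; first by rewrite mulr_ge0// ltW.
  move=> s sA; rewrite -mulrBr normrM -mulrA ler_pM//; last exact: fg.
  by apply: QM; rewrite -ler_norml.
have h2 := J_lip (J_cont (Qf_cont cf)) (J_cont (Qf_cont cg)) L0 _ h1 tA.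
rewrite /step opprD addrACA subrr add0r (le_trans (h2 _))//.
  by rewrite !mulr_ge0// ?invr_ge0 ltW.
rewrite ler_wpM2r ?expR_ge0// !ler_pdivrMr//.
have LL : 2 * M <= L * L by rewrite /L; nra.
have : c * (2 * M) <= c * (L * L) by rewrite ler_wpM2l.
by lra.
Qed.

Let u_geo (A : R) : exists C : R, forall t, `|t| <= A -> forall n,
  `|u n.+1 t - u n t| <= C * 2^-1 ^+ n.
Proof.
have [L L0 sL] := step_lip A.
have [c c0' h0] : exists2 c : R, 0 <= c &
    forall t, `|t| <= A -> `|u 1 t - u 0 t| <= c * expR (L * `|t|).
  have [M M0 h] := @bounded_seg R (fun t => u 1 t - u 0 t) (- `|A|) `|A|
     (ge0_cp (normr_ge0 A)).2 (fun t => cvgB (@u_cont 1 t) (@u_cont 0 t)).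
  exists M => [|t tA]; first exact: ltW.
  rewrite (le_trans (h t _))//.
    by rewrite -ler_norml (le_trans tA)// ler_norm.
  by rewrite ler_peMr ?(ltW M0)// -expR0 ler_expR mulr_ge0// ltW.
exists (c * expR (L * A)) => t tA n.
have : `|u n.+1 t - u n t| <= c * 2^-1 ^+ n * expR (L * `|t|).
  elim: n t tA => [|n IH] t tA; first by rewrite expr0 mulr1 h0.
  rewrite exprSr mulrA; apply: (sL (u n.+1) (u n)) => //.
  by rewrite mulr_ge0// exprn_ge0.
move=> /le_trans; apply; rewrite mulrAC ler_wpM2r ?exprn_ge0//.
by rewrite ler_wpM2l// ler_expR ler_wpM2l// ltW.
Qed.

Let v t := lim (u ^~ t @ \oo).

Let v_geo (A : R) : exists2 C : R, 0 <= C & forall t, `|t| <= A -> forall n,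
  `|v t - u n t| <= C * 2^-1 ^+ n.
Proof.
have [C h] := u_geo A; exists `|2 * C| => // t tA n.
rewrite (le_trans (geometric_cvg (h t tA) n))//.
by rewrite ler_wpM2r ?exprn_ge0// ler_norm.
Qed.

Let half_small (C e : R) : 0 <= C -> 0 < e ->
  exists n : nat, C * 2^-1 ^+ n < e.
Proof.
move=> C0 e0.
have h0 : (fun n => C * 2^-1 ^+ n) @ \oo --> (0 : R).
  rewrite -(mulr0 C); apply: cvgMl_tmp; apply: cvg_expr.
  by rewrite ger0_norm//; lra.
move/cvgrPdist_lt : h0 => /(_ e e0) [n _ /(_ n (leqnn _))] /=.
by rewrite sub0r normrN => h; exists n; rewrite (le_lt_trans (ler_norm _)).
Qed.

Let v_cont : continuous v.
Proof.
move=> t; have [C C0 h] := v_geo (`|t| + 1).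
apply/cvgrPdist_lt => e e0.
have e3 : 0 < e / 3 by lra.
have [n hn] := half_small C0 e3.
have /cvgrPdist_lt/(_ _ e3) hu := @u_cont n t.
have h1 : \forall s \near t, ball t 1 s by exact: nbhsx_ballx.
near=> s.
have st : `|u n t - u n s| < e / 3 by near: s.
have hs : `|v s - u n s| < e / 3.
  apply: le_lt_trans hn; apply: h.
  have : ball t 1 s by near: s.
  rewrite /ball/= => ts; rewrite -[s](subrK t) (le_trans (ler_normD _ _))// distrC.
  by lra.
have ht : `|v t - u n t| < e / 3 by apply: le_lt_trans hn; apply: h; lra.
have -> : v t - v s = (v t - u n t) + (u n t - u n s) - (v s - u n s) by ring.
rewrite (le_lt_trans (ler_normB _ _))// (_ : e = e / 3 + e / 3 + e / 3); last lra.
by rewrite ltrD// (le_lt_trans (ler_normD _ _))// ltrD.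
Unshelve. all: by end_near. Qed.

(** Both sides are within a multiple of 2^-n of [u n.+1 = step (u n)], the right one because [step]
    is a contraction in the weighted norm. *)
Let v_fix t : v t = step v t.
Proof.
have [L L0 sL] := step_lip `|t|.
have [C C0 h] := v_geo `|t|.
apply/eqP; rewrite -subr_eq0 -normr_le0; apply/ler_addgt0Pr => e e0.
rewrite add0r.
have K0 : 0 <= C * (1 + expR (L * `|t|)) by rewrite mulr_ge0// addr_ge0// expR_ge0.
have [n hn] := half_small K0 e0.
apply: ltW; apply: le_lt_trans hn.
have h2 : `|step v t - step (u n) t| <=
    (C * 2^-1 ^+ n) / 2 * expR (L * `|t|).
  apply: (sL v (u n)) => //; first by rewrite mulr_ge0// exprn_ge0.
  move=> s st; rewrite (le_trans (h s st n))//.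
  rewrite ler_peMr ?mulr_ge0// ?exprn_ge0//.
  by rewrite -expR0 ler_expR mulr_ge0// ltW.
have h1 := h t (lexx _) n.+1.
have -> : v t - step v t = (v t - u n.+1 t) - (step v t - step (u n) t).
  by rewrite opprB addrA subrK.
rewrite (le_trans (ler_normB _ _))// (le_trans (lerD h1 h2))//.
have := expR_gt0 (L * `|t|); rewrite exprS.
have : 0 <= C * 2^-1 ^+ n by rewrite mulr_ge0// exprn_ge0.
set p := 2^-1 ^+ n; set E := expR _ => Cp E0.
have : 0 <= C * p * E by rewrite mulr_ge0// ltW.
by lra.
Qed.

Lemma sol_exists0 : exists y dy, [/\ sol Q y dy, y 0 = c0 & dy 0 = c1].
Proof.
have cQv := Qf_cont v_cont.
have [J0 hJ] := JP cQv; have [K0 hK] := JP (J_cont cQv).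
exists v, (fun t => c1 + J (fun s => Q s * v s) t); split.
- split; last by move=> t; der; rewrite add0r.
  have e : step v = v by apply/esym/funext => t; exact: v_fix.
  move=> t; suff : is_derive t 1 (step v) (c1 + J (fun s => Q s * v s) t).
    by rewrite e.
  by rewrite /step /l; der; ring.
- by rewrite v_fix /step /l K0; ring.
- by rewrite J0 addr0.
Qed.

End Picard.

Lemma sol_lin Q y dy z dz (a b : R) : sol Q y dy -> sol Q z dz ->
  sol Q (fun t => a * y t + b * z t) (fun t => a * dy t + b * dz t).
Proof. by move=> [? ?] [? ?]; split=> t; der; ring. Qed.

Lemma wronskian_cst Q y dy z dz (s t : R) : sol Q y dy -> sol Q z dz ->
  y s * dz s - dy s * z s = y t * dz t - dy t * z t.
Proof.
move=> [? ?] [? ?].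
by apply: (@cst_prim R (fun t => y t * dz t - dy t * z t)) => x; der; ring.
Qed.

Lemma sol_span Q y dy z dz w dw : continuous Q ->
  sol Q y dy -> sol Q z dz -> sol Q w dw -> y 0 * dz 0 - dy 0 * z 0 = 1 ->
  exists a b, w = (fun t => a * y t + b * z t) /\
              dw = (fun t => a * dy t + b * dz t).
Proof.
move=> cQ hy hz hw W1.
exists (w 0 * dz 0 - dw 0 * z 0), (y 0 * dw 0 - dy 0 * w 0).
apply: (sol_eq (t0 := 0) cQ hw (sol_lin _ _ hy hz)).
  by rewrite -[LHS]mulr1 -W1; ring.
by rewrite -[LHS]mulr1 -W1; ring.
Qed.

(** Cramer's rule at [t0] for the fundamental pair with unit data at 0; their Wronskian is 1
    everywhere, so no division occurs. *)
Lemma sol_exists Q (t0 c0 c1 : R) : continuous Q ->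
  exists y dy, [/\ sol Q y dy, y t0 = c0 & dy t0 = c1].
Proof.
move=> cQ.
have [y [dy [hy y0 dy0]]] := sol_exists0 1 0 cQ.
have [z [dz [hz z0 dz0]]] := sol_exists0 0 1 cQ.
have W : y t0 * dz t0 - dy t0 * z t0 = 1.
  by rewrite (wronskian_cst t0 0 hy hz) y0 dy0 z0 dz0; ring.
exists (fun t => (c0 * dz t0 - c1 * z t0) * y t + (y t0 * c1 - dy t0 * c0) * z t).
exists (fun t => (c0 * dz t0 - c1 * z t0) * dy t + (y t0 * c1 - dy t0 * c0) * dz t).
split; first exact: sol_lin.
  by rewrite -[RHS]mulr1 -W; ring.
by rewrite -[RHS]mulr1 -W; ring.
Qed.

(* A second solution is obtained by rotating the initial data (y, y') of a
   nonzero solution, the square of whose length becomes the Wronskian. *)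
Lemma sol_complement Q y dy t0 : continuous Q -> sol Q y dy -> y t0 != 0 ->
  exists z dz, sol Q z dz /\ forall t, y t * dz t - dy t * z t = 1.
Proof.
move=> cQ hy yt0.
(* The data [(0, 1 / y t0)] at [t0] give Wronskian [y t0 / y t0 = 1] there, hence everywhere. *)
have [z [dz [hz z0 dz0]]] := sol_exists t0 0 (y t0)^-1 cQ.
exists z, dz; split=> // t; rewrite (wronskian_cst t t0 hy hz) z0 dz0.
by rewrite mulr0 subr0 divff.
Qed.

Lemma sol_reflect Q y dy : sol Q y dy ->
  sol (fun t => Q (- t)) (fun t => y (- t)) (fun t => - dy (- t)).
Proof. by move=> [? ?]; split=> t; der; ring. Qed.

End ODE.

(** * Asymptotics at infinity *)

Section Asymptotics.
Context {R : realType}.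
Implicit Types (y dy z dz Q f g : R -> R) (k th C T a b t : R).

Lemma near_pinftyP (P : R -> Prop) :
  (\forall t \near +oo, P t) <-> exists T, forall t, T <= t -> P t.
Proof.
split=> [[M [_ h]]|[T h]].
  by exists (M + 1) => t Mt; apply: h; rewrite (lt_le_trans _ Mt)// ltrDl.
by exists T; split; [exact: num_real|move=> t /ltW; exact: h].
Qed.

Lemma cvg_pinfty_le f l : f t @[t --> +oo] --> l <->
  forall e, 0 < e -> exists T, forall t, T <= t -> `|f t - l| <= e.
Proof.
split=> [/cvgrPdist_le h e e0|h].
  have /near_pinftyP[T hT] := h e e0; exists T => t /hT.
  by rewrite distrC.
apply/cvgrPdist_le => e e0; apply/near_pinftyP.
by have [T hT] := h e e0; exists T => t /hT; rewrite distrC.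
Qed.

Lemma expR_mul_cvgy (c : R) : 0 < c -> expR (c * t) @[t --> +oo] --> +oo.
Proof.
move=> c0; apply/cvgryPge => A; apply/near_pinftyP; exists (A / c) => t At.
rewrite (le_trans _ (expR_ge1Dx _))//.
by move: At; rewrite ler_pdivrMr// mulrC; lra.
Qed.

Lemma expR_mulN_cvg0 (c : R) : 0 < c -> expR (- c * t) @[t --> +oo] --> (0 : R).
Proof.
move=> c0; under eq_fun do rewrite mulNr expRN.
apply/gtr0_cvgV0; last exact: expR_mul_cvgy.
by near=> t; exact: expR_gt0.
Unshelve. all: by end_near. Qed.

(** Beyond [T3] the derivative of [f - g] is at most [e / 2] times that of [g], so [f - g] is
    bounded by its value at [T3] plus [e / 2 * g]. As [g] tends to infinity, that fixed value is in
    turn below [e / 2 * g]. *)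
Lemma lhopital_ratio f df g dg T :
  (forall t, T <= t -> is_derive t 1 f (df t)) ->
  (forall t, T <= t -> is_derive t 1 g (dg t)) ->
  (forall t, T <= t -> 0 < dg t) ->
  df t / dg t @[t --> +oo] --> (1 : R) -> g t @[t --> +oo] --> +oo ->
  f t / g t @[t --> +oo] --> (1 : R).
Proof.
move=> hf hg dg0 /cvg_pinfty_le h /cvgryPge gy; apply/cvg_pinfty_le => e e0.
have e2 : 0 < e / 2 by lra.
have [T1 h1] := h _ e2; have /near_pinftyP[T2 h2] := gy 1.
pose T3 := Num.max T (Num.max T1 T2).
have [TT3 TT1 TT2] : [/\ T <= T3, T1 <= T3 & T2 <= T3].
  by rewrite /T3 !le_max !lexx !orbT.
pose K := `|f T3 - g T3|.
have /near_pinftyP[T4 h4] := gy (K / (e / 2)).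
exists (Num.max T3 T4) => t; rewrite ge_max => /andP[T3t T4t].
have gt0 : 0 < g t by rewrite (lt_le_trans ltr01)// h2// (le_trans TT2).
rewrite -(ler_pM2r gt0) -{2}(gtr0_norm gt0) -normrM mulrBl divfK ?gt_eqF// mul1r.
have : `|(f t - g t) - (f T3 - g T3)| <= e / 2 * g t - e / 2 * g T3.
  apply: (@norm_der R (fun s => f s - g s) (fun s => e / 2 * g s)
    (fun s => df s - dg s) (fun s => e / 2 * dg s)); [exact: T3t|..] => s /andP[T3s _].
  - have ? := hf _ (le_trans TT3 T3s); have ? := hg _ (le_trans TT3 T3s).
    by der.
  - by have ? := hg _ (le_trans TT3 T3s); der; ring.
  - have dgs := dg0 _ (le_trans TT3 T3s).
    have dgV : 0 < (dg s)^-1 by rewrite invr_gt0.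
    rewrite -(ler_pM2r dgV) mulfK ?gt_eqF// -[X in _ * X](gtr0_norm dgV).
    by rewrite -normrM mulrBl divff ?gt_eqF// h1// (le_trans TT1).
have K4 : K <= e / 2 * g t by rewrite mulrC -ler_pdivrMr// h4.
have gT3 : 0 <= e / 2 * g T3 by rewrite mulr_ge0 ?ltW// (lt_le_trans ltr01)// h2.
move=> h5; rewrite -[f t - g t](subrK (f T3 - g T3)) (le_trans (ler_normD _ _))//.
by rewrite -/K; lra.
Qed.

(* In the variable z = e^{kt} y the equation reads (e^{-2kt} z')' = e^{-2kt}
   (Q - k^2) z; integrating it twice backwards from s makes z close to 1. *)
Lemma recessive_bound Q k th C T s y dy :
  0 <= k -> 0 < th -> 0 <= C -> continuous Q ->
  (forall t, T <= t -> `|Q t - k ^+ 2| <= C * expR (- th * t)) ->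
  C / th ^+ 2 * expR (- th * T) <= 2^-1 ->
  T <= s -> sol Q y dy -> y s = expR (- k * s) -> dy s = - k * expR (- k * s) ->
  forall t, T <= t <= s ->
    `|expR (k * t) * y t - 1| <= 2 * C / th ^+ 2 * expR (- th * t) /\
    `|expR (k * t) * (dy t + k * y t)| <= 2 * C / th * expR (- th * t).
Proof.
move=> k0 th0 C0 cQ hQ hT Ts [hy hdy] ys dys.
pose z t := expR (k * t) * y t.
pose w t := expR (- k * t) * (dy t + k * y t).
have wz t : expR (k * t) * (dy t + k * y t) = expR (2 * k * t) * w t.
  by rewrite /w mulrA -expRD; congr (expR _ * _); ring.
have dz t : is_derive t 1 z (expR (2 * k * t) * w t).
  by rewrite -wz /z; der; ring.
have dw t : is_derive t 1 w (expR (- 2 * k * t) * ((Q t - k ^+ 2) * z t)).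
  have -> : expR (- 2 * k * t) * ((Q t - k ^+ 2) * z t) =
      expR (- k * t) * ((Q t - k ^+ 2) * y t).
    have -> : expR (- k * t) = expR (- 2 * k * t) * expR (k * t).
      by rewrite -expRD; congr expR; ring.
    by rewrite /z; ring.
  by rewrite /w; der; ring.
have zc : continuous z by exact: (prim_cont dz).
have zs : z s = 1 by rewrite /z ys -expRD mulNr subrr expR0.
have ws : w s = 0 by rewrite /w ys dys; ring.
(* Two backward integrations from [s] turn any bound [M] of [z] into a bound of [z - 1]. It is used
   once with [M] the maximum of [|z|], and once more with the value 2 found for it. *)
have key M : 0 <= M -> (forall t, T <= t <= s -> `|z t| <= M) ->
    forall t, T <= t <= s ->
      `|z t - 1| <= C / th ^+ 2 * M * expR (- th * t) /\
      `|expR (2 * k * t) * w t| <= C / th * M * expR (- th * t).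
  move=> M0 zM.
  have c0 : 0 <= C * M by rewrite mulr_ge0.
  have W t : T <= t <= s ->
      `|expR (2 * k * t) * w t| <= C / th * M * expR (- th * t).
    move=> /andP[Tt ts].
    (* The decay rate of the integrand. Bounding 1/r by 1/th afterwards makes the estimate uniform
       down to [k = 0]. *)
    pose r := 2 * k + th; have r0 : 0 < r by rewrite /r; lra.
    have := @norm_der R w (fun x => - (C * M / r * expR (- r * x)))
      (fun x => expR (- 2 * k * x) * ((Q x - k ^+ 2) * z x))
      (fun x => C * M * expR (- r * x)) t s ts.
    rewrite ws sub0r normrN => h.
    have {h} : `|w t| <= C * M / r * expR (- r * t).
      apply: (le_trans (h _ _ _)).
      - by move=> x _; der; field; rewrite gt_eqF.
      - move=> x /andP[tx xs]; have Tx := le_trans Tt tx.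
        rewrite normrM (gtr0_norm (expR_gt0 _)) normrM.
        rewrite (_ : - r * x = - 2 * k * x + - th * x); last by rewrite /r; ring.
        rewrite expRD [leRHS]mulrCA ler_wpM2l ?expR_ge0// [leRHS]mulrAC.
        by apply: ler_pM; rewrite ?normr_ge0 ?hQ ?zM ?Tx.
      - have : 0 <= C * M / r * expR (- r * s).
          by rewrite !mulr_ge0 ?expR_ge0// invr_ge0 ltW.
        by lra.
    move=> h; rewrite normrM gtr0_norm ?expR_gt0//.
    apply: (@le_trans _ _ (expR (2 * k * t) * (C * M / r * expR (- r * t)))).
      by rewrite ler_wpM2l ?expR_ge0.
    rewrite mulrCA -expRD (_ : 2 * k * t + - r * t = - th * t); last by rewrite /r; ring.
    rewrite ler_wpM2r ?expR_ge0// [leRHS]mulrAC ler_wpM2l// lef_pV2 ?posrE//.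
    by rewrite /r; lra.
  move=> t tTs; split; last exact: W.
  move: tTs => /andP[Tt ts].
  have := @norm_der R z (fun x => - (C / th ^+ 2 * M * expR (- th * x)))
    (fun x => expR (2 * k * x) * w x) (fun x => C / th * M * expR (- th * x)) t s ts.
  rewrite zs distrC => h; apply: (le_trans (h _ _ _)).
  - by move=> x _; der; field; rewrite gt_eqF.
  - by move=> x /andP[tx xs]; apply: W; rewrite xs (le_trans Tt).
  - have : 0 <= C / th ^+ 2 * M * expR (- th * s).
      by rewrite !mulr_ge0 ?expR_ge0// invr_ge0 exprn_ge0// ltW.
    by lra.
have [c /[!in_itv]/= cTs hc] : exists2 c, c \in `[T, s] &
    forall t, t \in `[T, s] -> `|z t| <= `|z c|.
  apply: (EVT_max Ts); apply: continuous_subspaceT => x.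
  by apply: continuous_comp; [exact: zc|exact: norm_continuous].
(* The smallness assumption at [T] gives max <= 1 + max / 2. *)
have z2 : `|z c| <= 2.
  have [||h _] := key `|z c| _ _ c cTs => //.
  have : `|z c| <= 1 + `|z c - 1|.
    by rewrite -[X in `|X| <= _](subrK 1) addrC (le_trans (ler_normD _ _))// normr1.
  have : C / th ^+ 2 * `|z c| * expR (- th * c) <= 2^-1 * `|z c|.
    rewrite mulrAC ler_wpM2r// (le_trans _ hT)// ler_wpM2l//.
      by rewrite mulr_ge0// invr_ge0 exprn_ge0// ltW.
    by rewrite ler_expR !mulNr lerN2 ler_pM2l//; case/andP: cTs.
  by lra.
move=> t tTs; have [||h1 h2] := key 2 _ _ t tTs => //.
  by move=> x xTs; rewrite (le_trans (hc _ _))// in_itv.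
by rewrite -/(z t) wz; split; [move: h1|move: h2]; clear; lra.
Qed.

(** The solutions [Y s] that match [expR (- k * t)] at [s] satisfy bounds independent of [s], so
    their data at [T0] stay in a compact rectangle. A cluster point of these data as [s] tends to
    infinity defines a solution that inherits the bound at every [t]. *)
Lemma recessive_exists Q k th C T :
  0 <= k -> 0 < th -> 0 <= C -> continuous Q ->
  (forall t, T <= t -> `|Q t - k ^+ 2| <= C * expR (- th * t)) ->
  exists y dy, sol Q y dy /\ expR (k * t) * y t @[t --> +oo] --> (1 : R).
Proof.
move=> k0 th0 C0 cQ hQ0.
have [T0 TT0 hT] : exists2 T0, T <= T0 & C / th ^+ 2 * expR (- th * T0) <= 2^-1.
  have h : C / th ^+ 2 * expR (- th * t) @[t --> +oo] --> (0 : R).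
    by rewrite -(mulr0 (C / th ^+ 2)); apply: cvgMl_tmp; exact: expR_mulN_cvg0.
  have h2 : 0 < 2^-1 :> R by rewrite invr_gt0.
  have [T1 h1] := (cvg_pinfty_le _ _).1 h _ h2.
  exists (Num.max T T1); first by rewrite le_max lexx.
  have := h1 (Num.max T T1); rewrite subr0 le_max lexx orbT => /(_ isT).
  exact: le_trans (ler_norm _).
have hQ t : T0 <= t -> `|Q t - k ^+ 2| <= C * expR (- th * t).
  by move=> /(le_trans TT0); exact: hQ0.
have /choice[Y] : forall s, exists ydy : (R -> R) * (R -> R),
    [/\ sol Q ydy.1 ydy.2, ydy.1 s = expR (- k * s) & ydy.2 s = - k * expR (- k * s)].
  move=> s; have [y [dy [h1 h2 h3]]] := sol_exists s (expR (- k * s))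
    (- k * expR (- k * s)) cQ.
  by exists (y, dy).
move=> hY.
have [p [dp [hp p0 dp0]]] := sol_exists T0 1 0 cQ.
have [q [dq [hq q0 dq0]]] := sol_exists T0 0 1 cQ.
pose a s := (Y s).1 T0; pose b s := (Y s).2 T0.
have Yab s t : (Y s).1 t = a s * p t + b s * q t.
  have [hs _ _] := hY s.
  have [|| -> _ //] := sol_eq (t0 := T0) cQ hs (sol_lin (a s) (b s) hp hq).
    by rewrite p0 q0 /a; ring.
  by rewrite dp0 dq0 /b; ring.
pose c1 := 2 * C / th ^+ 2; pose c2 := 2 * C / th.
have bnd s : T0 <= s -> forall t, T0 <= t <= s ->
    `|expR (k * t) * (Y s).1 t - 1| <= c1 * expR (- th * t) /\
    `|expR (k * t) * ((Y s).2 t + k * (Y s).1 t)| <= c2 * expR (- th * t).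
  move=> T0s; have [h1 h2 h3] := hY s.
  exact: (recessive_bound k0 th0 C0 cQ hQ hT T0s h1 h2 h3).
pose A := expR (- k * T0) * (1 + c1 * expR (- th * T0)).
pose B := expR (- k * T0) * (c2 * expR (- th * T0)) + k * A.
have eK (x : R) : expR (- k * T0) * (expR (k * T0) * x) = x.
  by rewrite mulrA -expRD mulNr addNr expR0 mul1r.
have aA s : T0 <= s -> `|a s| <= A.
  move=> T0s; have [|h _] := bnd s T0s T0; first by rewrite lexx.
  rewrite -[a s]eK normrM gtr0_norm ?expR_gt0// ler_wpM2l ?expR_ge0//.
  rewrite -[X in `|X|](subrK 1) addrC (le_trans (ler_normD _ _))// normr1 lerD2l.
  exact: h.
have bB s : T0 <= s -> `|b s| <= B.
  move=> T0s; have [|_ h] := bnd s T0s T0; first by rewrite lexx.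
  rewrite -[b s](addrK (k * a s)) (le_trans (ler_normB _ _))// lerD//.
    rewrite -[X in `|X|]eK normrM gtr0_norm ?expR_gt0// ler_wpM2l ?expR_ge0//.
  by rewrite normrM (ger0_norm k0) ler_wpM2l// aA.
have cK : compact (`[- A, A]%classic `*` `[- B, B]%classic).
  by apply: compact_setX; exact: segment_compact.
have [|[a0 b0] [_ clu]] := cK ((fun s => (a s, b s)) @ +oo) _.
  apply/near_pinftyP; exists T0 => s T0s; split=> /=.
    by rewrite in_itv/= -ler_norml aA.
  by rewrite in_itv/= -ler_norml bB.
exists (fun t => a0 * p t + b0 * q t), (fun t => a0 * dp t + b0 * dq t).
split; first exact: sol_lin.
suff bd t : T0 <= t ->
    `|expR (k * t) * (a0 * p t + b0 * q t) - 1| <= c1 * expR (- th * t).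
  have h : c1 * expR (- th * t) @[t --> +oo] --> (0 : R).
    by rewrite -(mulr0 c1); apply: cvgMl_tmp; exact: expR_mulN_cvg0.
  apply/cvg_pinfty_le => e e0; have [T1 h1] := (cvg_pinfty_le _ _).1 h _ e0.
  exists (Num.max T0 T1) => t; rewrite ge_max => /andP[/bd h2 /h1].
  by rewrite subr0; apply: le_trans; rewrite (le_trans h2)// ler_norm.
move=> T0t; apply/ler_addgt0Pr => e e0.
(* At this fixed [t], an error below [e / K] in the data changes [expR (k * t) * y t] by at most
   [e]. *)
pose K := 1 + expR (k * t) * (`|p t| + `|q t|).
have K0 : 0 < K by rewrite ltr_pwDl// mulr_ge0 ?expR_ge0// addr_ge0.
have [[x1 x2] [[s ts [e1 e2]]]] : [set (a s, b s) | s in [set s | t <= s]] `&`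
    ball (a0, b0) (e / K) !=set0.
  apply: clu; last by apply: nbhsx_ballx; rewrite divr_gt0.
  by apply/near_pinftyP; exists t => s ts; exists s.
rewrite -e1 -e2 => -[/= h1 h2].
have ets : T0 <= t <= s by rewrite T0t.
have [h3 _] := bnd s (le_trans T0t ts) t ets.
have -> : expR (k * t) * (a0 * p t + b0 * q t) - 1 =
  (expR (k * t) * (Y s).1 t - 1) +
    expR (k * t) * ((a0 - a s) * p t + (b0 - b s) * q t).
  by rewrite Yab; ring.
rewrite (le_trans (ler_normD _ _))// lerD// normrM gtr0_norm ?expR_gt0//.
have : `|(a0 - a s) * p t + (b0 - b s) * q t| <= e / K * (`|p t| + `|q t|).
  rewrite (le_trans (ler_normD _ _))// !normrM mulrDr.
  by rewrite lerD// ler_wpM2r// ltW.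
move=> /(ler_wpM2l (expR_ge0 (k * t))) /le_trans; apply.
rewrite mulrCA -ler_pdivlMl ?divr_gt0// invf_div divfK ?gt_eqF//.
by rewrite /K lerDr.
Qed.

(** The factor 1/(2k) makes the Wronskian of [expR (- k * t)] with this function equal to 1; for
    [k = 0] the pair is 1 and [t]. *)
Definition dominant k t := if k == 0 then t else expR (k * t) / (2 * k).

(* The dominant solution is y * \int y^-2 with y the recessive one. *)
Lemma dominant_exists Q k y dy : 0 <= k -> continuous Q -> sol Q y dy ->
  expR (k * t) * y t @[t --> +oo] --> (1 : R) ->
  exists z dz, [/\ sol Q z dz, (forall t, y t * dz t - dy t * z t = 1),
    z t / dominant k t @[t --> +oo] --> (1 : R) &
    z t / y t @[t --> +oo] --> +oo].
Proof.
move=> k0 cQ hy y1.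
have [T hT] : exists T, forall t, T <= t -> 0 < y t.
  have h2 : 0 < 2^-1 :> R by rewrite invr_gt0.
  have [T h] := (cvg_pinfty_le _ _).1 y1 _ h2; exists T => t /h.
  rewrite ler_norml => /andP[h3 _].
  by rewrite -(pmulr_rgt0 _ (expR_gt0 (k * t))); lra.
have yT : y T != 0 by rewrite gt_eqF// hT.
have [z [dz [hz W]]] := sol_complement cQ hy yT.
(* A primitive of [expR (2 * k * t)], to which [y ^- 2], the derivative of [z / y], is equivalent.
   It tends to infinity also for [k = 0]. *)
pose D t := if k == 0 then t else expR (2 * k * t) / (2 * k).
have dD t : is_derive t 1 D (expR (2 * k * t)).
  rewrite /D; case: eqP => [->|/eqP kn0]; der; last by field.
  by rewrite mulr0 mul0r expR0.
have Dy : D t @[t --> +oo] --> +oo.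
  rewrite /D; case: eqP => [_|/eqP kn0]; first exact: cvg_id.
  have k2 : 0 < 2 * k by rewrite mulr_gt0// lt0r kn0.
  apply: gt0_cvgMly; first by rewrite invr_gt0.
  exact: expR_mul_cvgy.
have zyD : z t / y t / D t @[t --> +oo] --> (1 : R).
  apply: (@lhopital_ratio (fun t => z t / y t) (fun t => 1 / y t ^+ 2) D
    (fun t => expR (2 * k * t)) T) => //.
  - move=> t /hT yt; have y0 : y t != 0 by rewrite gt_eqF.
    by case: hy hz => ? ? [? ?]; der => //; rewrite -(W t); field.
  - by move=> t _; exact: expR_gt0.
  - have -> : (fun t => 1 / y t ^+ 2 / expR (2 * k * t)) =
        (fun t => ((expR (k * t) * y t) ^+ 2)^-1).
      apply/funext => t; rewrite exprMn -expRM_natl mul1r -invfM mulrC.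
      by congr (_ * _)^-1; congr expR; ring.
    have h : ((expR (k * t) * y t) ^+ 2)^-1 @[t --> +oo] --> ((1 : R) ^+ 2)^-1.
      apply: cvgV; first by rewrite expr1n oner_neq0.
      by under eq_fun do rewrite expr2; rewrite expr2; apply: cvgM.
    by rewrite expr1n invr1 in h.
exists z, dz; split=> //.
  have : (z t / y t / D t) * (expR (k * t) * y t) @[t --> +oo] --> (1 : R).
    by rewrite -[X in _ --> X]mulr1; apply: cvgM.
  apply: cvg_trans; apply: near_eq_cvg; apply/near_pinftyP; exists T => t /hT yt.
  have yn0 : y t != 0 by rewrite gt_eqF.
  rewrite /D /dominant; case: eqP => [->|/eqP kn0].
    by rewrite mul0r expR0 mul1r mulrAC divfK.
  have E0 : expR (k * t) != 0 by rewrite gt_eqF// expR_gt0.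
  have -> : expR (2 * k * t) = expR (k * t) ^+ 2.
    by rewrite -expRM_natl; congr expR; ring.
  by field; rewrite E0 kn0.
apply/cvgryPge => A; apply/near_pinftyP.
have h2 : 0 < 2^-1 :> R by rewrite invr_gt0.
have [T1 h1] := (cvg_pinfty_le _ _).1 zyD _ h2.
have /cvgryPge/(_ (2 * `|A| + 1))/near_pinftyP[T2 h3] := Dy.
exists (Num.max T1 T2) => t; rewrite ge_max => /andP[/h1 + /h3 Dt].
have D0 : 0 < D t by rewrite (lt_le_trans _ Dt)// ltr_wpDl// mulr_ge0.
rewrite ler_norml => /andP[+ _]; rewrite lerBrDr => h.
have {h} : (- 2^-1 + 1) * D t <= z t / y t by rewrite -ler_pdivlMr.
by have := ler_norm A; lra.
Qed.

End Asymptotics.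

(** * Integration on R^N *)

Section Integration.
Context {R : realType}.
Local Notation mu := (@lebesgue_measure R).
Local Notation tup n := (n.-tuple (measurableTypeR R)).

Definition cube n (A : R) : set (tup n) :=
  [set t | forall i, (tnth t i : R) \in `[- A, A]].
Arguments cube : clear implicits.

Lemma cube_preimage n (A : 'I_n -> set (measurableTypeR R)) :
  [set t : tup n | forall i, A i (tnth t i)] =
  \bigcap_(i in [set: 'I_n]) ((@tnth n (measurableTypeR R))^~ i @^-1` A i).
Proof. by apply/seteqP; split => t /= h i; [move=> _|]; exact: h. Qed.

Lemma measurable_box n (A : 'I_n -> set (measurableTypeR R)) :
  (forall i, measurable (A i)) ->
  measurable [set t : tup n | forall i, A i (tnth t i)].
Proof.
move=> mA; rewrite cube_preimage; apply: fin_bigcap_measurable => // i _.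
by rewrite -[X in measurable X]setTI; exact: measurable_tnth.
Qed.

Lemma measurable_cube n (A : R) : measurable (cube n A).
Proof. exact: (@measurable_box n (fun=> `[- A, A]%classic)). Qed.

Lemma cube_fin n (A : R) : (power_measure mu n (cube n A) < +oo)%E.
Proof.
pose B : set (measurableTypeR R) := `[- A, A]%classic.
have e := @power_measure_box _ (measurableTypeR R) R mu n (fun=> B).
rewrite (_ : cube n A = [set t : tup n | forall i, B (tnth t i)])// e//; last by move=> _; exact: measurable_itv.
suff /andP[] : (0 <= \prod_(i < n) mu B < +oo)%E by [].
apply: (big_ind (fun x => 0 <= x < +oo)%E) => [|x y /andP[x0 xo] /andP[y0 yo]|i _].
- by rewrite lee01 ltry.
- by rewrite mule_ge0//= lte_mul_pinfty// ge0_fin_numE.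
by rewrite measure_ge0/= lebesgue_measure_itv/=; case: ifP => // _; exact: ltry.
Qed.

Lemma integrable_cube n (A M : R) (G : tup n -> R) :
  measurable_fun setT G -> (forall t, `|G t| <= M) ->
  (forall t, ~ cube n A t -> G t = 0) ->
  (power_measure mu n).-integrable setT (EFin \o G).
Proof.
move=> mG GM G0.
have -> : EFin \o G = (EFin \o G) \_ (cube n A).
  apply/funext => t; rewrite /patch; case: ifPn => // /negP; rewrite inE => h.
  by rewrite /= G0.
apply/(integrable_mkcond _ (measurable_cube A)).
apply: measurable_bounded_integrable.
- exact: measurable_cube.
- exact: cube_fin.
- exact: measurable_funS mG.
- exists M; split; first exact: num_real.
  by move=> x Mx t _ /=; rewrite (le_trans (GM t))// ltW.
Qed.

Definition tupd n (i : 'I_n) (x : R) (t : tup n) : tup n :=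
  [tuple if j == i then x else tnth t j | j < n].

Lemma tupd0 n (x y : R) (t : tup n) :
  tupd ord0 x [tuple of y :: t] = [tuple of x :: t].
Proof.
apply: eq_from_tnth => j; rewrite tnth_mktuple.
by have [k ->|->] := unliftP ord0 j; rewrite ?eqxx ?tnthS.
Qed.

Lemma tupdS n (i : 'I_n) (x y : R) (t : tup n) :
  tupd (lift ord0 i) x [tuple of y :: t] = [tuple of y :: tupd i x t].
Proof.
apply: eq_from_tnth => j; rewrite tnth_mktuple.
have [k ->|->] := unliftP ord0 j; last by rewrite (negbTE (neq_lift _ _)).
by rewrite (inj_eq lift_inj) !tnthS tnth_mktuple.
Qed.

(** The measure is built by adding a coordinate in front, so Fubini directly separates only the
    first one. If [i] is the first coordinate it is integrated innermost; otherwise the tail is, and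
    the induction hypothesis applies to it. *)
Lemma integral_slices0 n (i : 'I_n) (A M : R) (G : tup n -> R) :
  measurable_fun setT G -> (forall t, `|G t| <= M) ->
  (forall t, ~ cube n A t -> G t = 0) ->
  (forall t, \int[mu]_x (G (tupd i x t))%:E = 0)%E ->
  (\int[power_measure mu n]_t (G t)%:E = 0)%E.
Proof.
elim: n i G => [[]//|n IH] i G mG GM G0 slice.
have iG := integrable_cube mG GM G0.
pose H : measurableTypeR R * tup n -> R := G \o (@tcons _ _ n).
have mH : measurable_fun setT H by apply: measurableT_comp => //; exact: measurable_tcons.
have iH : (mu \x power_measure mu n)%E.-integrable setT (EFin \o H).
  have HE : EFin \o H = (EFin \o H) \_ (@tcons _ _ n @^-1` cube n.+1 A).
    apply/funext => t; rewrite /patch; case: ifPn => // /negP; rewrite inE => h.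
    by rewrite /= /H /= G0.
  have mc : measurable (@tcons _ (measurableTypeR R) n @^-1` cube n.+1 A).
    rewrite -[X in measurable X]setTI; apply: measurable_tcons => //.
    exact: measurable_cube.
  rewrite HE; apply/(integrable_mkcond _ mc); apply: measurable_bounded_integrable.
  - exact: mc.
  - exact: (cube_fin n.+1 A).
  - exact: measurable_funS mH.
  - exists M; split; first exact: num_real.
    by move=> x Mx t _ /=; rewrite (le_trans (GM _))// ltW.
(* By construction the measure on the left is the image of the product measure under [tcons]. *)
have -> : (\int[power_measure mu n.+1]_t (G t)%:E =
    \int[mu \x power_measure mu n]_z (H z)%:E)%E.
  rewrite -[LHS]/(\int[pushforward (mu \x power_measure mu n)%E (@tcons _ _ n)]_(y in setT) (EFin \o G) y)%E.
  case/integrableP: (iG) => mf _.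
  by rewrite (integral_pushforward (@measurable_tcons _ _ n) mf).
have [j ij|i0] := unliftP ord0 i; last first.
  rewrite -(integral21_prod_meas1 iH); apply: integral0_eq => t _.
  rewrite /fubini_G /= -(slice [tuple of 0 :: t]) i0.
  by apply: eq_integral => x _; rewrite /H /= tupd0.
rewrite -(integral12_prod_meas1 iH); apply: integral0_eq => x _.
rewrite /fubini_F /=; apply: (IH j (fun t => H (x, t))).
- exact: (measurable_fun_pair2 x mH).
- by move=> t; exact: GM.
- move=> t tA; apply: G0 => h; apply: tA => k; have := h (lift ord0 k).
  by rewrite tnthS.
- move=> t; rewrite -(slice [tuple of x :: t]) ij.
  by apply: eq_integral => s _; rewrite /H /= tupdS.
Qed.

(** * Integration and integration by parts for compactly supported functions on R^N *)

Section Row.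
Context {N : nat}.
Implicit Types (f g F : 'rV[R]_N -> R) (x : 'rV[R]_N).

(* Every open set is a countable union of rational boxes. *)
Lemma measurable_row_open (U : set 'rV[R]_N) : open U ->
  measurable [set t : tup N | U (row_of_tuple t)].
Proof.
move=> oU.
have flip (u v w : R) : u \in `]v - w, v + w[ -> v \in `]u - w, u + w[.
  by rewrite !in_itv/= => /andP[? ?]; apply/andP; split; lra.
have close (u v q w e : R) : u \in `]q - w, q + w[ -> w < e / 2 ->
    v \in `]q - w, q + w[ -> `|u - v| < e.
  rewrite !in_itv/= => /andP[? ?] ? /andP[? ?].
  by rewrite ltr_norml; apply/andP; split; lra.
pose B (p : {ffun 'I_N -> rat} * nat) : set (tup N) :=
  [set t | forall i, (tnth t i : R) \in `]ratr (p.1 i) - p.2.+1%:R^-1, ratr (p.1 i) + p.2.+1%:R^-1[].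
have mB p : measurable (B p).
  apply: (@measurable_box N (fun i =>
    `]ratr (p.1 i) - p.2.+1%:R^-1, ratr (p.1 i) + p.2.+1%:R^-1[%classic)).
  by move=> i; exact: measurable_itv.
pose C p := if `[< B p `<=` [set t | U (row_of_tuple t)] >] then B p else set0.
have -> : [set t : tup N | U (row_of_tuple t)] = \bigcup_p C p.
  apply/seteqP; split => [t /= Ut|t [p _]]; last first.
    by rewrite /C; case: ifPn => // /asboolP; apply.
  have /nbhs_ballP[e /= e0 he] : nbhs (row_of_tuple t) U by exact: open_nbhs_nbhs.
  have [n hn] : exists n : nat, n.+1%:R^-1 < e / 2.
    have /ltr_add_invr[n hn] : 0 < e / 2 by lra.
    by exists n; rewrite add0r in hn.
  have n0 : 0 < n.+1%:R^-1 :> R by rewrite invr_gt0.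
  have /choice[q hq] : forall i : 'I_N, exists q : rat,
      ratr q \in `](tnth t i : R) - n.+1%:R^-1, (tnth t i : R) + n.+1%:R^-1[.
    by move=> i; apply: rat_in_itvoo; rewrite ltrBlDr -addrA ltrDl addr_gt0.
  have Bt : B ([ffun i => q i], n) t.
    by move=> i; rewrite /= ffunE; apply: flip; exact: hq.
  exists ([ffun i => q i], n) => //; rewrite /C; case: ifPn => // /asboolPn; case.
  move=> s Bs; apply: he; split => // i j; rewrite /ball/= !mxE.
  by have := Bs j; rewrite /= ffunE; exact: close (flip _ _ _ (hq j)) hn.
apply: countable_bigcupT_measurable; first exact: countableP.
by move=> p; rewrite /C; case: ifP.
Qed.

Lemma measurable_row f : continuous f ->
  measurable_fun setT (fun t : tup N => f (row_of_tuple t)).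
Proof.
move=> cf mD; apply: (measurability _ (RGenOInfty.measurableE R)) => //.
move=> /= _ [_ [r ->] <-]; rewrite setTI; apply: (@measurable_row_open (f @^-1` `]r, +oo[%classic)).
by apply: open_comp => [x _|]; [exact: cf|exact: interval_open].
Qed.

Definition supp_in (A : R) f := forall x i, A < `|x ord0 i| -> f x = 0.

Definition cc f := continuous f /\ exists A, supp_in A f.

Lemma cc_bounded f : cc f -> exists2 M, 0 < M & forall x, `|f x| <= M.
Proof.
move=> [cf [A fA]].
pose K : set 'rV[R]_N := [set x | forall i, x ord0 i \in `[- `|A|, `|A| ]].
have cK : compact K.
  apply: (@rV_compact _ _ (fun=> `[- `|A|, `|A| ]%classic)) => _.
  exact: segment_compact.
have [||c _ h] := @EVT_max_rV R N (fun x => `|f x|) K _ cK.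
- by exists 0 => i; rewrite mxE in_itv/= oppr_le0 normr_ge0.
- apply: continuous_subspaceT => x; apply: continuous_comp; first exact: cf.
  exact: norm_continuous.
exists (`|f c| + 1) => [|x]; first by rewrite ltr_wpDl.
have [Kx|] := pselect (K x).
  by rewrite (le_trans (h x _)) ?inE// lerDl.
move=> /existsNP[i] /negP; rewrite in_itv/= -ler_norml -ltNge => Ai.
by rewrite (fA x i) ?normr0 ?addr_ge0// (le_lt_trans (ler_norm A)).
Qed.

Lemma cc_integrable f : cc f ->
  (lebesgue_tuple (N := N)).-integrable setT (EFin \o (fun t : tup N => f (row_of_tuple t))).
Proof.
move=> ccf; have [M M0 fM] := cc_bounded ccf; have [cf [A fA]] := ccf.
apply: (@integrable_cube N A M); first exact: measurable_row.
  by move=> t; exact: fM.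
move=> t /existsNP[i] /negP; rewrite in_itv/= -ler_norml -ltNge => Ai.
by apply: (fA _ i); rewrite mxE.
Qed.

Definition intN f : R := \int[lebesgue_tuple]_t f (row_of_tuple t).

Lemma intN_E f : cc f ->
  (\int[lebesgue_tuple]_t (f (row_of_tuple t))%:E)%E = (intN f)%:E.
Proof.
move=> /cc_integrable h; rewrite /intN /Rintegral fineK//.
exact: (integrable_fin_num _ h).
Qed.

Lemma ccD f g : cc f -> cc g -> cc (fun x => f x + g x).
Proof.
move=> [cf [A fA]] [cg [B gB]]; split; first by move=> x; exact: (cvgD (cf x) (cg x)).
exists (Num.max A B) => x i; rewrite gt_max => /andP[/fA -> /gB ->]; exact: addr0.
Qed.

Lemma ccM f g : cc f -> continuous g -> cc (fun x => f x * g x).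
Proof.
move=> [cf [A fA]] cg; split; first by move=> x; exact: (cvgM (cf x) (cg x)).
by exists A => x i /fA ->; exact: mul0r.
Qed.

Lemma ccZ f (c : R) : cc f -> cc (fun x => c * f x).
Proof.
by move=> [cf [A fA]]; split=> [x|]; [exact: (cvgM (cvg_cst c) (cf x))|exists A => x i /fA ->; exact: mulr0].
Qed.

Lemma cc0 : cc (fun _ : 'rV[R]_N => 0).
Proof. by split; [exact: cst_continuous|exists 0]. Qed.

Lemma cc_sum (I : Type) (r : seq I) (h : I -> 'rV[R]_N -> R) :
  (forall i, cc (h i)) -> cc (fun x => \sum_(i <- r) h i x).
Proof.
move=> ch; elim: r => [|i r IH].
  by under eq_fun do rewrite big_nil; exact: cc0.
by under eq_fun do rewrite big_cons; exact: ccD.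
Qed.

Lemma intND f g : cc f -> cc g -> intN (fun x => f x + g x) = intN f + intN g.
Proof. by move=> cf cg; apply: RintegralD => //; exact: cc_integrable. Qed.

Lemma intNZ f (c : R) : cc f -> intN (fun x => c * f x) = c * intN f.
Proof. by move=> cf; apply: RintegralZl => //; exact: cc_integrable. Qed.

Lemma intNB f g : cc f -> cc g -> intN (fun x => f x - g x) = intN f - intN g.
Proof. by move=> cf cg; apply: RintegralB => //; exact: cc_integrable. Qed.

Lemma intN_sum (I : Type) (r : seq I) (h : I -> 'rV[R]_N -> R) :
  (forall i, cc (h i)) -> intN (fun x => \sum_(i <- r) h i x) = \sum_(i <- r) intN (h i).
Proof.
move=> ch; elim: r => [|i r IH].
  rewrite big_nil -[RHS](mul0r (intN (fun _ : 'rV[R]_N => 0))) -intNZ; last exact: cc0.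
  by apply: eq_Rintegral => t _; rewrite big_nil mul0r.
rewrite big_cons -IH -intND//; last exact: cc_sum.
by apply: eq_Rintegral => t _; rewrite big_cons.
Qed.

Lemma eq_intN f g : f =1 g -> intN f = intN g.
Proof. by move=> fg; apply: eq_Rintegral => t _; exact: fg. Qed.

Lemma le_intN f g : cc f -> cc g -> (forall x, f x <= g x) -> intN f <= intN g.
Proof.
by move=> cf cg fg; apply: le_Rintegral => //; exact: cc_integrable.
Qed.

Lemma intN_ge0 f : (forall x, 0 <= f x) -> 0 <= intN f.
Proof. by move=> f0; apply: Rintegral_ge0. Qed.

(** By continuity [f] exceeds [f x0 / 2] on a box around [x0], whose volume is given by
    [power_measure_box]. *)
Lemma intN_gt0 f x0 : cc f -> (forall x, 0 <= f x) -> 0 < f x0 -> 0 < intN f.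
Proof.
move=> cf f0 fx0; have c2 : 0 < f x0 / 2 by lra.
have /nbhs_ballP[e /= e0 he] : nbhs x0 [set y | f x0 / 2 < f y].
  have /cvgr_gt := cf.1 x0; apply; lra.
pose A (i : 'I_N) : set (measurableTypeR R) := `]x0 ord0 i - e, x0 ord0 i + e[%classic.
pose B : set (tup N) := [set t | forall i, A i (tnth t i)].
have mB : measurable B by apply: measurable_box => i; exact: measurable_itv.
have muA i : mu (A i) = (2 * e)%:E.
  rewrite lebesgue_measure_itv/= lte_fin ifT; last by lra.
  by rewrite -EFinB; congr EFin; lra.
have muB : (lebesgue_tuple (N := N) B = ((2 * e) ^+ N)%:E)%E.
  have box := @power_measure_box _ (measurableTypeR R) R mu N A.
  transitivity (\prod_(i < N) mu (A i))%E.
    by apply: box => i; exact: measurable_itv.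
  under eq_bigr do rewrite muA.
  by rewrite prodEFin prodr_const card_ord.
suff : (0 < (intN f)%:E)%E by rewrite lte_fin.
rewrite -intN_E//.
apply: (@lt_le_trans _ _ ((f x0 / 2)%:E * lebesgue_tuple (N := N) B)%E).
  by rewrite muB lte_fin mulr_gt0// exprn_gt0//; lra.
rewrite -[X in (X <= _)%E](@integral_cst _ _ _ (lebesgue_tuple (N := N)) B mB).
rewrite [X in (X <= _)%E]integral_mkcond; apply: ge0_le_integral => //.
- by move=> t _; rewrite /patch; case: ifP => // _; rewrite lee_fin ltW.
- apply: (measurable_restrict _ _ _).1 => //; exact: measurableT.
- by case/integrableP: (cc_integrable cf).
move=> t _; rewrite /patch; case: ifPn; last by rewrite lee_fin.
rewrite inE lee_fin => Bt; apply/ltW/he; split => // i j.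
rewrite (ord1 i) mxE; have := Bt j; rewrite /A/= in_itv/= /ball/= => /andP[? ?].
by rewrite ltr_norml; apply/andP; split; lra.
Qed.

Lemma is_derive_line f (p v : 'rV[R]_N) (x d : R) :
  is_derive (p + x *: v) v f d -> is_derive x 1 (fun h => f (p + h *: v)) d.
Proof.
have e : (fun h : R => h^-1 *: (((fun h => f (p + h *: v)) \o shift x) (h *: 1) - f (p + x *: v)))
   = (fun h : R => h^-1 *: ((f \o shift (p + x *: v)) (h *: v) - f (p + x *: v))).
  apply/funext => h /=; congr (_ *: (f _ - _)).
  by rewrite addrCA -scalerDl /GRing.scale /= mulr1.
by move=> [h1 h2]; split; [rewrite /derivable e|rewrite /derive e].
Qed.

Lemma row_tupd (i : 'I_N) (x : R) (t : tup N) :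
  row_of_tuple (tupd i x t) =
  row_of_tuple (tupd i 0 t) + x *: delta_mx ord0 i :> 'rV[R]_N.
Proof.
apply/rowP => j; rewrite !mxE !tnth_mktuple eqxx /=.
by case: eqP => _; rewrite ?mulr1 ?add0r// mulr0 addr0.
Qed.

Lemma integral_derive_cc (s ds : R -> R) (A : R) : prim_of s ds -> continuous ds ->
  (forall x : R, A < `|x| -> s x = 0) -> (forall x : R, A < `|x| -> ds x = 0) ->
  (\int[mu]_x (ds x)%:E = 0)%E.
Proof.
move=> hs cds s0 ds0; pose B := `|A| + 1.
have AB : A < B by rewrite (le_lt_trans (ler_norm A))// ltrDl.
have B0 : 0 < B by rewrite ltr_wpDl.
have -> : (fun x : R => (ds x)%:E) = (fun x : R => (ds x)%:E) \_ `[- B, B].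
  apply/funext => x; rewrite /patch; case: ifPn => // /negP.
  rewrite inE/= in_itv/= -ler_norml => /negP; rewrite -ltNge => Bx.
  by rewrite ds0// (lt_trans AB).
rewrite -integral_mkcond (@continuous_FTC2 _ ds s).
- by rewrite !s0 ?sube0// ?normrN gtr0_norm.
- lra.
- exact: continuous_subspaceT.
- have cs := prim_cont hs; split.
  + by move=> x _; case: (hs x).
  + by apply: cvg_at_right_filter; exact: cs.
  + by apply: cvg_at_left_filter; exact: cs.
- by move=> x _; rewrite derive1E; case: (hs x).
Qed.

(** On every line in direction [i] the integrand is the derivative of a compactly supported
    function; this is the only integration by parts on R^N, and the divergence theorem is its sum
    over [i]. *)
Lemma intN_partial (i : 'I_N) F (dF : 'rV[R]_N -> R) :
  (forall x, is_derive x (delta_mx ord0 i) F (dF x)) -> cc dF ->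
  (exists A, supp_in A F) -> intN dF = 0.
Proof.
move=> hF cdF [A FA].
have [M M0 dFM] := cc_bounded cdF; have [ccdF [B dFB]] := cdF.
apply: EFin_inj; rewrite -intN_E//.
pose A0 := Num.max A B.
apply: (@integral_slices0 N i A0 M (fun t => dF (row_of_tuple t))).
- exact: measurable_row.
- by move=> t; exact: dFM.
- move=> t /existsNP[j] /negP; rewrite in_itv/= -ler_norml -ltNge gt_max.
  by move=> /andP[_ h]; apply: (dFB _ j); rewrite mxE.
move=> t; pose p : 'rV[R]_N := row_of_tuple (tupd i 0 t).
pose e : 'rV[R]_N := delta_mx ord0 i.
have pi (x : R) : (p + x *: e) ord0 i = x.
  by rewrite !mxE tnth_mktuple !eqxx mulr1 add0r.
transitivity (\int[mu]_(x in setT) (dF (p + (x : R) *: e))%:E)%E.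
  by apply: eq_integral => x _; rewrite row_tupd.
apply: (@integral_derive_cc (fun x : R => F (p + x *: e)) _ A0).
- by move=> x; apply: is_derive_line; exact: hF.
- move=> x; apply: (@continuous_comp _ _ _ (fun x : R => p + x *: e) dF).
    by apply: cvgD; [exact: cvg_cst|apply: cvgZr_tmp; exact: cvg_id].
  exact: ccdF.
- by move=> x; rewrite gt_max => /andP[h _]; apply: (FA _ i); rewrite pi.
- by move=> x; rewrite gt_max => /andP[_ h]; apply: (dFB _ i); rewrite pi.
Qed.

End Row.

End Integration.
Arguments cube {R} n A.

(** * Radial functions on R^N *)

Section Radial.
Context {R : realType}.

Lemma near_continuous {T U : topologicalType} (f g : T -> U) x :
  (\forall y \near x, f y = g y) -> {for x, continuous f} ->
  {for x, continuous g}.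
Proof.
move=> fg; rewrite /prop_for /continuous_at -(nbhs_singleton fg); apply: cvg_trans.
by apply: near_eq_cvg; apply: filterS fg.
Qed.

Lemma continuous_comp_for {T : topologicalType} (f : T -> R) (g : R -> R) (x : T) :
  {for x, continuous f} -> {for (f x), continuous g} ->
  {for x, continuous (fun y => g (f y))}.
Proof. exact: continuous_comp. Qed.

Lemma for_cst {T : topologicalType} (c : R) (x : T) :
  {for x, continuous (fun _ : T => c)}.
Proof. exact: cst_continuous. Qed.

Lemma for_D {T : topologicalType} (f g : T -> R) (x : T) :
  {for x, continuous f} -> {for x, continuous g} ->
  {for x, continuous (fun y => f y + g y)}.
Proof. by move=> cf cg; exact: (cvgD cf cg). Qed.

Lemma for_M {T : topologicalType} (f g : T -> R) (x : T) :
  {for x, continuous f} -> {for x, continuous g} ->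
  {for x, continuous (fun y => f y * g y)}.
Proof. by move=> cf cg; exact: (cvgM cf cg). Qed.

Lemma for_X {T : topologicalType} (f : T -> R) n (x : T) :
  {for x, continuous f} -> {for x, continuous (fun y => f y ^+ n)}.
Proof.
move=> cf; elim: n => [|n IH]; first exact: for_cst.
rewrite (_ : (fun y => f y ^+ n.+1) = (fun y => f y * f y ^+ n)).
  exact: for_M.
by apply/funext => y; rewrite exprS.
Qed.

Lemma ln_sqrt (s : R) : 0 < s -> ln (Num.sqrt s) = ln s / 2.
Proof.
move=> s0; have h : 0 < Num.sqrt s by rewrite sqrtr_gt0.
rewrite -[in RHS](sqr_sqrtr (ltW s0)) lnXn//.
by rewrite -[X in X / 2]mulr_natr mulfK.
Qed.

(* A function of t = ln |x| as a function of s = |x|^2, cut off at s = 0 so that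
   it is regular there when g vanishes near -oo. *)
Definition of_log (g : R -> R) (s : R) : R := if 0 < s then g (ln s / 2) else 0.

Lemma of_log_gt0 g (s : R) : 0 < s -> of_log g s = g (ln s / 2).
Proof. by rewrite /of_log => ->. Qed.

Lemma of_log_small g (a s : R) : (forall t, t < a -> g t = 0) ->
  s < expR (2 * a) -> of_log g s = 0.
Proof.
move=> g0 sa; rewrite /of_log; case: ifPn => // s0; apply: g0.
by rewrite ltr_pdivrMr// mulrC -ltr_expR lnK.
Qed.

Lemma of_log_large g (b s : R) : (forall t, b < t -> g t = 0) ->
  expR (2 * b) < s -> of_log g s = 0.
Proof.
move=> g0 bs; have s0 := lt_trans (expR_gt0 _) bs.
by rewrite of_log_gt0// g0// ltr_pdivlMr// mulrC -ltr_expR lnK.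
Qed.

(** With s = e^{2t} the chain rule divides by 2s, which is again a function of [t], so the
    derivative is another [of_log]. For [s <= 0] the function vanishes in a neighbourhood. *)
Lemma of_log_der g dg (a : R) : prim_of g dg -> (forall t, t < a -> g t = 0) ->
  (forall t, t < a -> dg t = 0) ->
  prim_of (of_log g) (of_log (fun t => dg t / (2 * expR (2 * t)))).
Proof.
move=> hg g0 dg0 s; case: (ltP 0 s) => s0.
  apply: (@near_eq_is_derive _ _ _ (fun s => g (ln s / 2))).
    near=> u; rewrite of_log_gt0//; near: u; exact: lt_nbhsr.
  rewrite of_log_gt0// (_ : 2 * (ln s / 2) = ln s); last by field.
  by rewrite lnK//; der => //; field; rewrite gt_eqF.
rewrite /of_log ltNge s0 /=; apply: (@near_eq_is_derive _ _ _ (fun=> 0)).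
  have ea := expR_gt0 (2 * a).
  near=> u; apply/esym/(of_log_small g0); near: u; apply: lt_nbhsl.
  exact: le_lt_trans ea.
Unshelve. all: by end_near. Qed.

Lemma of_log_cont g (a : R) : continuous g -> (forall t, t < a -> g t = 0) ->
  continuous (of_log g).
Proof.
move=> cg g0 s; case: (ltP 0 s) => s0.
  have : {for s, continuous (fun u : R => g (ln u / 2))}.
    apply: continuous_comp; last exact: cg.
    exact: (cvgM (continuous_ln s0) (cvg_cst _)).
  apply: near_continuous; have : \forall u \near s, 0 < u by exact: lt_nbhsr.
  by apply: filterS => u u0; rewrite of_log_gt0.
apply: (near_continuous (f := fun=> 0)); last exact: cst_continuous.
have : \forall u \near s, u < expR (2 * a).
  by apply: lt_nbhsl; rewrite (le_lt_trans s0)// expR_gt0.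
by apply: filterS => u /(of_log_small g0).
Qed.

Context {N : nat}.
Implicit Types (f g F q phi : 'rV[R]_N -> R) (x p : 'rV[R]_N).

Definition r2 x : R := \sum_i x ord0 i ^+ 2.

Lemma r2_ge0 x : 0 <= r2 x.
Proof. by apply: sumr_ge0 => i _; exact: sqr_ge0. Qed.

Lemma r2_coord x i : x ord0 i ^+ 2 <= r2 x.
Proof.
by rewrite /r2 (bigD1 i)//= lerDl sumr_ge0// => j _; exact: sqr_ge0.
Qed.

Lemma r2_gt0 x : x != 0 -> 0 < r2 x.
Proof.
move=> x0; rewrite lt_neqAle r2_ge0 andbT; apply: contra x0 => /eqP e.
apply/eqP/rowP => i; rewrite mxE; apply/eqP; rewrite -sqrf_eq0 eq_le sqr_ge0 andbT.
by rewrite [X in _ <= X]e r2_coord.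
Qed.

Lemma r2_0 : r2 0 = 0.
Proof. by rewrite /r2 big1// => i _; rewrite mxE expr0n. Qed.

Lemma ln_enorm x : x != 0 -> ln (enorm x) = ln (r2 x) / 2.
Proof. by move=> /r2_gt0 h; rewrite /enorm ln_sqrt. Qed.

Lemma expR_ln_enorm x : x != 0 -> expR (2 * (ln (r2 x) / 2)) = r2 x.
Proof. by move=> /r2_gt0 h; rewrite mulrC divfK// lnK. Qed.

Lemma enorm_gt0 x : x != 0 -> 0 < enorm x.
Proof. by move=> /r2_gt0 h; rewrite /enorm sqrtr_gt0. Qed.

Lemma coord_cont i : continuous (fun x : 'rV[R]_N => x ord0 i).
Proof. by move=> x; exact: coord_continuous. Qed.

Lemma r2_cont : continuous r2.
Proof.
suff h (r : seq 'I_N) : continuous (fun x : 'rV[R]_N => \sum_(i <- r) x ord0 i ^+ 2).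
  exact: h.
elim: r => [|i r IH] x.
  have -> : (fun x : 'rV[R]_N => \sum_(i <- [::]) x ord0 i ^+ 2) = (fun=> 0).
    by apply/funext => y; rewrite big_nil.
  exact: cst_continuous.
under eq_fun do rewrite big_cons expr2.
have ci := @coord_cont i x.
exact: (cvgD (cvgM ci ci) (IH x)).
Qed.

Lemma is_derive_of_line f p v (d : R) :
  is_derive (0 : R) 1 (fun h => f (p + h *: v)) d -> is_derive p v f d.
Proof.
have e : (fun h : R => h^-1 *: (((fun h => f (p + h *: v)) \o shift 0) (h *: 1) - f (p + 0 *: v)))
   = (fun h : R => h^-1 *: ((f \o shift p) (h *: v) - f p)).
  apply/funext => h /=; rewrite scale0r addr0 addr0 /GRing.scale /= mulr1.
  by congr (_ *: (f _ - _)); exact: addrC.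
by move=> [h1 h2]; split; [rewrite /derivable -e|rewrite /derive -e].
Qed.

Lemma is_derive_to_line f p v (d : R) :
  is_derive p v f d -> is_derive (0 : R) 1 (fun h => f (p + h *: v)) d.
Proof. by move=> h; apply: is_derive_line; rewrite scale0r addr0. Qed.

Lemma coord_line p i (h : R) : (p + h *: delta_mx ord0 i) ord0 i = p ord0 i + h.
Proof. by rewrite !mxE !eqxx mulr1. Qed.

Lemma r2_line p i (h : R) :
  r2 (p + h *: delta_mx ord0 i) = r2 p + 2 * p ord0 i * h + h ^+ 2.
Proof.
rewrite /r2 (bigD1 i)//= coord_line [in RHS](bigD1 i)//=.
rewrite [X in _ + X = _](eq_bigr (fun j => p ord0 j ^+ 2)); first by ring.
by move=> j ji; rewrite !mxE (negbTE ji) andbF mulr0 addr0.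
Qed.

Lemma near0_r2 (P : 'rV[R]_N -> Prop) (d : R) : 0 < d ->
  (forall x, r2 x < d -> P x) -> \forall x \near (0 : 'rV[R]_N), P x.
Proof.
move=> d0 h; have := @r2_cont 0; rewrite /continuous_at r2_0 => /cvgr_lt /(_ _ d0).
by apply: filterS => x; exact: h.
Qed.

(** Potentials and vector fields are singular at 0 but always multiplied by a test function
    vanishing near 0, which reduces regularity to nonzero points. *)
Lemma cont_off0 f (d : R) : 0 < d -> (forall x, r2 x < d -> f x = 0) ->
  (forall x, x != 0 -> {for x, continuous f}) -> continuous f.
Proof.
move=> d0 f0 h x; have [->|/h//] := eqVneq x 0.
apply: (near_continuous (f := fun=> 0)); last exact: cst_continuous.
by apply: (near0_r2 d0) => y /f0 ->.
Qed.

Lemma der_off0 f (v : 'rV[R]_N) df (d : R) : 0 < d -> (forall x, r2 x < d -> f x = 0) ->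
  df 0 = 0 ->
  (forall x, x != 0 -> is_derive x v f (df x)) -> forall x, is_derive x v f (df x).
Proof.
move=> d0 f0 df0 h x; have [->|/h//] := eqVneq x 0.
rewrite df0; apply: (@near_eq_is_derive _ _ _ (fun=> 0)).
  by apply: (near0_r2 d0) => y /f0 ->.
Qed.

Lemma supp_partial (A : R) f df i : supp_in A f ->
  (forall x, is_derive x (delta_mx ord0 i) f (df x)) -> supp_in A df.
Proof.
move=> fA hf x j Aj; have [_ <-] := hf x.
have : is_derive x (delta_mx ord0 i) f 0.
  apply: (@near_eq_is_derive _ _ _ (fun=> 0)).
  have : {for x, continuous (fun y : 'rV[R]_N => `|y ord0 j|)}.
    apply: continuous_comp; [exact: coord_cont|exact: norm_continuous].
  by move=> /cvgr_gt /(_ _ Aj); apply: filterS => y; move=> /fA ->.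
by case.
Qed.

Lemma coord_le_norm x i : `|x ord0 i| <= `|x|.
Proof.
have /mapP[j Hj ->] : `|x ord0 i| \in [seq `|x z.1 z.2| | z : 'I_1 * 'I_N].
  by apply/mapP; exists (ord0, i) => //=; rewrite mem_enum.
by rewrite [leRHS]/Num.Def.normr /= mx_normrE; apply/bigmax_geP; right => /=; exists j.
Qed.

Lemma C0infty_supp Omega phi : C0infty Omega phi -> exists A, supp_in A phi.
Proof.
move=> [_ /compact_bounded[M [_ hM]] _]; exists (M + 1) => x i hx.
apply/eqP/negPn/negP => h.
have : `|x| <= M + 1 by apply: hM; [rewrite ltrDl|exact: subset_closure].
by move=> /(le_trans (coord_le_norm x i)); rewrite leNgt hx.
Qed.

Lemma C0infty_cont Omega phi : C0infty Omega phi -> continuous phi.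
Proof. by move=> [h _ _]; case: (h [::]). Qed.

Lemma C0infty_der Omega phi i : C0infty Omega phi ->
  forall x, is_derive x (delta_mx ord0 i) phi (partial i phi x).
Proof. by move=> [h _ _] x; case: (h [::]) => _ /(_ i x) hd; exact: derivableP. Qed.

Lemma C0infty_partial_cont Omega phi i : C0infty Omega phi ->
  continuous (partial i phi).
Proof. by move=> [h _ _]; case: (h [:: i]). Qed.

Lemma C0infty_off0 phi : C0infty [set x | x != 0] phi ->
  exists2 d : R, 0 < d & forall x, r2 x < d -> phi x = 0.
Proof.
move=> [_ _ h0].
have : nbhs (0 : 'rV[R]_N) (~` closure [set x | phi x != 0]).
  apply: open_nbhs_nbhs; split; first exact/closed_openC/closed_closure.
  by move=> /h0 /=; rewrite eqxx.
move=> /nbhs_ballP[e /= e0 he]; exists (e ^+ 2); first exact: exprn_gt0.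
move=> x xe; apply/eqP/negPn/negP => h.
apply: (he x); last exact: subset_closure.
split=> // i j; rewrite (ord1 i) mxE /ball/= sub0r normrN.
rewrite -(ltr_pXn2r (_ : 0 < 2)%N) ?nnegrE//; last exact: ltW.
by rewrite real_normK ?num_real// (le_lt_trans (r2_coord x j)).
Qed.

Lemma cc_pot q phi : (forall x, x != 0 -> {for x, continuous q}) ->
  C0infty [set x | x != 0] phi -> cc (fun x => q x * phi x ^+ 2).
Proof.
move=> cq hphi; have [A phiA] := C0infty_supp hphi; have [d d0 phi0] := C0infty_off0 hphi.
split; last by exists A => x i /phiA ->; rewrite expr0n mulr0.
apply: (cont_off0 d0) => [x /phi0 ->|x x0]; first by rewrite expr0n mulr0.
apply: for_M; first exact: cq; apply: for_X; exact: C0infty_cont hphi _.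
Qed.

Lemma energy_cc q phi : (forall x, x != 0 -> {for x, continuous q}) ->
  C0infty [set x | x != 0] phi ->
  cc (fun x => \sum_i partial i phi x ^+ 2 + q x * phi x ^+ 2).
Proof.
move=> cq hphi; have [A phiA] := C0infty_supp hphi.
apply: ccD; last exact: cc_pot.
apply: cc_sum => i; have ci := C0infty_partial_cont (i := i) hphi.
have -> : (fun x => partial i phi x ^+ 2) =
  (fun x => partial i phi x * partial i phi x) by apply/funext => x; rewrite expr2.
apply: ccM => //; split=> //; exists A.
exact: (supp_partial phiA (C0infty_der i hphi)).
Qed.

Lemma energyE q phi : (forall x, x != 0 -> {for x, continuous q}) ->
  C0infty [set x | x != 0] phi ->
  energy q phi =
  (intN (fun x => \sum_i partial i phi x ^+ 2 + q x * phi x ^+ 2))%:E.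
Proof. by move=> cq hphi; rewrite -intN_E//; exact: energy_cc. Qed.

(* With A = (beta - (N-2)/2)(ln |x|) x/|x|^2, integrating |grad phi - phi A|^2 >= 0
   by parts gives int |grad phi|^2 >= - int phi^2 (div A + |A|^2). *)
Lemma nonnegative_riccati q (be dbe : R -> R) :
  (forall x, x != 0 -> {for x, continuous q}) ->
  prim_of be dbe -> continuous dbe ->
  (forall x, x != 0 -> dbe (ln (r2 x) / 2) + be (ln (r2 x) / 2) ^+ 2 <=
    ((N%:R - 2) / 2) ^+ 2 + r2 x * q x) ->
  nonnegative q.
Proof.
move=> cq hbe cdbe hq phi hphi; rewrite energyE// lee_fin.
have [A phiA] := C0infty_supp hphi; have [d d0 phi0] := C0infty_off0 hphi.
have cphi := C0infty_cont hphi.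
pose m : R := (N%:R - 2) / 2.
(* The vector field is A = c(|x|^2) x; [F i] is the component of phi^2 A in direction [i]. *)
pose c (s : R) := (be (ln s / 2) - m) / s.
pose dc (s : R) := dbe (ln s / 2) / (2 * s ^+ 2) - (be (ln s / 2) - m) / s ^+ 2.
have hc (s : R) : 0 < s -> is_derive s 1 c (dc s).
  move=> s0; have sn0 : s != 0 by rewrite gt_eqF.
  by rewrite /c /dc; der => //; field.
have cc_ (s : R) : 0 < s -> {for s, continuous c}.
  by move=> /hc; exact: der_cont.
have cdc (s : R) : 0 < s -> {for s, continuous dc}.
  move=> s0; have sn0 : s != 0 by rewrite gt_eqF.
  have cl : {for s, continuous (fun s : R => ln s / 2)}.
    exact: (cvgM (continuous_ln s0) (cvg_cst _)).
  have cb : {for s, continuous (fun s : R => be (ln s / 2) - m)}.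
    have cbe : {for s, continuous (fun s : R => be (ln s / 2))}.
      exact: (continuous_comp_for (g := be) cl (@prim_cont _ _ _ hbe _)).
    exact: (cvgB cbe (cvg_cst m)).
  have cdb : {for s, continuous (fun s : R => dbe (ln s / 2))}.
    exact: (continuous_comp_for (g := dbe) cl (cdbe _)).
  have cV : {for s, continuous (fun s : R => (s ^+ 2)^-1)}.
    apply: (der_cont (a := - (2%:R * s ^+ 1 * 1) / (s ^+ 2) ^+ 2)).
    by der; rewrite // expf_neq0.
  have cV2 : {for s, continuous (fun s : R => (2 * s ^+ 2)^-1)}.
    apply: (der_cont (a := - (2 * (2%:R * s ^+ 1 * 1)) / (2 * s ^+ 2) ^+ 2)).
    by der; [rewrite mulf_neq0// expf_neq0|ring].
  exact: (cvgB (cvgM cdb cV2) (cvgM cb cV)).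
pose F i x := phi x ^+ 2 * x ord0 i * c (r2 x).
pose dF i x := 2 * phi x * partial i phi x * x ord0 i * c (r2 x)
  + phi x ^+ 2 * c (r2 x) + phi x ^+ 2 * x ord0 i * (dc (r2 x) * (2 * x ord0 i)).
have hF i x : is_derive x (delta_mx ord0 i) (F i) (dF i x).
  apply: (der_off0 d0) x => [x /phi0 h|| x x0].
  - by rewrite /F h expr0n !mul0r.
  - by rewrite /dF phi0 ?r2_0//; ring.
  apply: is_derive_of_line; rewrite /F.
  under eq_fun do rewrite coord_line r2_line.
  have h1 := is_derive_to_line (C0infty_der i hphi x).
  have h2 : is_derive (0 : R) 1 (fun h => c (r2 x + 2 * x ord0 i * h + h ^+ 2))
     (dc (r2 x) * (2 * x ord0 i)).
    apply: (der_comp (f := c) (g := fun h => r2 x + 2 * x ord0 i * h + h ^+ 2)).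
      by rewrite mulr0 expr0n !addr0; apply: hc; exact: r2_gt0.
    by der; ring.
  by der; rewrite scale0r mulr0 expr0n !addr0 /dF; ring.
have cdF i : cc (dF i).
  split; last by exists A => x j /phiA h; rewrite /dF h; ring.
  apply: (cont_off0 d0) => [x /phi0 h|x x0]; first by rewrite /dF h; ring.
  have p0 := r2_gt0 x0; have cx := @coord_cont i x.
  have cr : {for x, continuous (fun x => c (r2 x))}.
    exact: (continuous_comp_for (g := c) (@r2_cont x) (cc_ _ p0)).
  have cdr : {for x, continuous (fun x => dc (r2 x))}.
    exact: (continuous_comp_for (g := dc) (@r2_cont x) (cdc _ p0)).
  have cp := cphi x.
  have cpi : {for x, continuous (partial i phi)} by exact: C0infty_partial_cont hphi x.
  have cp2 : {for x, continuous (fun x => phi x ^+ 2)}.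
    exact: for_X.
  by rewrite /dF; repeat lazymatch goal with
    | |- {for _, continuous (fun y => @?f y + @?g y)} => apply: for_D
    | |- {for _, continuous (fun y => @?f y * @?g y)} => apply: for_M
    | _ => first [assumption | exact: for_cst]
    end.
have div0 : intN (fun x => \sum_i dF i x) = 0.
  rewrite intN_sum// big1// => i _; apply: (intN_partial (hF i) (cdF i)).
  by exists A => x j /phiA h; rewrite /F h expr0n !mul0r.
have ccs : cc (fun x => \sum_i dF i x) by exact: cc_sum.
have := le_intN ccs (energy_cc cq hphi); rewrite div0; apply.
move=> x; have [->|x0] := eqVneq x 0.
  have p0 : phi 0 = 0 by rewrite phi0 ?r2_0.
  rewrite p0 expr0n mulr0 addr0; apply: ler_sum => i _.
  by rewrite /dF p0 (_ : _ + _ = 0) ?sqr_ge0//; ring.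
have p0 := r2_gt0 x0; have pn0 : r2 x != 0 by rewrite gt_eqF.
set b := be (ln (r2 x) / 2) - m.
have eF : \sum_i dF i x = \sum_i (2 * phi x * c (r2 x) * (x ord0 i * partial i phi x))
    + phi x ^+ 2 * (N%:R * c (r2 x) + 2 * dc (r2 x) * r2 x).
  rewrite {3}/r2 mulr_sumr mulrDr mulr_sumr -mulrA.
  rewrite (_ : N%:R * c (r2 x) = \sum_(i < N) c (r2 x)); last first.
    by rewrite sumr_const card_ord mulr_natl.
  rewrite mulr_sumr -!big_split/=; apply: eq_bigr => i _; rewrite /dF; ring.
have eG : \sum_i (partial i phi x - phi x * c (r2 x) * x ord0 i) ^+ 2 =
   \sum_i partial i phi x ^+ 2 + phi x ^+ 2 * c (r2 x) ^+ 2 * r2 x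
   - \sum_i (2 * phi x * c (r2 x) * (x ord0 i * partial i phi x)).
  rewrite {3}/r2 mulr_sumr -big_split/= -sumrB; apply: eq_bigr => i _; ring.
have G0 : 0 <= \sum_i (partial i phi x - phi x * c (r2 x) * x ord0 i) ^+ 2.
  by apply: sumr_ge0 => i _; exact: sqr_ge0.
suff : phi x ^+ 2 * (N%:R * c (r2 x) + 2 * dc (r2 x) * r2 x + c (r2 x) ^+ 2 * r2 x)
    <= phi x ^+ 2 * q x.
  move: G0; rewrite eF eG; set S1 := \sum_i _; set S2 := \sum_i _.
  by move=> h1 h2; rewrite (mulrC (q x)); lra.
rewrite ler_wpM2l ?sqr_ge0//.
(* This is div A + |A|^2. The shift of [be] by m = (N-2)/2 completes the square and removes the term
   linear in [be], leaving the one-dimensional Riccati expression. *)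
have -> : N%:R * c (r2 x) + 2 * dc (r2 x) * r2 x + c (r2 x) ^+ 2 * r2 x =
  (dbe (ln (r2 x) / 2) + be (ln (r2 x) / 2) ^+ 2 - m ^+ 2) / r2 x.
  by rewrite /c /dc /m; field.
by rewrite ler_pdivrMr// [leRHS]mulrC; have := hq x x0; rewrite -/m; lra.
Qed.

End Radial.

(** * Smooth test functions *)

Section Smooth.
Context {R : realType}.
Implicit Types (f g F : R -> R) (P : {poly R}).

(* x |-> P(1/x) e^{-1/x} for x > 0, extended by 0: these functions are stable
   under derivation. *)
Definition flat P (x : R) : R := if 0 < x then P.[x^-1] * expR (- x^-1) else 0.

Lemma pow_exp_le n (u : R) : 0 <= u -> u ^+ n * expR (- u) <= n`!%:R.
Proof.
move=> u0; rewrite expRN ler_pdivrMr ?expR_gt0//.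
case: n => [|n]; first by rewrite expr0 fact0 mul1r -expR0 ler_expR.
have := expR_ge1Dxn n u0; have f0 : 0 < (n.+1)`!%:R :> R by rewrite ltr0n fact_gt0.
move=> h; rewrite mulrC -ler_pdivrMr//; apply: (le_trans _ h); lra.
Qed.

(** After division by x^2 each monomial becomes u^n e^{-u} with u = 1/x, which is at most n!. The
    quadratic bound gives derivative 0 at the origin. *)
Lemma flat_bound P : exists2 C, 0 <= C & forall x, `|flat P x| <= C * x ^+ 2.
Proof.
exists (\sum_(i < size P) `|P`_i| * (i.+2)`!%:R).
  by apply: sumr_ge0 => i _; rewrite mulr_ge0.
move=> x; rewrite /flat; case: ifPn => x0; last first.
  by rewrite normr0 mulr_ge0 ?sqr_ge0// sumr_ge0// => i _; rewrite mulr_ge0.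
have u0 : 0 <= x^-1 by rewrite invr_ge0 ltW.
rewrite normrM (gtr0_norm (expR_gt0 _)) horner_coef.
apply: (@le_trans _ _ (\sum_(i < size P) `|P`_i| * x^-1 ^+ i * expR (- x^-1))).
  rewrite -mulr_suml ler_wpM2r ?expR_ge0//.
  rewrite (le_trans (ler_norm_sum _ _ _))//; apply: ler_sum => i _.
  by rewrite normrM normrX (ger0_norm u0).
rewrite mulr_suml; apply: ler_sum => i _.
rewrite -!mulrA ler_wpM2l// -ler_pdivrMr ?exprn_gt0// mulrAC -exprVn -exprD addn2.
exact: pow_exp_le.
Qed.

Lemma is_derive_sq_bound f (C : R) : (forall x, `|f x| <= C * x ^+ 2) ->
  is_derive (0 : R) 1 f 0.
Proof.
move=> fC; have f0 : f 0 = 0.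
  by apply/eqP; rewrite -normr_le0 (le_trans (fC 0))// expr0n mulr0.
apply/is_derive1_caratheodory; exists (fun z => f z / z); split.
- move=> z; rewrite f0 !subr0; have [->|z0] := eqVneq z 0; last by rewrite divfK.
  by rewrite f0 mulr0.
- rewrite /prop_for /continuous_at invr0 mulr0; apply/cvgr0Pnorm_le => e e0.
  pose d := e / (1 + `|C|); have d0 : 0 < d by rewrite divr_gt0// ltr_pwDl.
  have := nbhsx_ballx (0 : R) d d0; apply: filterS => z.
  rewrite /ball/= sub0r normrN => zd; have [->|z0] := eqVneq z 0.
    by rewrite invr0 mulr0 normr0 ltW.
  have z1 : 0 < `|z| by rewrite normr_gt0.
  rewrite normrM normfV ler_pdivrMr// (le_trans (fC z))//.
  rewrite -(real_normK (num_real z)) expr2 mulrA ler_wpM2r//.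
  rewrite (@le_trans _ _ ((1 + `|C|) * `|z|))//.
    by rewrite ler_wpM2r// (le_trans (ler_norm C))// lerDr.
  by rewrite mulrC -ler_pdivlMr ?ltr_pwDl// ltW.
- by rewrite invr0 mulr0.
Qed.

Lemma flat_der P : prim_of (flat P) (flat ('X^2 * (P - P^`()))).
Proof.
move=> x; case: (ltgtP 0 x) => [x0|x0|<-].
- have xn0 : x != 0 by rewrite gt_eqF.
  apply: (@near_eq_is_derive R R R (fun u : R => P.[u^-1] * expR (- u^-1))).
    have : \forall u \near x, 0 < u by exact: lt_nbhsr.
    by apply: filterS => u u0; rewrite /flat u0.
  have hP : is_derive x^-1 1 (horner P) (P^`()).[x^-1].
    by rewrite derivE derive1E; apply: derivableP; exact: derivable_horner.
  have hV : is_derive x 1 (fun x : R => x^-1) (- 1 / x ^+ 2) by der.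
  have hPV := der_comp hP hV.
  by rewrite /flat x0 hornerM hornerXn hornerD hornerN; der => //; field.
- apply: (@near_eq_is_derive _ _ _ (fun=> 0)).
    have : \forall u \near x, u < 0 by exact: lt_nbhsl.
    by apply: filterS => u u0; rewrite /flat ltNge (ltW u0).
  by rewrite /flat ltNge (ltW x0); exact: is_derive_cst.
- have [C C0 hC] := flat_bound P.
  have -> : flat ('X^2 * (P - P^`())) 0 = 0 by rewrite /flat ltxx.
  exact: (is_derive_sq_bound hC).
Qed.

Lemma flat1_ge0 x : 0 <= flat 1 x.
Proof. by rewrite /flat; case: ifP => // _; rewrite hornerE mul1r expR_ge0. Qed.

(** A class of smooth functions given by construction: the derivative of each constructor is again
    in the class, so all orders are obtained by iterating one lemma. Closure under primitives
    supplies the smooth step and the approximations. *)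
Inductive sm : (R -> R) -> Prop :=
| sm_flat P : sm (flat P)
| sm_cst c : sm (fun=> c)
| sm_add f g : sm f -> sm g -> sm (fun x => f x + g x)
| sm_mul f g : sm f -> sm g -> sm (fun x => f x * g x)
| sm_aff f (a b : R) : sm f -> sm (fun x => f (a * x + b))
| sm_prim F f : sm f -> prim_of F f -> sm F.

Lemma sm_der f : sm f -> exists2 df, sm df & prim_of f df.
Proof.
elim=> [P|c|{}f g _ [df sf hf] _ [dg sg hg]|{}f g sf0 [df sf hf] sg0 [dg sg hg]
  |{}f a b _ [df sf hf]|F {}f sf _ hF].
- by exists (flat ('X^2 * (P - P^`()))); [exact: sm_flat|exact: flat_der].
- by exists (fun=> 0); [exact: sm_cst|move=> x; der].
- by exists (fun x => df x + dg x); [exact: sm_add|move=> x; der].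
- exists (fun x => df x * g x + f x * dg x); last by move=> x; der.
  by apply: sm_add; exact: sm_mul.
- exists (fun x => a * df (a * x + b)); last by move=> x; der; ring.
  by apply: sm_mul; [exact: sm_cst|exact: sm_aff].
- by exists f.
Qed.

Lemma sm_cont f : sm f -> continuous f.
Proof. by move=> /sm_der[df _ hf]; exact: (prim_cont hf). Qed.

(** The normalised primitive of the bump [b0], a product of two flat functions, positive exactly
    inside (0,1). *)
Lemma step_exists : exists Th dTh : R -> R,
  [/\ sm Th, prim_of Th dTh, continuous dTh, (forall x, 0 <= dTh x) &
   [/\ forall x, x <= 0 -> Th x = 0, forall x, 1 <= x -> Th x = 1,
       forall x, 0 <= Th x <= 1, forall x, x <= 0 -> dTh x = 0 &
       forall x, 1 <= x -> dTh x = 0]].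
Proof.
pose b0 x := flat 1 x * flat 1 (- 1 * x + 1).
have sb : sm b0 by apply: sm_mul; [exact: sm_flat|apply: sm_aff; exact: sm_flat].
have cb := sm_cont sb.
have b00 x : 0 <= b0 x by rewrite mulr_ge0// flat1_ge0.
have b0N x : x <= 0 -> b0 x = 0 by move=> x0; rewrite /b0 /flat ltNge x0 mul0r.
have b01 x : 1 <= x -> b0 x = 0.
  move=> x1; rewrite /b0 /flat [X in _ * X]ifF ?mulr0//.
  by apply/negbTE; rewrite -leNgt; lra.
have [B [B0 hB]] := prim_exists cb.
have B00 x : x <= 0 -> B x = 0.
  move=> x0; rewrite -B0; apply: cst_der => // y /andP[_ y0].
  by rewrite -(b0N y y0); exact: hB.
have B11 x : 1 <= x -> B x = B 1.
  move=> x1; apply/esym; apply: cst_der => // y /andP[y1 _].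
  by rewrite -(b01 y y1); exact: hB.
have Bnd x y : x <= y -> B x <= B y.
  by move=> xy; apply: (le_der (df := b0)) => // z _; exact: hB.
have B1 : 0 < B 1.
  rewrite (@lt_le_trans _ _ (B (3 / 4)))//; last by apply: Bnd; lra.
  rewrite (@le_lt_trans _ _ (B (1 / 4)))//; first by rewrite -B0; apply: Bnd; lra.
  apply: (lt_der (df := b0)); [lra|by move=> z _; exact: hB|].
  move=> z /andP[z1 z2]; rewrite /b0 /flat !ifT; [|lra|lra].
  by rewrite -!polyC1 !hornerC !mul1r; apply: mulr_gt0; exact: expR_gt0.
exists (fun x => B x * (B 1)^-1), (fun x => b0 x * (B 1)^-1).
have Bn0 : B 1 != 0 by rewrite gt_eqF.
have V0 : 0 <= (B 1)^-1 by rewrite invr_ge0 ltW.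
split.
- by apply: sm_mul; [exact: (sm_prim sb hB)|exact: sm_cst].
- by move=> x; der; ring.
- by move=> x; apply: for_M; [exact: cb|exact: for_cst].
- by move=> x; rewrite mulr_ge0.
- split.
  + by move=> x /B00 ->; rewrite mul0r.
  + by move=> x /B11 ->; rewrite divff.
  + move=> x; rewrite ler_pdivrMr// mul1r; apply/andP; split.
      rewrite mulr_ge0//; case: (leP x 0) => [/B00 ->//|/ltW x0].
      by rewrite -B0; exact: Bnd.
    by case: (leP 1 x) => [/B11 ->//|/ltW x1]; exact: Bnd.
  + by move=> x /b0N ->; rewrite mul0r.
  + by move=> x /b01 ->; rewrite mul0r.
Qed.

Lemma heine f (a b e : R) : continuous f -> 0 < e ->
  exists2 d, 0 < d & forall x y, a <= x <= b -> `|x - y| < d -> `|f x - f y| <= e.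
Proof.
move=> cf e0.
have /compact_near_coveringP cov := @segment_compact R a b.
have e2 : 0 < e / 2 by lra.
have := cov _ ((0 : R)^'+) (fun d x => forall y, `|x - y| < d -> `|f x - f y| <= e).
have h : forall x, `[a, b]%classic x -> \forall x' \near x & d \near (0 : R)^'+,
    forall y, `|x' - y| < d -> `|f x' - f y| <= e.
  move=> x _; have /cvgrPdist_le/(_ _ e2)/nbhs_ballP[r /= r0 hr] := cf x.
  have r2 : 0 < r / 2 by lra.
  exists (ball x (r / 2), [set d | 0 < d < r / 2]) => /=.
    split; first exact: nbhsx_ballx.
    near=> d; apply/andP; split; near: d; first exact: nbhs_right_gt.
    exact: nbhs_right_lt.
  move=> [x' d] /= [xx' /andP[d0 dr]] y x'y.
  have hx' : ball x r x' by rewrite /ball/= (lt_trans xx')//; lra.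
  have hy : ball x r y.
    rewrite /ball/= -[x - y](subrKA x') addrC.
    rewrite (le_lt_trans (ler_normD _ _))// addrC (_ : r = r / 2 + r / 2); last lra.
    by rewrite ltrD// (lt_trans x'y).
  have -> : f x' - f y = (f x - f y) - (f x - f x') by ring.
  rewrite (le_trans (ler_normB _ _))// (_ : e = e / 2 + e / 2); last lra.
  by rewrite lerD// hr.
move=> /(_ _ h) hd.
have : \forall d \near (0 : R)^'+, 0 < d /\
    (`[a, b]%classic `<=` (fun x => forall y, `|x - y| < d -> `|f x - f y| <= e)).
  near=> d; split; first by near: d; exact: nbhs_right_gt.
  by near: d.
move=> /filter_ex[d [d0 hfd]]; exists d => // x y xab; apply: hfd.
by rewrite /= in_itv.
Unshelve. all: by end_near. Qed.

(** A smooth staircase: on each cell of a mesh finer than the modulus of continuity, a rescaled step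
    joins the values of [g] at the two ends, so the sum stays between them. *)
Lemma sm_approx_cont g (a b e : R) : a < b -> continuous g -> 0 < e ->
  (forall x, x <= a -> g x = 0) -> (forall x, b <= x -> g x = 0) ->
  exists S, [/\ sm S, (forall x, `|S x - g x| <= e) & forall x, x <= a -> S x = 0].
Proof.
move=> ab cg e0 ga gb.
have [Th [dTh [sTh _ _ _ [Th0 Th1 Th01 _ _]]]] := step_exists.
have e2 : 0 < e / 2 by lra.
have [d d0 hd] := heine a b cg e2.
have ba : 0 < b - a by rewrite subr_gt0.
have [n hn] : exists n : nat, (b - a) / n.+1%:R < d.
  have /ltr_add_invr[n hn] : 0 < d / (b - a) by rewrite divr_gt0.
  by exists n; rewrite add0r ltr_pdivlMr// mulrC in hn.
pose h := (b - a) / n.+1%:R; have h0 : 0 < h by rewrite divr_gt0.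
pose t (k : nat) := a + k%:R * h.
have tS k : t k.+1 = t k + h by rewrite /t mulrS; ring.
have tn : t n.+1 = b.
  by rewrite /t /h mulrC divfK ?pnatr_eq0// addrC subrK.
have tmono k : t k <= t k.+1 by rewrite tS lerDl ltW.
have ta k : a <= t k by rewrite /t lerDl mulr_ge0// ltW.
have tb k : (k <= n.+1)%N -> t k <= b.
  by move=> kn; rewrite -tn /t lerD2l ler_wpM2r ?ler_nat// ltW.
have ind k : (k <= n.+1)%N -> exists S, [/\ sm S,
    (forall x, x <= t k -> `|S x - g x| <= e), (forall x, t k <= x -> S x = g (t k)) &
    forall x, x <= a -> S x = 0].
  elim: k => [_|k IH kn].
    have t0 : t 0 = a by rewrite /t mul0r addr0.
    exists (fun=> 0); split => [||x|//]; first exact: sm_cst.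
      by move=> x; rewrite t0 => /ga ->; rewrite subrr normr0 ltW.
    by rewrite t0 ga.
  have [S [sS S1 S2 S3]] := IH (ltnW kn).
  have eh x : h^-1 * x + (- t k / h) = (x - t k) / h by rewrite mulrBl mulrC mulNr.
  have Tl x : x <= t k -> Th (h^-1 * x + (- t k / h)) = 0.
    by move=> xk; rewrite eh Th0// pmulr_lle0 ?invr_gt0// subr_le0.
  exists (fun x => S x + (g (t k.+1) - g (t k)) * Th (h^-1 * x + (- t k / h))); split.
  - apply: sm_add => //; apply: sm_mul; first exact: sm_cst.
    exact: (sm_aff h^-1 (- t k / h)).
  - move=> x xt; case: (leP x (t k)) => [xk|/ltW tkx].
      by rewrite Tl// mulr0 addr0 S1.
    rewrite S2// eh; have /andP[T0 T1] := Th01 ((x - t k) / h).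
    have hx : x - t k < d.
      by rewrite (le_lt_trans _ hn)// -/h lerBlDl -tS.
    have A1 : `|g (t k) - g x| <= e / 2.
      by apply: hd; rewrite ?ta ?tb ?(ltnW kn)// ler0_norm ?subr_le0// opprB.
    have A2 : `|g (t k) - g (t k.+1)| <= e / 2.
      apply: hd; rewrite ?ta ?tb ?(ltnW kn)// ler0_norm ?subr_le0// opprB tS.
      by rewrite addrAC subrr add0r.
    move: T0 T1; set T := Th _ => T0 T1.
    rewrite addrAC (le_trans (ler_normD _ _))// (_ : e = e / 2 + e / 2); last lra.
    rewrite lerD// normrM distrC (le_trans _ A2)// (ger0_norm T0).
    by rewrite ler_piMr.
  - move=> x xt; have tx := le_trans (tmono k) xt.
    rewrite S2// eh Th1 ?mulr1; first by rewrite addrC subrK.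
    by rewrite ler_pdivlMr// mul1r lerBrDl -tS.
  - by move=> x xa; rewrite S3// Tl ?mulr0 ?addr0// (le_trans xa).
have [S [sS S1 S2 S3]] := ind n.+1 (leqnn _).
exists S; split => // x; case: (leP x (t n.+1)) => [/S1//|/ltW tx].
rewrite tn in tx; rewrite S2 tn//.
by rewrite gb// gb// subrr normr0 ltW.
Qed.

(** The derivative is approximated and integrated from [a]. The resulting primitive need not vanish
    beyond [b], where it is merely small, so it is cut off by [chi] on [b, b + 1]. *)
Lemma sm_approx rho drho (a b e : R) : a < b -> 0 < e ->
  prim_of rho drho -> continuous drho ->
  (forall x, x <= a -> rho x = 0) -> (forall x, b <= x -> rho x = 0) ->
  (forall x, x <= a -> drho x = 0) -> (forall x, b <= x -> drho x = 0) ->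
  exists f df, [/\ sm f, prim_of f df, (forall x, x <= a -> f x = 0),
    (forall x, b + 1 <= x -> f x = 0) &
    (forall x, `|f x - rho x| <= e) /\ (forall x, `|df x - drho x| <= e)].
Proof.
move=> ab e0 hrho cdrho ra rb da db.
have [Th [dTh [sTh hTh cdTh dTh0 [Th0 Th1 Th01 dTh00 dTh1]]]] := step_exists.
have [K K0 dThK0] : exists2 K, 0 < K & forall x, `|dTh x| <= K.
  have l01 : 0 <= 1 :> R by [].
  have [K K0 hK] := bounded_seg l01 cdTh; exists K => // x.
  case: (leP x 0) => [/dTh00 ->|/ltW x0]; first by rewrite normr0 ltW.
  case: (leP 1 x) => [/dTh1 ->|/ltW x1]; first by rewrite normr0 ltW.
  by apply: hK; rewrite x0.
pose L := b + 1 - a; have L0 : 0 < L by rewrite /L; lra.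
(* It dominates [L], the loss from integrating, and [1 + L * K], the loss from differentiating the
   product with the cutoff. *)
pose M := (1 + L) * (1 + K); have M0 : 0 < M by rewrite mulr_gt0//; lra.
pose e1 := e / M; have e10 : 0 < e1 by rewrite divr_gt0.
have [S [sS SP Sa]] := sm_approx_cont ab cdrho e10 da db.
have [P0 [P00 hP0]] := prim_exists (sm_cont sS).
pose P x := P0 x + - P0 a.
have hP : prim_of P S by move=> x; rewrite /P; der; ring.
have sP : sm P by exact: (sm_prim sS hP).
have Pa x : x <= a -> P x = 0.
  move=> xa; rewrite /P (_ : P0 x = P0 a) ?subrr//; apply: cst_der => // y /andP[_ ya].
  by rewrite -(Sa y ya); exact: hP0.
have D1 x : x <= b + 1 -> `|P x - rho x| <= e1 * L.
  move=> xb; case: (leP x a) => [xa|/ltW ax].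
    by rewrite Pa// ra// subrr normr0 mulr_ge0 ?ltW.
  have Pra : P a - rho a = 0 by rewrite Pa// ra// subrr.
  have : `|(P x - rho x) - (P a - rho a)| <= e1 * x - e1 * a.
    apply: (@norm_der R (fun y => P y - rho y) (fun y => e1 * y) (fun y => S y - drho y)
      (fun=> e1) a x ax) => y _; [by der|by der; ring|exact: SP].
  rewrite Pra subr0 => h; apply: (le_trans h).
  by rewrite -mulrBr ler_wpM2l ?(ltW e10)// /L; lra.
have Mb : e1 * (1 + L * K) <= e /\ e1 * L <= e.
  have -> : e = e1 * M by rewrite /e1 divfK// gt_eqF.
  by split; rewrite ler_wpM2l ?(ltW e10)// /M; nra.
pose chi x := Th (-1 * x + (b + 1)); pose dchi x := - dTh (-1 * x + (b + 1)).
have hchi : prim_of chi dchi by move=> x; rewrite /chi /dchi; der; ring.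
exists (fun x => P x * chi x), (fun x => S x * chi x + P x * dchi x).
have chi1 x : x <= b -> chi x = 1 by move=> xb; rewrite /chi Th1//; clear -xb; lra.
have dchi1 x : x <= b -> dchi x = 0 by move=> xb; rewrite /dchi dTh1 ?oppr0//; clear -xb; lra.
have chi0 x : b + 1 <= x -> chi x = 0 by move=> xb; rewrite /chi Th0//; clear -xb; lra.
have dchi0 x : b + 1 <= x -> dchi x = 0 by move=> xb; rewrite /dchi dTh00 ?oppr0//; clear -xb; lra.
have chi01 x : `|chi x| <= 1.
  by have /andP[? ?] := Th01 (-1 * x + (b + 1)); rewrite ger0_norm.
split.
- by apply: sm_mul => //; exact: (sm_aff (-1) (b + 1)).
- by move=> x; der.
- by move=> x /Pa ->; rewrite mul0r.
- by move=> x /chi0 ->; rewrite mulr0.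
split=> x.
- have -> : P x * chi x - rho x = (P x - rho x) * chi x.
    rewrite [RHS]mulrBl; congr (_ - _).
    by case: (leP x b) => [/chi1 ->|/ltW/rb ->]; rewrite ?mulr1// mul0r.
  case: (leP (b + 1) x) => [/chi0 ->|/ltW xb]; first by rewrite mulr0 normr0 ltW.
  rewrite normrM (le_trans _ Mb.2)// (le_trans _ (D1 x xb))//.
  by rewrite ler_piMr.
- have -> : S x * chi x + P x * dchi x - drho x =
      (S x - drho x) * chi x + (P x - rho x) * dchi x.
    have e1' : drho x * chi x = drho x.
      by case: (leP x b) => [/chi1 ->|/ltW/db ->]; rewrite ?mulr1// mul0r.
    have e2' : rho x * dchi x = 0.
      by case: (leP x b) => [/dchi1 ->|/ltW/rb ->]; rewrite ?mulr0// mul0r.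
    have e3 : drho x = drho x * chi x + rho x * dchi x by rewrite e1' e2' addr0.
    by rewrite [X in _ - X = _]e3; ring.
  rewrite (le_trans (ler_normD _ _))// (le_trans _ Mb.1)// mulrDr mulr1 lerD//.
    by rewrite normrM (le_trans _ (SP x))// ler_piMr.
  case: (leP (b + 1) x) => [/dchi0 ->|/ltW xb].
    by rewrite mulr0 normr0; apply: mulr_ge0; [|apply: mulr_ge0]; exact: ltW.
  by rewrite normrM mulrA ler_pM// ?D1// /dchi normrN.
Qed.

End Smooth.

(** * The radial quadratic form *)

Section RadialForm.
Context {R : realType} {N : nat}.

(** A partial derivative of [f (r2 x)] produces a coordinate factor, so the coordinates must be
    included for the class to be stable under all partial derivatives. *)
Inductive rad : ('rV[R]_N -> R) -> Prop :=
| rad_r2 f : sm f -> rad (fun x => f (r2 x))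
| rad_coord i : rad (fun x => x ord0 i)
| rad_cst c : rad (fun=> c)
| rad_add f g : rad f -> rad g -> rad (fun x => f x + g x)
| rad_mul f g : rad f -> rad g -> rad (fun x => f x * g x).

Lemma is_derive_r2 (f df : R -> R) (x : 'rV[R]_N) i : is_derive (r2 x) 1 f (df (r2 x)) ->
  is_derive x (delta_mx ord0 i) (fun y => f (r2 y)) (df (r2 x) * (2 * x ord0 i)).
Proof.
move=> hf; apply: is_derive_of_line; under eq_fun do rewrite r2_line.
apply: (der_comp (f := f) (g := fun h => r2 x + 2 * x ord0 i * h + h ^+ 2)).
  by rewrite mulr0 expr0n !addr0.
by der; ring.
Qed.

Lemma rad_der F i : rad F -> exists2 dF, rad dF &
  forall x, is_derive x (delta_mx ord0 i) F (dF x).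
Proof.
elim=> [f sf|j|c|f g _ [df sf hf] _ [dg sg hg]|f g rf [df sf hf] rg [dg sg hg]].
- have [df sdf hf] := sm_der sf.
  exists (fun x => df (r2 x) * (2 * x ord0 i)).
    apply: rad_mul; first exact: rad_r2.
    by apply: rad_mul; [exact: rad_cst|exact: rad_coord].
  by move=> x; exact: is_derive_r2.
- exists (fun=> (i == j)%:R); first exact: rad_cst.
  move=> x; apply: is_derive_of_line.
  have -> : (fun h : R => (x + h *: delta_mx ord0 i) ord0 j) =
      (fun h => x ord0 j + h * (i == j)%:R).
    by apply/funext => h; rewrite !mxE eqxx eq_sym.
  by der; ring.
- by exists (fun=> 0); [exact: rad_cst|move=> x; exact: is_derive_cst].
- exists (fun x => df x + dg x); first exact: rad_add.
  move=> x; apply: is_derive_of_line.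
  have h1 := is_derive_to_line (hf x); have h2 := is_derive_to_line (hg x).
  by der.
- exists (fun x => df x * g x + f x * dg x).
    by apply: rad_add; exact: rad_mul.
  move=> x; apply: is_derive_of_line.
  have h1 := is_derive_to_line (hf x); have h2 := is_derive_to_line (hg x).
  by der; rewrite scale0r addr0.
Qed.

Lemma rad_continuous F : rad F -> continuous F.
Proof.
elim=> [f sf|j|c|f g _ cf _ cg|f g _ cf _ cg] x.
- by apply: (continuous_comp_for (g := f)); [exact: r2_cont|exact: sm_cont].
- exact: coord_cont.
- exact: for_cst.
- exact: (for_D (cf x) (cg x)).
- exact: (for_M (cf x) (cg x)).
Qed.

Lemma rad_iter s F : rad F -> rad (iter_partial s F).
Proof.
move=> rF; elim: s => [//|i s IH] /=.
have [dF rdF hdF] := rad_der i IH.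
rewrite (_ : partial i _ = dF)//; apply/funext => x.
by rewrite /partial; case: (hdF x).
Qed.

Lemma rad_smooth F : rad F -> smooth F.
Proof.
move=> rF s; have rs := rad_iter s rF; split; first exact: rad_continuous.
by move=> i x; have [dF _ /(_ x)[]] := rad_der i rs.
Qed.

Lemma radial_C0infty f (b : R) : sm f -> (forall s, b <= s -> f s = 0) ->
  C0infty [set: 'rV[R]_N] (fun x => f (r2 x)).
Proof.
move=> sf fb; split => //; first by apply: rad_smooth; exact: rad_r2.
pose B := 1 + `|b|.
have cK : compact [set x : 'rV[R]_N | forall i, x ord0 i \in `[- B, B]].
  apply: (@rV_compact _ _ (fun=> `[- B, B]%classic)) => _; exact: segment_compact.
apply: (subclosed_compact (@closed_closure _ _) cK).
apply: (@subset_trans _ [set x : 'rV[R]_N | r2 x <= b]).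
  rewrite closureE; apply: smallest_sub.
    apply: (@closed_comp _ _ r2 [set s | s <= b]); last exact: closed_le.
    by move=> x _; exact: r2_cont.
  by move=> x /=; apply: contraNT; rewrite -ltNge => /ltW /fb ->.
move=> x /= xb i; rewrite in_itv/= -ler_norml.
have h := le_trans (r2_coord x i) xb.
rewrite -(ler_pXn2r (_ : 0 < 2)%N) ?nnegrE ?addr_ge0//.
rewrite real_normK ?num_real// (le_trans h)// /B (le_trans (ler_norm b))//.
by have := normr_ge0 b; set c := `|b|; nra.
Qed.

Lemma radial_C0infty_off0 f (a b : R) : 0 < a -> sm f ->
  (forall s, s <= a -> f s = 0) -> (forall s, b <= s -> f s = 0) ->
  C0infty [set x : 'rV[R]_N | x != 0] (fun x => f (r2 x)).
Proof.
move=> a0 sf fa fb; have [h1 h2 _] := radial_C0infty sf fb; split => //.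
apply: (@subset_trans _ [set x : 'rV[R]_N | a <= r2 x]).
  rewrite closureE; apply: smallest_sub.
    apply: (@closed_comp _ _ r2 [set s | a <= s]); last exact: closed_ge.
    by move=> x _; exact: r2_cont.
  by move=> x /=; apply: contraNT; rewrite -ltNge => /ltW /fa ->.
by move=> x /=; apply: contraTneq => ->; rewrite r2_0 -ltNge.
Qed.

Lemma cc_r2 f (b : R) : continuous f -> (forall s, b < s -> f s = 0) ->
  cc (fun x : 'rV[R]_N => f (r2 x)).
Proof.
move=> cf fb; split.
  by move=> x; apply: (continuous_comp_for (g := f)); [exact: r2_cont|exact: cf].
exists (1 + `|b|) => x i hx; apply: fb; apply: lt_le_trans (r2_coord x i).
rewrite -(real_normK (num_real (x ord0 i))).
have := normr_ge0 b; have := ler_norm b; move: hx.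
by set c := `|b|; set u := `|_|; nra.
Qed.

Lemma cc_of_log g (a b : R) : continuous g -> (forall t, t < a -> g t = 0) ->
  (forall t, b < t -> g t = 0) -> cc (fun x : 'rV[R]_N => of_log g (r2 x)).
Proof.
move=> cg ga gb; apply: (@cc_r2 _ (expR (2 * b))); first exact: of_log_cont ga.
by move=> s; exact: of_log_large.
Qed.

(** With t = ln |x| this is |x|^-N g, the density whose integral over R^N is a constant times the
    integral of [g] over the line. *)
Definition weighted g (t : R) : R := expR (- N%:R * t) * g t.

Lemma weighted_cont g : continuous g -> continuous (weighted g).
Proof.
move=> cg t; have h : {for t, continuous (fun u : R => expR (- N%:R * u))}.
  by apply: (der_cont (a := expR (- N%:R * t) * - N%:R)); der; ring.
exact: (for_M h (cg t)).
Qed.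

Lemma cc_weighted g (a b : R) : continuous g -> (forall t, t < a -> g t = 0) ->
  (forall t, b < t -> g t = 0) ->
  cc (fun x : 'rV[R]_N => of_log (weighted g) (r2 x)).
Proof.
move=> cg ga gb; apply: (@cc_of_log _ a b); first exact: weighted_cont.
  by move=> t /ga; rewrite /weighted => ->; rewrite mulr0.
by move=> t /gb; rewrite /weighted => ->; rewrite mulr0.
Qed.

(* |x|^-N g(ln |x|) is the divergence of x |x|^-N G(ln |x|) for a primitive G
   of g. *)
Lemma intN_polar0 g G (a b : R) : continuous g -> prim_of G g ->
  (forall t, t < a -> G t = 0) -> (forall t, b < t -> G t = 0) ->
  (forall t, t < a -> g t = 0) -> (forall t, b < t -> g t = 0) ->
  intN (fun x : 'rV[R]_N => of_log (weighted g) (r2 x)) = 0.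
Proof.
move=> cg hG Ga Gb ga gb; have cG := prim_cont hG.
pose dk t := expR (- N%:R * t) * (g t - N%:R * G t).
have hk : prim_of (weighted G) dk by move=> t; rewrite /weighted /dk; der; ring.
have cdk : continuous dk.
  have cg' : continuous (fun t => g t - N%:R * G t).
    move=> t; apply: (for_D (cg t)); apply: (der_cont (a := - (N%:R * g t))).
    by der; ring.
  exact: (weighted_cont cg').
have dka t : t < a -> dk t = 0 by move=> h; rewrite /dk ga// Ga//; ring.
have dkb t : b < t -> dk t = 0 by move=> h; rewrite /dk gb// Gb//; ring.
have ka t : t < a -> weighted G t = 0 by move=> h; rewrite /weighted Ga// mulr0.
pose k2 t := dk t / (2 * expR (2 * t)).
have ck2 : continuous k2.
  move=> t; apply: (for_M (cdk t)).
  have e0 : 2 * expR (2 * t) != 0 by rewrite mulf_neq0// gt_eqF ?expR_gt0.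
  by apply: (der_cont (a := - (2 * (expR (2 * t) * 2)) / (2 * expR (2 * t)) ^+ 2)); der => //; ring.
have hof := of_log_der hk ka dka.
pose F i (x : 'rV[R]_N) := of_log (weighted G) (r2 x) * x ord0 i.
pose dF i (x : 'rV[R]_N) := of_log (weighted G) (r2 x) +
  of_log k2 (r2 x) * (2 * x ord0 i * x ord0 i).
have ccG : cc (fun x : 'rV[R]_N => of_log (weighted G) (r2 x)) by exact: cc_weighted Ga Gb.
have cck2 : cc (fun x : 'rV[R]_N => of_log k2 (r2 x)).
  by apply: (cc_of_log (a := a) (b := b)) => // t h; rewrite /k2; [rewrite dka|rewrite dkb]; rewrite ?mul0r.
have hF i x : is_derive x (delta_mx ord0 i) (F i) (dF i x).
  apply: is_derive_of_line.
  have h1 : is_derive x (delta_mx ord0 i) (fun y => of_log (weighted G) (r2 y))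
    (of_log k2 (r2 x) * (2 * x ord0 i)) by apply: is_derive_r2; exact: hof.
  have h2 := is_derive_to_line h1; rewrite /F /dF.
  have -> : (fun h : R => of_log (weighted G) (r2 (x + h *: delta_mx ord0 i)) *
      (x + h *: delta_mx ord0 i) ord0 i) =
    (fun h : R => of_log (weighted G) (r2 (x + h *: delta_mx ord0 i)) * (x ord0 i + h)).
    by apply/funext => h; rewrite coord_line.
  by der; rewrite scale0r !addr0; ring.
have cdF i : cc (dF i).
  have c2 : continuous (fun y : 'rV[R]_N => 2 * y ord0 i * y ord0 i).
    suff h x : {for x, continuous (fun y : 'rV[R]_N => 2 * y ord0 i * y ord0 i)}.
      exact: h.
    have cx : {for x, continuous (fun y : 'rV[R]_N => y ord0 i)} by exact: coord_cont.
    by apply: for_M => //; apply: for_M => //; exact: for_cst.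
  exact: (ccD ccG (ccM cck2 c2)).
have e : \sum_i intN (dF i) = 0.
  apply: big1 => i _; apply: (intN_partial (hF i) (cdF i)).
  have [_ [A hA]] := ccG; exists A => x j /hA; rewrite /F => ->; exact: mul0r.
rewrite -e -intN_sum//; apply: eq_intN => x; rewrite /dF big_split/=.
have -> : \sum_i of_log k2 (r2 x) * (2 * x ord0 i * x ord0 i) =
    of_log k2 (r2 x) * 2 * r2 x.
  by rewrite {3}/r2 mulr_sumr; apply: eq_bigr => i _; ring.
rewrite sumr_const card_ord -mulr_natl.
have [r0|r0] := ltP 0 (r2 x); last by rewrite /of_log ltNge r0/=; ring.
rewrite !of_log_gt0// /weighted /k2 /dk (_ : 2 * (ln (r2 x) / 2) = ln (r2 x)); last by field.
by rewrite lnK//; field; rewrite gt_eqF.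
Qed.

(** The constant is read off a reference profile [g0]. Subtracting from [g] the multiple [c * g0]
    with the same total integral leaves a function with a compactly supported primitive, whose
    weighted integral is 0 by [intN_polar0]. *)
Lemma intN_polar : (0 < N)%N -> exists2 om : R, 0 < om &
  forall g G (a b : R), a <= b -> continuous g -> prim_of G g ->
  (forall t, t <= a -> g t = 0) -> (forall t, b <= t -> g t = 0) ->
  intN (fun x : 'rV[R]_N => of_log (weighted g) (r2 x)) = om * (G b - G a).
Proof.
move=> N0.
pose g0 (t : R) := Num.max 0 (1 - t ^+ 2).
have cg0 : continuous g0.
  move=> t; apply: (@continuous_max _ _ (fun=> 0) (fun t : R => 1 - t ^+ 2)).
    exact: for_cst.
  by apply: (der_cont (a := - (2 * t))); der; ring.
have g0a t : t < -1 -> g0 t = 0.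
  by move=> h; rewrite /g0 max_l// subr_le0; nra.
have g0b t : 1 < t -> g0 t = 0.
  by move=> h; rewrite /g0 max_l// subr_le0; nra.
have [G0 [_ hG0]] := prim_exists cg0.
have I0 : 0 < G0 1 - G0 (-1).
  rewrite subr_gt0 (@lt_le_trans _ _ (G0 (1/2)))//.
    apply: (@le_lt_trans _ _ (G0 (-(1/2)))).
      apply: (le_der (df := g0)); [lra|by move=> *; exact: hG0|].
      by move=> x _; rewrite /g0 le_max lexx.
    apply: (lt_der (df := g0)); [lra|by move=> *; exact: hG0|].
    by move=> x /andP[? ?]; rewrite /g0 lt_max; apply/orP; right; nra.
  apply: (le_der (df := g0)); [lra|by move=> *; exact: hG0|].
  by move=> x _; rewrite /g0 le_max lexx.
set I := G0 1 - G0 (-1) in I0.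
have ccg0 : cc (fun x : 'rV[R]_N => of_log (weighted g0) (r2 x)).
  exact: cc_weighted g0a g0b.
pose L := intN (fun x : 'rV[R]_N => of_log (weighted g0) (r2 x)).
have L0 : 0 < L.
  pose x0 : 'rV[R]_N := delta_mx ord0 (Ordinal N0).
  apply: (@intN_gt0 _ _ _ x0) => //.
    move=> x; rewrite /of_log; case: ifP => // _.
    by rewrite /weighted mulr_ge0 ?expR_ge0// /g0 le_max lexx.
  have -> : r2 x0 = 1.
    rewrite /r2 (bigD1 (Ordinal N0))//= big1 ?addr0; first by rewrite mxE !eqxx expr1n.
    by move=> i hi; rewrite mxE (negbTE hi) expr0n.
  rewrite of_log_gt0// ln1 mul0r /weighted mulr_gt0 ?expR_gt0//.
  by rewrite /g0 lt_max; apply/orP; right; lra.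
exists (L / I); first exact: divr_gt0.
move=> g G a b ab cg hG ga gb.
pose c := (G b - G a) / I.
pose h t := g t - c * g0 t.
pose H t := (G t - G a) - c * (G0 t - G0 (-1)).
have ch : continuous h.
  by move=> t; exact: (cvgB (cg t) (cvgM (cvg_cst c) (cg0 t))).
have hH : prim_of H h by move=> t; rewrite /H /h; der; ring.
have ccg : cc (fun x : 'rV[R]_N => of_log (weighted g) (r2 x)).
  by apply: (cc_weighted (a := a) (b := b)) => // x /ltW; [exact: ga|exact: gb].
have Gl t : t <= a -> G t = G a.
  move=> ta; apply: cst_der => // x /andP[_ xa]; rewrite -(ga x xa); exact: hG.
have Gr t : b <= t -> G t = G b.
  move=> bt; apply/esym/cst_der; [exact: bt|move=> x /andP[bx _]]; rewrite -(gb x bx); exact: hG.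
have G0l t : t <= -1 -> G0 t = G0 (-1).
  move=> ta; apply: cst_der => // x /andP[_ xa]; have <- : g0 x = 0; last exact: hG0.
  by rewrite /g0 max_l// subr_le0; nra.
have G0r t : 1 <= t -> G0 t = G0 1.
  move=> ta; apply/esym/cst_der; [exact: ta|move=> x /andP[xa _]]; have <- : g0 x = 0; last exact: hG0.
  by rewrite /g0 max_l// subr_le0; nra.
have In0 : I != 0 by rewrite gt_eqF.
have : intN (fun x : 'rV[R]_N => of_log (weighted h) (r2 x)) = 0.
  apply: (@intN_polar0 h H (Num.min a (-1)) (Num.max b 1)) => // t.
  - rewrite lt_min => /andP[/ltW ta /ltW t1]; rewrite /H Gl// G0l//; ring.
  - rewrite gt_max => /andP[/ltW ta /ltW t1]; rewrite /H Gr// G0r// -/I /c divfK//.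
    by rewrite subrr.
  - by rewrite lt_min => /andP[/ltW ta t1]; rewrite /h ga// g0a// mulr0 subrr.
  - by rewrite gt_max => /andP[/ltW ta t1]; rewrite /h gb// g0b// mulr0 subrr.
have -> : intN (fun x : 'rV[R]_N => of_log (weighted h) (r2 x)) =
    intN (fun x : 'rV[R]_N => of_log (weighted g) (r2 x)) - c * L.
  rewrite -intNZ// -intNB//; last exact: ccZ.
  apply: eq_intN => x; rewrite /of_log; case: ifP => _; last by rewrite mulr0 subrr.
  by rewrite /weighted /h; ring.
by move/eqP; rewrite subr_eq0 => /eqP ->; rewrite /c; field.
Qed.

Lemma energy_radial (V f df : R -> R) (a b : R) : 0 < a -> sm f -> prim_of f df ->
  (forall r : R, 0 < r -> {for r, continuous V}) ->
  (forall s, s <= a -> f s = 0) -> (forall s, b <= s -> f s = 0) ->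
  let E (x : 'rV[R]_N) := 4 * r2 x * df (r2 x) ^+ 2 + radial N V x * f (r2 x) ^+ 2 in
  cc E /\ energy (radial N V) (fun x => f (r2 x)) = (intN E)%:E.
Proof.
move=> a0 sf hf cV fa fb E.
have hphi := radial_C0infty_off0 a0 sf fa fb.
have cq (x : 'rV[R]_N) : x != 0 -> {for x, continuous (radial N V)}.
  move=> x0; apply: (continuous_comp_for (g := V)); last exact/cV/enorm_gt0.
  apply: (continuous_comp_for (f := r2) (g := Num.sqrt)); first exact: r2_cont.
  exact: sqrt_continuous.
have e x : \sum_i partial i (fun x : 'rV[R]_N => f (r2 x)) x ^+ 2 +
    radial N V x * f (r2 x) ^+ 2 = E x.
  rewrite /E; congr (_ + _); rewrite {2}/r2 mulr_sumr mulr_suml.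
  apply: eq_bigr => i _.
  by rewrite /partial; have [_ ->] := is_derive_r2 i (hf (r2 x)); ring.
split; last by rewrite energyE//; congr EFin; apply: eq_intN => x; exact: e.
have := energy_cc cq hphi; congr cc; apply/funext => x; exact: e.
Qed.

Lemma prim0 (f df : R -> R) (a b x : R) : prim_of f df -> a < x < b ->
  (forall y, a < y < b -> f y = 0) -> df x = 0.
Proof.
move=> hf /andP[ax xb] f0; have [_ <-] := hf x.
have : is_derive x 1 f 0.
  apply: (@near_eq_is_derive _ _ _ (fun=> 0)).
  have : \forall y \near x, a < y /\ y < b.
    by apply: filterI; [exact: lt_nbhsr|exact: lt_nbhsl].
  by apply: filterS => y [ay yb]; rewrite f0// ay.
by case.
Qed.

Lemma sqr_close (u v e M : R) : `|u - v| <= e -> `|v| <= M -> 0 <= e -> e <= 1 ->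
  `|u ^+ 2 - v ^+ 2| <= e * (2 * M + 1).
Proof.
move=> uv vM e0 e1; rewrite subr_sqr normrM ler_pM//.
have -> : u + v = (u - v) + 2 * v by ring.
rewrite (le_trans (ler_normD _ _))// addrC lerD ?(le_trans uv)//.
by rewrite normrM ger0_norm// ler_wpM2l.
Qed.

(** The test function |x|^-m eta(ln |x|), m = (N-2)/2, has energy density |x|^-N g(ln |x|) and hence
    energy [om * (F b - F a)]. It is only C^1, so nonnegativity is obtained as a limit over smooth
    radial functions. *)
Lemma radial_form_ge0 (V eta deta Q F : R -> R) (a b : R) : (0 < N)%N ->
  (forall r : R, 0 < r -> {for r, continuous V}) ->
  nonnegative (radial N V) -> a < b ->
  prim_of eta deta -> continuous deta ->
  (forall t, t <= a -> eta t = 0 /\ deta t = 0) ->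
  (forall t, b <= t -> eta t = 0 /\ deta t = 0) ->
  (forall t, Q t = ((N%:R - 2) / 2) ^+ 2 + expR (2 * t) * V (expR t)) ->
  prim_of F (fun t => deta t ^+ 2 + Q t * eta t ^+ 2) ->
  F a <= F b.
Proof.
move=> N0 cV hV ab heta cdeta ea eb QE hF.
pose m : R := (N%:R - 2) / 2.
pose al := expR (2 * a); pose be := expR (2 * b).
have al0 : 0 < al by exact: expR_gt0.
have albe : al < be by rewrite ltr_expR ltr_pM2l.
pose ka t := expR (- m * t) * eta t.
pose dka t := expR (- m * t) * (deta t - m * eta t).
have hka : prim_of ka dka by move=> t; rewrite /ka /dka; der; ring.
have cexp c : continuous (fun t : R => expR (c * t)).
  by move=> t; apply: (der_cont (a := expR (c * t) * c)); der; ring.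
have ceta := prim_cont heta.
have cdka : continuous dka.
  suff h t : {for t, continuous dka} by exact: h.
  apply: for_M; first exact: cexp.
  exact: (cvgB (cdeta t) (cvgM (cvg_cst m) (ceta t))).
have kal t : t <= a -> ka t = 0 /\ dka t = 0.
  by move=> /ea[h1 h2]; rewrite /ka /dka h1 h2; split; ring.
have kbl t : b <= t -> ka t = 0 /\ dka t = 0.
  by move=> /eb[h1 h2]; rewrite /ka /dka h1 h2; split; ring.
pose dk2 t := dka t / (2 * expR (2 * t)).
pose rho := of_log ka; pose drho := of_log dk2.
have cdk2 : continuous dk2.
  suff h t : {for t, continuous dk2} by exact: h.
  apply: for_M; first exact: cdka.
  have e0 : 2 * expR (2 * t) != 0 by rewrite mulf_neq0// gt_eqF ?expR_gt0.
  by apply: (der_cont (a := - (2 * (expR (2 * t) * 2)) / (2 * expR (2 * t)) ^+ 2)); der => //; ring.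
have hrho : prim_of rho drho.
  by apply: (@of_log_der _ _ _ a) => // t /ltW /kal[].
have cdrho : continuous drho.
  by apply: (@of_log_cont _ _ a) => // t /ltW /kal[_ h]; rewrite /dk2 h mul0r.
have of_le g (s : R) : (forall t, t <= a -> g t = 0) -> s <= al -> of_log g s = 0.
  move=> g0 sa; rewrite /of_log; case: ifPn => // s0; apply: g0.
  by rewrite ler_pdivrMr// mulrC -ler_expR lnK.
have of_ge g (s : R) : (forall t, b <= t -> g t = 0) -> be <= s -> of_log g s = 0.
  move=> g0 sb; have s0 : 0 < s by rewrite (lt_le_trans (expR_gt0 _) sb).
  by rewrite of_log_gt0// g0// ler_pdivlMr// mulrC -ler_expR lnK.
have ra s : s <= al -> rho s = 0 by apply: of_le => t /kal[].
have rb s : be <= s -> rho s = 0 by apply: of_ge => t /kbl[].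
have da s : s <= al -> drho s = 0.
  by apply: of_le => t /kal[_ h]; rewrite /dk2 h mul0r.
have db s : be <= s -> drho s = 0.
  by apply: of_ge => t /kbl[_ h]; rewrite /dk2 h mul0r.
(* The exponents match since 2m + 2 = N: squared gradient and potential term both carry the factor
   |x|^-N. *)
pose g t := (deta t - m * eta t) ^+ 2 + expR (2 * t) * V (expR t) * eta t ^+ 2.
have cVe : continuous (fun t => V (expR t)).
  suff h t : {for t, continuous (fun t => V (expR t))} by exact: h.
  apply: (continuous_comp_for (g := V)); first exact: continuous_expR.
  by apply: cV; exact: expR_gt0.
have cg : continuous g.
  suff h t : {for t, continuous g} by exact: h.
  apply: for_D.
    apply: (for_X (f := fun t => deta t - m * eta t)).
    exact: (cvgB (cdeta t) (cvgM (cvg_cst m) (ceta t))).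
  apply: for_M; last by apply: for_X; exact: ceta.
  by apply: for_M; [exact: cexp|exact: cVe].
have ga t : t <= a -> g t = 0 by move=> /ea[h1 h2]; rewrite /g h1 h2; ring.
have gb t : b <= t -> g t = 0 by move=> /eb[h1 h2]; rewrite /g h1 h2; ring.
have ga' t : t < a -> g t = 0 by move=> /ltW; exact: ga.
have gb' t : b < t -> g t = 0 by move=> /ltW; exact: gb.
have ccg := cc_weighted cg ga' gb'.
have gE (x : 'rV[R]_N) : of_log (weighted g) (r2 x) =
    4 * r2 x * drho (r2 x) ^+ 2 + radial N V x * rho (r2 x) ^+ 2.
  have [->|x0] := eqVneq x 0.
    by rewrite r2_0 /rho /drho /of_log ltxx; ring.
  have s0 := r2_gt0 x0; have sn0 : r2 x != 0 by rewrite gt_eqF.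
  rewrite /rho /drho !of_log_gt0//.
  have e1 : expR (2 * (ln (r2 x) / 2)) = r2 x by rewrite mulrC divfK// lnK.
  have e2 : expR (ln (r2 x) / 2) = enorm x.
    by rewrite -(ln_sqrt s0) lnK// posrE sqrtr_gt0.
  rewrite /radial -e2 /weighted /g /dk2 /ka /dka; move: e1; set t := ln _ / 2 => e1.
  have -> : expR (- N%:R * t) = expR (- m * t) ^+ 2 / r2 x.
    by rewrite -e1 -expRM_natl -expRN -expRD; congr expR; rewrite /m; field.
  by rewrite e1; field.
suff pos : 0 <= intN (fun x : 'rV[R]_N => of_log (weighted g) (r2 x)).
  have [om om0 hpol] := intN_polar N0.
  have [G [_ hG]] := prim_exists cg.
  move: pos; rewrite (hpol g G a b (ltW ab) cg hG ga gb) pmulr_rge0// => hG0.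
  (* The cross term of the square is the derivative of [- m * eta ^+ 2], which vanishes at both
     ends; the remaining m^2 is the constant in [Q]. *)
  have : F a - (G a + m * eta a ^+ 2) = F b - (G b + m * eta b ^+ 2).
    apply: (@cst_prim R (fun t => F t - (G t + m * eta t ^+ 2))) => t; der.
    by rewrite /g QE -/m; ring.
  by rewrite (ea a (lexx _)).1 (eb b (lexx _)).1; lra.
have abs01 : al <= be + 1 by lra.
have [M1 M10 hM1] := bounded_seg abs01 cdrho.
have [M0 M00 hM0] := bounded_seg abs01 (prim_cont hrho).
have [MV MV0 hMV] : exists2 MV, 0 < MV & forall s, al <= s <= be + 1 -> `|V (Num.sqrt s)| <= MV.
  have hb : a <= ln (be + 1) / 2.
    rewrite ler_pdivlMr// mulrC -ler_expR lnK ?posrE; last by rewrite addr_gt0// expR_gt0.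
    exact: abs01.
  have [MV MV0 h] := bounded_seg hb cVe; exists MV => // s /andP[s1 s2].
  have s0 : 0 < s by rewrite (lt_le_trans al0).
  have -> : Num.sqrt s = expR (ln s / 2) by rewrite -(ln_sqrt s0) lnK// posrE sqrtr_gt0.
  apply: h; rewrite ler_pdivlMr// ler_pM2r ?invr_gt0//.
  rewrite mulrC -ler_expR lnK ?posrE// s1/= ler_ln ?posrE//.
  by rewrite addr_gt0// expR_gt0.
(* If profile and derivative are approximated within [e1 <= 1], the density changes by at most
   [e1 * K] on the enlarged support. *)
pose K := 4 * (be + 1) * (2 * M1 + 1) + MV * (2 * M0 + 1).
have be0 : 0 < be by exact: expR_gt0.
(* A continuous compactly supported majorant of the indicator of [s <= be + 1], used to integrate
   the uniform error. *)
pose ch (s : R) := Num.max 0 (be + 2 - s).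
have cch : continuous ch.
  move=> s; apply: (@continuous_max _ _ (fun=> 0) (fun s : R => be + 2 - s)).
    exact: for_cst.
  by apply: (der_cont (a := - 1)); der; ring.
have ccch : cc (fun x : 'rV[R]_N => ch (r2 x)).
  apply: (@cc_r2 _ (be + 2)) => // s hs; rewrite /ch max_l//; lra.
apply/ler_addgt0Pr => e e0.
pose D := K * intN (fun x : 'rV[R]_N => ch (r2 x)).
have K0 : 0 <= K.
  have ? : 0 <= 4 * (be + 1) by clear -be0; lra.
  have ? : 0 <= 2 * M1 + 1 by clear -M10; lra.
  have ? : 0 <= 2 * M0 + 1 by clear -M00; lra.
  by apply: addr_ge0; apply: mulr_ge0 => //; exact: ltW.
have D0 : 0 <= D.
  by rewrite mulr_ge0//; apply: intN_ge0 => x; rewrite /ch le_max lexx.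
pose e1 := Num.min 1 (e / (1 + D)).
have e10 : 0 < e1 by rewrite lt_min ltr01/= divr_gt0// ltr_pwDl.
have e11 : e1 <= 1 by rewrite ge_min lexx.
have [f [df [sf hf fa fb [hf1 hf2]]]] := sm_approx albe e10 hrho cdrho ra rb da db.
have [ccE eE] := energy_radial al0 sf hf cV fa fb.
have hphi := radial_C0infty_off0 al0 sf fa fb.
have := hV _ hphi; rewrite eE lee_fin => pos.
have ccR : cc (fun x : 'rV[R]_N => of_log (weighted g) (r2 x) + e1 * K * ch (r2 x)).
  by apply: ccD => //; exact: ccZ.
have cmp := le_intN ccE ccR.
have {}cmp : intN (fun x : 'rV[R]_N => 4 * r2 x * df (r2 x) ^+ 2 + radial N V x * f (r2 x) ^+ 2) <=
    intN (fun x : 'rV[R]_N => of_log (weighted g) (r2 x) + e1 * K * ch (r2 x)).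
  apply: cmp => x; rewrite gE; set s := r2 x.
  have ch0 : 0 <= ch s by rewrite /ch le_max lexx.
  have eK0 : 0 <= e1 * K by rewrite mulr_ge0// ltW.
  case: (ltP s al) => [sal|als].
    rewrite (ra s (ltW sal)) (da s (ltW sal)) (fa s (ltW sal)).
    rewrite (@prim0 f df (s - 1) al s) //; last 2 first.
      by rewrite sal andbT ltrBlDr ltrDl.
      by move=> y /andP[_ /ltW]; exact: fa.
    rewrite expr0n !mulr0 !add0r mulr_ge0//.
  case: (ltP (be + 1) s) => [bes|sbe].
    have bs : be <= s by clear -bes; lra.
    rewrite (rb s bs) (db s bs) (fb s (ltW bes)).
    rewrite (@prim0 f df (be + 1) (s + 1) s) //; last 2 first.
      by rewrite bes/= ltrDl.
      by move=> y /andP[/ltW + _]; exact: fb.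
    rewrite expr0n !mulr0 !add0r mulr_ge0//.
  have sI : al <= s <= be + 1 by rewrite als.
  have h1 := sqr_close (hf1 s) (hM0 s sI) (ltW e10) e11.
  have h2 := sqr_close (hf2 s) (hM1 s sI) (ltW e10) e11.
  have ch1 : 1 <= ch s by rewrite /ch le_max; apply/orP; right; clear -sbe; lra.
  have s0 : 0 <= s by rewrite (le_trans (ltW al0)).
  have A1 : 4 * s * df s ^+ 2 - 4 * s * drho s ^+ 2 <= 4 * (be + 1) * (e1 * (2 * M1 + 1)).
    rewrite -mulrBr; apply: (@le_trans _ _ (4 * s * (e1 * (2 * M1 + 1)))).
      by rewrite ler_wpM2l ?mulr_ge0// (le_trans (ler_norm _) h2).
    apply: ler_wpM2r; first by rewrite mulr_ge0 ?(ltW e10)//; clear -M10; lra.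
    by rewrite ler_pM2l.
  have A2 : radial N V x * f s ^+ 2 - radial N V x * rho s ^+ 2 <= MV * (e1 * (2 * M0 + 1)).
    rewrite -mulrBr (le_trans (ler_norm _))// normrM ler_pM// /radial /enorm.
    exact: hMV.
  have A3 : e1 * K <= e1 * K * ch s by rewrite ler_peMr.
  have A4 : 4 * (be + 1) * (e1 * (2 * M1 + 1)) + MV * (e1 * (2 * M0 + 1)) = e1 * K.
    by rewrite /K; ring.
  by clear -A1 A2 A3 A4; lra.
rewrite intND// ?intNZ// in cmp; last exact: ccZ.
have : e1 * K * intN (fun x : 'rV[R]_N => ch (r2 x)) <= e.
  rewrite -mulrA -/D (@le_trans _ _ (e / (1 + D) * D))//.
    by rewrite ler_wpM2r// /e1 ge_min lexx orbT.
  rewrite mulrAC ler_pdivrMr ?ltr_pwDl// mulrDr mulr1 lerDr ltW//.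
by move=> h; clear -pos cmp h; lra.
Qed.

End RadialForm.

(** * Disconjugacy *)

Section Disconjugacy.
Context {R : realType}.
Implicit Types (y dy z dz u du Q eta deta F w : R -> R).

(* F b - F a is the value at eta of the quadratic form int eta'^2 + Q eta^2. *)
Definition form_ge0 Q := forall eta deta F (a b : R), a < b ->
  prim_of eta deta -> continuous deta ->
  (forall t, t <= a -> eta t = 0 /\ deta t = 0) ->
  (forall t, b <= t -> eta t = 0 /\ deta t = 0) ->
  prim_of F (fun t => deta t ^+ 2 + Q t * eta t ^+ 2) -> F a <= F b.

Let aff_cont (p q : R) : continuous (fun t : R => p * (t - q)).
Proof. by move=> t; apply: (der_cont (a := p)); der; ring. Qed.

Let comp_aff (f : R -> R) (p q : R) : continuous f -> continuous (fun t : R => f (p * (t - q))).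
Proof.
move=> cf; suff h t : {for t, continuous (fun t => f (p * (t - q)))} by exact: h.
by apply: (continuous_comp_for (g := f)); [exact: aff_cont|exact: cf].
Qed.

Lemma bump_exists (c b : R) : c < b -> exists eta deta,
  [/\ prim_of eta deta, continuous deta, eta b = 1 /\ deta b = 0,
      forall t, t <= c -> eta t = 0 /\ deta t = 0 &
      forall t, b + 1 <= t -> eta t = 0 /\ deta t = 0].
Proof.
move=> cb; have [Th [dTh [_ hTh cdTh _ [Th0 Th1 _ dTh0 dTh1]]]] := @step_exists R.
have cTh := prim_cont hTh; pose k := (b - c)^-1.
have k0 : 0 < k by rewrite invr_gt0 subr_gt0.
exists (fun t => Th (k * (t - c)) * Th (- 1 * (t - (b + 1)))).
exists (fun t => k * dTh (k * (t - c)) * Th (- 1 * (t - (b + 1)))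
  - Th (k * (t - c)) * dTh (- 1 * (t - (b + 1)))).
split.
- by move=> t; der; ring.
- move=> t; exact: (cvgB (cvgM (cvgM (cvg_cst k) (@comp_aff dTh k c cdTh t))
    (@comp_aff Th (-1) (b + 1) cTh t)) (cvgM (@comp_aff Th k c cTh t)
    (@comp_aff dTh (-1) (b + 1) cdTh t))).
- have h : 1 <= k * (b - c) by rewrite /k mulVf// gt_eqF// subr_gt0.
  have h2 : 1 <= - 1 * (b - (b + 1)) :> R by lra.
  by rewrite (Th1 _ h) (Th1 _ h2) (dTh1 _ h) (dTh1 _ h2); split; ring.
- move=> t tc; have h : k * (t - c) <= 0 by rewrite pmulr_rle0// subr_le0.
  by rewrite (Th0 _ h) (dTh0 _ h); split; ring.
- move=> t tb; have h : - 1 * (t - (b + 1)) <= 0 by lra.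
  by rewrite (Th0 _ h) (dTh0 _ h); split; ring.
Qed.

(** A plateau function for [a, b] with ramps of length [d]. The height 1 is recorded only at
    [b - d]; the vanishing of [dchi] extends it over the plateau. *)
Definition cutoff (a b d M : R) chi dchi :=
  [/\ prim_of chi dchi, continuous dchi, chi (b - d) = 1,
      (forall t, t <= a \/ b <= t -> chi t = 0 /\ dchi t = 0) &
      [/\ forall t, a + d <= t <= b - d -> dchi t = 0,
          forall t, b - d <= t -> dchi t <= 0 &
          forall t, `|dchi t| <= M]].

Lemma cutoff_exists : exists2 K : R, 0 < K & forall a b d, 0 < d ->
  d + d < b - a -> exists chi dchi, cutoff a b d (K / d) chi dchi.
Proof.
have [Th [dTh [_ hTh cdTh dTh0 [Th0 Th1 Th01 dTh00 dTh1]]]] := @step_exists R.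
have cTh := prim_cont hTh; have [K K0 dThK0] := bounded_seg ler01 cdTh.
have dThK x : `|dTh x| <= K.
  case: (leP x 0) => [/dTh00 ->|/ltW x0]; first by rewrite normr0 ltW.
  case: (leP 1 x) => [/dTh1 ->|/ltW x1]; first by rewrite normr0 ltW.
  by apply: dThK0; rewrite x0.
have Thn x : `|Th x| <= 1 by have /andP[? ?] := Th01 x; rewrite ger0_norm.
exists (2 * K) => [|a b d d0 dab]; first by rewrite mulr_gt0.
have k0 : 0 < d^-1 by rewrite invr_gt0.
have big r : d <= r -> 1 <= d^-1 * r by move=> dr; rewrite mulrC ler_pdivlMr// mul1r.
have bigN r : d <= r -> 1 <= - d^-1 * - r by move=> /big; rewrite mulrNN.
exists (fun t => Th (d^-1 * (t - a)) * Th (- d^-1 * (t - b))).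
exists (fun t => d^-1 * dTh (d^-1 * (t - a)) * Th (- d^-1 * (t - b))
  - d^-1 * Th (d^-1 * (t - a)) * dTh (- d^-1 * (t - b))).
split.
- by move=> t; der; ring.
- move=> t; exact: (cvgB (cvgM (cvgM (cvg_cst d^-1) (@comp_aff dTh d^-1 a cdTh t))
    (@comp_aff Th (- d^-1) b cTh t)) (cvgM (cvgM (cvg_cst d^-1)
    (@comp_aff Th d^-1 a cTh t)) (@comp_aff dTh (- d^-1) b cdTh t))).
- have h1 : d <= b - d - a by lra.
  have e : b - d - b = - d by ring.
  by rewrite e (Th1 _ (big _ h1)) (Th1 _ (bigN _ (lexx d))) mulr1.
- move=> t [ta|tb].
    have h : d^-1 * (t - a) <= 0 by rewrite pmulr_rle0// subr_le0.
    by rewrite (Th0 _ h) (dTh00 _ h); split; ring.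
  have h : - d^-1 * (t - b) <= 0 by rewrite mulNr oppr_le0 mulr_ge0 ?(ltW k0)// subr_ge0.
  by rewrite (Th0 _ h) (dTh00 _ h); split; ring.
split.
- move=> t /andP[h1 h2]; have h3 : d <= t - a by lra.
  have h4 : d <= b - t by lra.
  by rewrite (dTh1 _ (big _ h3)) -(opprB b t) (dTh1 _ (bigN _ h4)); ring.
- move=> t tb; have h3 : d <= t - a by lra.
  rewrite (dTh1 _ (big _ h3)) mulr0 mul0r sub0r oppr_le0 !mulr_ge0 ?(ltW k0)//.
  by case/andP: (Th01 (d^-1 * (t - a))).
- move=> t; rewrite (le_trans (ler_normB _ _))// !normrM (gtr0_norm k0).
  have -> : 2 * K / d = d^-1 * K * 1 + d^-1 * 1 * K by ring.
  have dK x : d^-1 * `|dTh x| <= d^-1 * K by rewrite ler_wpM2l// ltW.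
  have dT x : d^-1 * `|Th x| <= d^-1 * 1 by rewrite ler_wpM2l// ltW.
  by rewrite lerD// ler_pM// mulr_ge0// ltW.
Qed.

(** On the two ramps, of length [d], the function [u] is at most [L * d] since it vanishes at [a]
    and [b]. For [M] of order 1/d the bound is therefore O(d). *)
Lemma cutoff_energy (a b d L M : R) u du chi dchi H : cutoff a b d M chi dchi ->
  0 < d -> d + d < b - a -> 0 <= L -> prim_of u du ->
  (forall t, a <= t <= b -> `|du t| <= L) -> u a = 0 -> u b = 0 ->
  prim_of H (fun t => (u t * dchi t) ^+ 2) ->
  H (b + 1) - H a <= 2 * d * (L * d * M) ^+ 2.
Proof.
move=> [_ _ _ chi0 [dchim _ dchiM]] d0 dab L0 hu hL ua ub hH.
have hLa t : a <= t <= b -> `|u t| <= L * (t - a).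
  move=> /andP[ta tb]; have := @norm_der R u (fun t => L * t) du (fun=> L) a t ta.
  rewrite ua subr0 mulrBr; apply => [x _|x _|x /andP[xa xt]]; [exact: hu|by der; ring|].
  by apply: hL; rewrite xa (le_trans xt).
have hLb t : a <= t <= b -> `|u t| <= L * (b - t).
  move=> /andP[ta tb]; have := @norm_der R u (fun t => L * t) du (fun=> L) t b tb.
  rewrite ub sub0r normrN mulrBr; apply => [x _|x _|x /andP[xa xt]]; [exact: hu|by der; ring|].
  by apply: hL; rewrite xt (le_trans ta).
have e1 : H (a + d) = H (b - d).
  apply: cst_der => [|t t12]; first lra.
  by have := hH t; rewrite dchim// mulr0 expr0n.
have e2 : H b = H (b + 1).
  apply: cst_der => [|t /andP[tb _]]; first lra.
  by have := hH t; rewrite (chi0 t (or_intror tb)).2 mulr0 expr0n.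
set C := (L * d * M) ^+ 2.
have bnd t r : `|u t| <= L * r -> r <= d -> (u t * dchi t) ^+ 2 <= C.
  move=> h rd; rewrite -(real_normK (num_real _)) /C normrM.
  rewrite lerXn2r ?nnegrE ?mulr_ge0 ?(ltW d0) ?(le_trans _ (dchiM t))//.
  by rewrite ler_pM// (le_trans h)// ler_wpM2l.
have h1 : H (a + d) - H a <= C * (a + d) - C * a.
  apply: (le_der2 (f := H) (g := fun t => C * t) (df := fun t => (u t * dchi t) ^+ 2)
      (dg := fun=> C)); first lra.
  - by move=> t _; exact: hH.
  - by move=> t _; der; ring.
  - move=> t /andP[t1 t2]; apply: (bnd t (t - a)); last lra.
    by apply: hLa; apply/andP; split; lra.
have h2 : H b - H (b - d) <= C * b - C * (b - d).
  apply: (le_der2 (f := H) (g := fun t => C * t) (df := fun t => (u t * dchi t) ^+ 2)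
      (dg := fun=> C)); first lra.
  - by move=> t _; exact: hH.
  - by move=> t _; der; ring.
  - move=> t /andP[t1 t2]; apply: (bnd t (b - t)); last lra.
    by apply: hLb; apply/andP; split; lra.
rewrite -e2; rewrite -e1 in h2; have -> : 2 * d * C = d * C + d * C by ring.
by lra.
Qed.

(** The left ramp contributes nothing because [g] vanishes there; on the right ramp [dchi] is
    nonpositive with total mass -1 and [g >= e]. *)
Lemma cutoff_flux (a b d M e c : R) g chi dchi J : cutoff a b d M chi dchi ->
  0 < d -> d + d < b - a -> a + d <= c -> (forall t, t <= c -> g t = 0) ->
  (forall t, b - d <= t <= b -> e <= g t) ->
  prim_of J (fun t => dchi t * g t) -> J (b + 1) - J a <= - e.
Proof.
move=> [hchi _ chi1 chi0 [dchim dchi_le0 _]] d0 dab adc gc ge hJ.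
have e1 : J a = J (b - d).
  apply: cst_der => [|t /andP[t1 t2]]; first lra.
  have <- : dchi t * g t = 0; last exact: hJ.
  have [tc|/ltW ct] := leP t c; first by rewrite gc ?mulr0.
  by rewrite dchim ?mul0r// t2 (le_trans adc).
have e2 : J b = J (b + 1).
  apply: cst_der => [|t /andP[tb _]]; first lra.
  by have := hJ t; rewrite (chi0 t (or_intror tb)).2 mul0r.
rewrite e1 -e2.
have bd : b - d <= b by lra.
have := @le_der2 R J (fun t => e * chi t) (fun t => dchi t * g t)
  (fun t => e * dchi t) (b - d) b bd.
rewrite chi1 (chi0 b (or_intror (lexx b))).1 mulr0 mulr1 sub0r.
apply => t /andP[t1 t2]; first exact: hJ.
- by der; ring.
- by rewrite mulrC ler_wnM2r ?dchi_le0 ?ge ?t1.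
Qed.

(* The test function is u cut off at scale d near its zeros a and b, plus s eta
   with eta = 1 near b; its energy is O(d) + s u'(b) + O(s^2). *)
Lemma no_conjugate_lt0 Q u du (a b : R) : continuous Q -> form_ge0 Q ->
  sol Q u du -> a < b -> u a = 0 -> u b = 0 -> ~ du b < 0.
Proof.
move=> cQ fQ [hu hdu] ab ua ub dub.
pose c := (a + b) / 2; have [ac cb] : a < c /\ c < b by rewrite /c; split; lra.
have [eta [deta [heta cdeta [etab detab] etal etar]]] := bump_exists cb.
have cu := prim_cont hu; have cdu := prim_cont hdu; have ceta := prim_cont heta.
pose g t := u t * deta t - du t * eta t.
have cg : continuous g.
  by move=> t; exact: (cvgB (cvgM (cu t) (cdeta t)) (cvgM (cdu t) (ceta t))).
pose e := - du b / 2; have e0 : 0 < e by rewrite /e; lra.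
(* At [b] one has [g b = - du b = 2 * e], so half of that value persists nearby. *)
have [d0 d00 hd0] : exists2 d0, 0 < d0 & forall t, `|b - t| < d0 -> e <= g t.
  have /cvgrPdist_le/(_ _ e0)/nbhs_ballP[r /= r0 hr] := cg b.
  exists r => // t /hr /=; rewrite {1}/g ub etab /e ler_norml => /andP[_]; lra.
have [La La0 hLa] := bounded_seg (ltW ab) cdu.
have cL : continuous (fun t => deta t ^+ 2 + Q t * eta t ^+ 2).
  suff h t : {for t, continuous (fun t => deta t ^+ 2 + Q t * eta t ^+ 2)} by exact: h.
  apply: for_D; first by apply: for_X; exact: cdeta.
  by apply: for_M; [exact: cQ|apply: for_X; exact: ceta].
have [L [_ hL]] := prim_exists cL.
pose ell := `|L (b + 1) - L a| + 1; have ell0 : 0 < ell by rewrite ltr_wpDl.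
(* The quadratic term [s ^+ 2 * (L (b + 1) - L a)] then costs at most [s * e], half of the gain
   [2 * s * e] of the mixed term. *)
pose s := e / ell; have s0 : 0 < s by rewrite divr_gt0.
have sl : s ^+ 2 * (L (b + 1) - L a) <= s * e.
  rewrite expr2 -mulrA ler_wpM2l ?(ltW s0)// /s mulrAC ler_pdivrMr// ler_wpM2l ?(ltW e0)//.
  by rewrite (le_trans (ler_norm _))// lerDl.
have [K K0 /(_ a b) hK] := cutoff_exists.
pose C := 2 * (La * K) ^+ 2 + 1; have C0 : 0 < C by rewrite ltr_wpDl// mulr_ge0// sqr_ge0.
(* The three bounds put the right ramp where [g >= e], the left ramp where [eta] vanishes, and the
   cutoff energy [d * C] below the remaining [s * e]. *)
pose d := Num.min (Num.min (d0 / 2) ((c - a) / 2)) (s * e / (2 * C)).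
have d1 : 0 < d.
  have se : 0 < s * e / (2 * C) by exact: (divr_gt0 (mulr_gt0 s0 e0) (mulr_gt0 (ltr0Sn R 1) C0)).
  by rewrite /d !lt_min se andbT !divr_gt0// subr_gt0.
have dd0 : d < d0.
  by rewrite (@le_lt_trans _ _ (d0 / 2)) ?/d ?ge_min ?lexx//; clear -d00; lra.
have dca : d + d <= c - a.
  suff : d <= (c - a) / 2 by clear; lra.
  by rewrite /d !ge_min lexx orbT.
have dC : d * C < s * e.
  have : d <= s * e / (2 * C) by rewrite /d !ge_min lexx orbT.
  have C2 : 0 < 2 * C by rewrite mulr_gt0.
  have := mulr_gt0 s0 e0; rewrite (ler_pdivlMr _ _ C2); clear; lra.
have dab : d + d < b - a by clear -dca cb; lra.
have [chi [dchi hchi]] := hK d d1 dab.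
have [hchi1 cdchi chi1 chi0 _] := hchi; have cchi := prim_cont hchi1.
have cH : continuous (fun t => (u t * dchi t) ^+ 2).
  suff h t : {for t, continuous (fun t => (u t * dchi t) ^+ 2)} by exact: h.
  by apply: (for_X (f := fun t => u t * dchi t)); exact: (cvgM (cu t) (cdchi t)).
have cJ : continuous (fun t => dchi t * g t).
  by move=> t; exact: (cvgM (cdchi t) (cg t)).
have [H [_ hH]] := prim_exists cH; have [J [_ hJ]] := prim_exists cJ.
pose f t := u t * chi t + s * eta t.
pose df t := du t * chi t + u t * dchi t + s * deta t.
have hf : prim_of f df by move=> t; rewrite /f /df; der; ring.
have cdf : continuous df.
  move=> t; exact: (cvgD (cvgD (cvgM (cdu t) (cchi t)) (cvgM (cu t) (cdchi t)))
    (cvgM (cvg_cst s) (cdeta t))).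
(* By the equation for [u], all terms containing [Q * u] are exact derivatives of products with the
   factor [chi], and drop out at [a] and [b + 1]. What remains is [H], the flux [J] and the form of
   [eta]. *)
pose F t := u t * du t * chi t ^+ 2 + 2 * s * (du t * chi t * eta t)
   + H t + 2 * s * J t + s ^+ 2 * L t.
have hF : prim_of F (fun t => df t ^+ 2 + Q t * f t ^+ 2).
  by move=> t; rewrite /F; der; rewrite /f /df /g; ring.
have bb1 : b <= b + 1 by rewrite lerDl.
have fl t : t <= a -> f t = 0 /\ df t = 0.
  move=> ta; have [h1 h2] := chi0 t (or_introl ta).
  have [|h3 h4] := etal t; first by rewrite (le_trans ta)// ltW.
  by rewrite /f /df h1 h2 h3 h4; split; ring.
have fr t : b + 1 <= t -> f t = 0 /\ df t = 0.
  move=> tb; have [|h1 h2] := chi0 t; first by right; exact: le_trans tb.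
  by have [h3 h4] := etar t tb; rewrite /f /df h1 h2 h3 h4; split; ring.
have := fQ f df F a (b + 1) (lt_le_trans ab bb1) hf cdf fl fr hF.
rewrite /F (chi0 a (or_introl (lexx a))).1 (chi0 (b + 1) (or_intror bb1)).1.
have Jab : J (b + 1) - J a <= - e.
  apply: (cutoff_flux hchi d1 dab (c := c) (g := g)) => //; first by rewrite -lerBrDl (le_trans _ dca)// lerDl ltW.
  - by move=> t /etal[h1 h2]; rewrite /g h1 h2; ring.
  - by move=> t /andP[t1 t2]; apply: hd0; rewrite ger0_norm; clear -dd0 t1 t2; lra.
have Hab : H (b + 1) - H a <= d * C.
  have := cutoff_energy hchi d1 dab (ltW La0) hu hLa ua ub hH.
  rewrite (_ : La * d * (K / d) = La * K); last by field; rewrite gt_eqF.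
  by rewrite /C; lra.
have hs : s * (J (b + 1) - J a) <= s * (- e) by rewrite ler_wpM2l// ltW.
rewrite expr0n !mulr0 !mul0r !mulr0 !add0r.
by clear -sl hs Hab dC; lra.
Qed.

(** Applied to [u] and to [- u], [no_conjugate_lt0] forces [du b = 0], and uniqueness concludes. *)
Lemma disconjugate Q u du (a b : R) : continuous Q -> form_ge0 Q ->
  sol Q u du -> a < b -> u a = 0 -> u b = 0 -> forall t, u t = 0.
Proof.
move=> cQ fQ hu ab ua ub.
have hN : sol Q (fun t => - 1 * u t + 0 * u t) (fun t => - 1 * du t + 0 * du t).
  exact: sol_lin.
have h1 := no_conjugate_lt0 cQ fQ hu ab ua ub.
have := no_conjugate_lt0 cQ fQ hN ab; rewrite ua ub !mulr0 addr0 => /(_ erefl erefl) h2.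
have dub : du b = 0 by move/negP: h1; move/negP: h2; rewrite -!leNgt; lra.
have h0 : sol Q (fun=> 0) (fun=> 0) by split=> t; der; ring.
by have [-> _] := sol_eq cQ hu h0 ub dub.
Qed.

(** Suppose [y t1 < 0]. Since [z / y] is unbounded below on the left, [u = z - M * y] can be made to
    vanish at some [a < T] with [M] below the ratios at [T] and [t1]. Then [u] is positive at [T]
    and negative at [t1], which yields a second zero. *)
Lemma form_ge0_pos Q y dy z dz (T : R) : continuous Q -> form_ge0 Q ->
  sol Q y dy -> sol Q z dz -> (forall t, y t * dz t - dy t * z t = 1) ->
  (forall t, t <= T -> 0 < y t) -> (forall M, exists2 a, a < T & z a <= M * y a) ->
  forall t, 0 < y t.
Proof.
move=> cQ fQ hy hz W1 yT zy.
suff nneg t1 : ~ y t1 < 0.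
  (* A zero of a nonnegative solution is a minimum, so [dy] vanishes there too, against Wronskian
     1. *)
  move=> t0; have y0 t : 0 <= y t by rewrite leNgt; apply/negP/nneg.
  rewrite lt0r y0 andbT; apply/eqP => yt0.
  have h : is_derive t0 1 y 0.
    have t0I : t0 \in `](t0 - 1), (t0 + 1)[ by rewrite in_itv /=; apply/andP; split; lra.
    by apply: (derive1_at_min _ _ t0I) => [|t _|t _]; [lra|case: (hy.1 t)|rewrite yt0].
  have e : dy t0 = 0 by case: (hy.1 t0) => _ <-; case: h.
  by have := W1 t0; rewrite e yt0 !mul0r subr0 => /esym/eqP; rewrite oner_eq0.
move=> yt1; have Tt1 : T <= t1 by rewrite leNgt; apply/negP => /ltW/yT; lra.
have yT0 := yT T (lexx T).
pose m := Num.min (z T / y T - 1) (z t1 / y t1 - 1).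
have [a aT za] := zy m; have ya := yT a (ltW aT).
have zam : z a / y a <= m by rewrite ler_pdivrMr.
pose M := z a / y a; pose u t := 1 * z t + - M * y t; pose du t := 1 * dz t + - M * dy t.
have hu : sol Q u du by exact: sol_lin.
have ua : u a = 0 by rewrite /u /M; field; rewrite gt_eqF.
have m1 : m <= z T / y T - 1 by rewrite /m ge_min lexx.
have m2 : m <= z t1 / y t1 - 1 by rewrite /m ge_min lexx orbT.
have uT : 0 < u T.
  have -> : u T = (z T / y T - M) * y T by rewrite /u; field; rewrite gt_eqF.
  by rewrite mulr_gt0// /M; lra.
have ut1 : u t1 < 0.
  have -> : u t1 = (z t1 / y t1 - M) * y t1 by rewrite /u; field; rewrite lt_eqF.
  by rewrite nmulr_llt0// /M; lra.
have [|c /andP[Tc _] uc] := ivt0 Tt1 (prim_cont hu.1).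
  by rewrite mulr_ge0_le0 ?ltW.
have := disconjugate cQ fQ hu (lt_le_trans aT Tc) ua uc T; lra.
Qed.

Lemma sol_local_eq Q Q1 y dy z dz (t1 : R) : continuous Q ->
  (forall t, t <= t1 -> Q1 t = Q t) -> sol Q y dy -> sol Q1 z dz ->
  y t1 = z t1 -> dy t1 = dz t1 -> forall t, t <= t1 -> y t = z t.
Proof.
move=> cQ QQ [hy hdy] [hz hdz] e0 e1 t tt1.
have [M M0 hM] := bounded_seg tt1 cQ.
apply/eqP; rewrite -subr_eq0; apply/eqP.
apply: (ode_zero (y := fun s => y s - z s) (dy := fun s => dy s - dz s) (M := M)
  (g := fun s => Q s * y s - Q1 s * z s) (a := t) (b := t1) (t0 := t1)).
- by rewrite tt1 lexx.
- by move=> s _; der.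
- by move=> s _; der.
- move=> s sI; have /andP[_ s1] := sI; rewrite QQ//.
  by rewrite -mulrBr normrM ler_wpM2r// hM.
- by rewrite e0 subrr.
- by rewrite e1 subrr.
- by rewrite lexx.
Qed.

(* The solution of the perturbed equation equal to y before the perturbation is
   c y + d z with d < 0 after it. *)
Lemma not_form_ge0 Q y dy z dz w (eps t1 s1 s2 t2 : R) : continuous Q ->
  sol Q y dy -> sol Q z dz -> (forall t, y t * dz t - dy t * z t = 1) ->
  (forall t, 0 < y t) -> (forall M T, exists2 a, a < T & z a <= M * y a) ->
  (forall M T, exists2 a, T < a & M * y a <= z a) ->
  continuous w -> 0 < eps -> t1 <= s1 -> s1 < s2 -> s2 <= t2 ->
  (forall t, 0 <= w t) -> (forall t, s1 <= t <= s2 -> 0 < w t) ->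
  (forall t, t <= t1 -> w t = 0) -> (forall t, t2 <= t -> w t = 0) ->
  ~ form_ge0 (fun t => Q t - eps * w t).
Proof.
move=> cQ hy hz W1 y0 zl zr cw e0 ts1 s12 ts2 w0 ws wl wr fQ.
pose Q1 t := Q t - eps * w t.
have cQ1 : continuous Q1.
  by move=> t; exact: (cvgB (cQ t) (cvgM (cvg_cst eps) (cw t))).
have [U [dU [hU U1 dU1]]] := sol_exists t1 (y t1) (dy t1) cQ1.
have [Z [dZ [hZ Z1 dZ1]]] := sol_exists t1 (z t1) (dz t1) cQ1.
have QQ t : t <= t1 -> Q1 t = Q t by rewrite /Q1 => /wl ->; rewrite mulr0 subr0.
have yU t : t <= t1 -> y t = U t by apply: (sol_local_eq cQ QQ hy hU).
have zZ t : t <= t1 -> z t = Z t by apply: (sol_local_eq cQ QQ hz hZ).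
have WU t : U t * dZ t - dU t * Z t = 1.
  by rewrite (wronskian_cst t t1 hU hZ) U1 dU1 Z1 dZ1 W1.
have U0 : forall t, 0 < U t.
  apply: (form_ge0_pos cQ1 fQ hU hZ WU (T := t1)) => [t tt|M]; first by rewrite -yU.
  by have [a at1 h] := zl M t1; exists a => //; rewrite -(yU _ (ltW at1)) -(zZ _ (ltW at1)).
case: hy hz hU => [hy hdy] [hz hdz] [hU hdU].
(* The Wronskian of solutions for the two potentials: it starts at 0, never increases, and drops
   strictly on [s1, s2]. Its value at [t2] is the coefficient of [z] in [U] beyond [t2]. *)
pose D t := y t * dU t - dy t * U t; pose dD t := - eps * (w t * (y t * U t)).
have hD : prim_of D dD by move=> t; rewrite /D /dD /Q1; der; rewrite /Q1; ring.
have dD0 t : dD t <= 0.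
  by rewrite /dD mulNr oppr_le0 mulr_ge0 ?(ltW e0)// !mulr_ge0// ltW.
have D1 : D t1 = 0 by rewrite /D U1 dU1; ring.
have mono a b : a <= b -> D b <= D a.
  move=> ab; rewrite -subr_le0.
  have := @le_der2 R D (fun=> 0) dD (fun=> 0) a b ab; rewrite subrr; apply => t _.
  - exact: hD.
  - exact: dD0.
have D12 : D s2 < D s1.
  rewrite -ltrN2; apply: (lt_der (f := fun t => - D t) (df := fun t => - dD t)) => // t tI.
    by der.
  by rewrite /dD mulNr opprK !mulr_gt0 ?ws.
have d0 : D t2 < 0.
  have h1 := mono _ _ ts1; have h2 := mono _ _ ts2; by rewrite D1 in h1; lra.
have Dc t : t2 <= t -> D t = D t2.
  move=> tt; apply/esym; apply: cst_der => // s /andP[/wr ws0 _].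
  by have := hD s; rewrite /dD ws0 mul0r mulr0.
(* Past [t2], [U - D t2 * z] has zero Wronskian with [y], hence is a multiple of it. *)
pose G t := (U t - D t2 * z t) / y t.
have Gc t : t2 <= t -> G t = G t2.
  move=> tt; apply/esym; apply: cst_der => // s /andP[ts _].
  have yn : y s != 0 by rewrite gt_eqF.
  rewrite /G; der => //.
  have e : (dU s - D t2 * dz s) * y s - (U s - D t2 * z s) * dy s = 0.
    transitivity (D s - D t2 * (y s * dz s - dy s * z s)); first by rewrite /D; ring.
    by rewrite W1 Dc//; ring.
  by transitivity (((dU s - D t2 * dz s) * y s - (U s - D t2 * z s) * dy s) / y s ^+ 2);
    [field|rewrite e mul0r].
have [a t2a za] := zr (- G t2 / D t2) t2.
have := U0 a; have -> : U a = G t2 * y a + D t2 * z a.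
  by rewrite -(Gc a (ltW t2a)) /G; field; rewrite gt_eqF.
have : D t2 * z a <= D t2 * (- G t2 / D t2 * y a) by rewrite ler_wnM2l// ltW.
have -> : D t2 * (- G t2 / D t2 * y a) = - G t2 * y a by field; rewrite lt_eqF.
by rewrite mulNr; lra.
Qed.

End Disconjugacy.

(** * Solutions recessive and dominant at infinity *)

Section Bases.
Context {R : realType}.
Implicit Types (y dy z dz u du v dv Q w : R -> R).

Definition right_basis Q (k : R) y dy z dz :=
  [/\ sol Q y dy, sol Q z dz, (forall t, y t * dz t - dy t * z t = 1),
      expR (k * t) * y t @[t --> +oo] --> (1 : R) &
      z t / dominant k t @[t --> +oo] --> (1 : R) /\ z t / y t @[t --> +oo] --> +oo].

(** Reflection reverses the sign of derivatives and so of the Wronskian; negating [z] restores the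
    value 1. Hence [z] tends to minus infinity at -oo. *)
Definition left_basis Q k y dy z dz :=
  right_basis (fun t => Q (- t)) k (fun t => y (- t)) (fun t => - dy (- t))
    (fun t => - z (- t)) (fun t => dz (- t)).

Lemma right_basis_exists Q (k th C T : R) : 0 <= k -> 0 < th -> 0 <= C -> continuous Q ->
  (forall t, T <= t -> `|Q t - k ^+ 2| <= C * expR (- th * t)) ->
  exists y dy z dz, right_basis Q k y dy z dz.
Proof.
move=> k0 th0 C0 cQ hQ; have [y [dy [hy y1]]] := recessive_exists k0 th0 C0 cQ hQ.
by have [z [dz [hz W1 z1 zy]]] := dominant_exists k0 cQ hy y1; exists y, dy, z, dz.
Qed.

Lemma left_basis_exists Q (k th C T : R) : 0 <= k -> 0 < th -> 0 <= C -> continuous Q ->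
  (forall t, T <= t -> `|Q (- t) - k ^+ 2| <= C * expR (- th * t)) ->
  exists y dy z dz, left_basis Q k y dy z dz.
Proof.
move=> k0 th0 C0 cQ hQ.
have cQN : continuous (fun t : R => Q (- t)).
  by move=> t; apply: continuous_comp; [exact: opp_continuous|exact: cQ].
have [y [dy [z [dz h]]]] := right_basis_exists k0 th0 C0 cQN hQ.
exists (fun t => y (- t)), (fun t => - dy (- t)), (fun t => - z (- t)), (fun t => dz (- t)).
rewrite /left_basis; have -> : (fun t => y (- - t)) = y by apply/funext => t; rewrite opprK.
have -> : (fun t => - - dy (- - t)) = dy by apply/funext => t; rewrite !opprK.
have -> : (fun t => - - z (- - t)) = z by apply/funext => t; rewrite !opprK.
by have -> : (fun t => dz (- - t)) = dz by apply/funext => t; rewrite opprK.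
Qed.

Lemma left_basis_sol Q k y dy z dz : left_basis Q k y dy z dz ->
  [/\ sol Q y dy, sol Q z dz & forall t, y t * dz t - dy t * z t = 1].
Proof.
move=> [/sol_reflect hy /sol_reflect hz W1 _ _]; split.
- by move: hy; congr sol; apply/funext => t; rewrite !opprK.
- have := sol_lin (-1) 0 hz hz; congr sol; apply/funext => t; rewrite ?opprK//; ring.
- by move=> t; have := W1 (- t); rewrite !opprK => <-; ring.
Qed.

Section RightBasis.
Context (Q : R -> R) (k : R) (y dy z dz : R -> R).
Hypothesis k0 : 0 <= k.
Hypothesis yz : right_basis Q k y dy z dz.

Lemma right_basis_pos : exists T, forall t, T <= t -> 0 < y t.
Proof.
have [_ _ _ /cvg_pinfty_le h _] := yz; have [|T hT] := h 2^-1; first lra.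
exists T => t /hT; rewrite ler_norml => /andP[h1 _].
have : 0 < expR (k * t) * y t by lra.
by rewrite pmulr_rgt0// expR_gt0.
Qed.

Lemma right_basis_dominates M : exists T, forall t, T <= t -> M * y t <= z t.
Proof.
have [T hT] := right_basis_pos; have [_ _ _ _ [_ /cvgryPge h]] := yz.
have /near_pinftyP[T1 hT1] := h M; exists (Num.max T T1) => t.
by rewrite ge_max => /andP[/hT y0 /hT1]; rewrite ler_pdivlMr.
Qed.

Lemma right_basis_unbounded M T : exists2 a, T < a & M * y a <= z a.
Proof.
have [T1 h] := right_basis_dominates M; exists (Num.max (T + 1) T1).
  by rewrite lt_max ltrDl ltr01.
by apply: h; rewrite le_max lexx orbT.
Qed.

(** The recessive solution is negligible, as [y / dominant] is the product of [z / dominant] and the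
    inverse of [z / y]. A solution thus reveals its dominant coefficient as a limit. *)
Lemma right_basis_coef (a b : R) :
  (a * y t + b * z t) / dominant k t @[t --> +oo] --> b.
Proof.
have [T hT] := right_basis_pos; have [_ _ _ _ [z1 zy]] := yz.
have yd : y t / dominant k t @[t --> +oo] --> (0 : R).
  have zy0 : (z t / y t)^-1 @[t --> +oo] --> (0 : R).
    by apply/gtr0_cvgV0 => //; move/cvgryPgt: zy => /(_ 0).
  rewrite -[0](mul1r 0); apply: cvg_trans (cvgM z1 zy0); apply: near_eq_cvg.
  have [T1 hT1] := right_basis_dominates 1.
  apply/near_pinftyP; exists (Num.max T T1) => t; rewrite ge_max => /andP[tT tT1].
  have y0 := hT t tT; have z0 : 0 < z t by rewrite (lt_le_trans y0)// -[y t]mul1r hT1.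
  rewrite /GRing.mul_fun /=; case: (eqVneq (dominant k t) 0) => [->|dn].
    by rewrite invr0 !mulr0 mul0r.
  by field; rewrite dn !gt_eqF.
have h : a * (y t / dominant k t) + b * (z t / dominant k t) @[t --> +oo] --> a * 0 + b * 1.
  exact: (cvgD (cvgM (cvg_cst a) yd) (cvgM (cvg_cst b) z1)).
rewrite mulr0 add0r mulr1 in h; move: h.
by under eq_fun do rewrite !mulrA -mulrDl.
Qed.

Lemma right_basis_span w dw : continuous Q -> sol Q w dw ->
  exists a b, w = (fun t => a * y t + b * z t) /\ dw = (fun t => a * dy t + b * dz t).
Proof. by have [hy hz W1 _ _] := yz => cQ hw; exact: sol_span hy hz hw (W1 0). Qed.

Lemma dominant_gt0 t : 0 < t -> 0 < dominant k t.
Proof.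
rewrite /dominant; case: eqP => // /eqP kn _.
by rewrite divr_gt0 ?expR_gt0// mulr_gt0// lt0r kn.
Qed.

(** The exponentials cancel in [y * z], leaving growth at most linear (for [k = 0]), which
    [expR (- t)] absorbs. *)
Lemma right_basis_product (a b : R) : exists C T, forall t, T <= t ->
  expR (- t) * `|y t * (a * y t + b * z t)| <= C.
Proof.
have [_ _ _ y1 [z1 _]] := yz; have l1 : 0 < 1 :> R by [].
move/cvg_pinfty_le: y1 => /(_ 1 l1)[T1 h1]; move/cvg_pinfty_le: z1 => /(_ 1 l1)[T2 h2].
exists (4 * `|a| + 4 * `|b| * (1 + (2 * k)^-1)), (Num.max 1 (Num.max T1 T2)) => t.
rewrite !ge_max => /and3P[t1 /h1 yt /h2 zt]; have t0 : 0 < t by exact: lt_le_trans t1.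
have e0 := expR_gt0 (k * t); have d0 := dominant_gt0 t0.
have en : expR (- t) * (1 + t) <= 1.
  by rewrite expRN mulrC ler_pdivrMr ?expR_gt0// mul1r expR_ge1Dx.
have yle : `|y t| <= 2 * expR (- (k * t)).
  rewrite expRN ler_pdivlMr// mulrC -[X in X * _](gtr0_norm e0) -normrM.
  rewrite -[_ * _](subrK 1) (le_trans (ler_normD _ _))// normr1; lra.
have zle : `|z t| <= 2 * dominant k t.
  rewrite -ler_pdivrMr// -[X in _ / X](gtr0_norm d0) -normf_div.
  rewrite -[_ / _](subrK 1) (le_trans (ler_normD _ _))// normr1; lra.
have ek1 : expR (- (k * t)) <= 1 by rewrite expR_le1 oppr_le0 mulr_ge0// ltW.
(* One bound serves both cases because the inverse of 0 is 0. *)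
have ekd : expR (- (k * t)) * dominant k t <= (1 + (2 * k)^-1) * (1 + t).
  rewrite /dominant; case: eqP => [->|/eqP kn].
    by rewrite mul0r oppr0 expR0 mul1r mulr0 invr0 addr0; lra.
  have kp : 0 < (2 * k)^-1 by rewrite invr_gt0 mulr_gt0// lt0r kn.
  rewrite mulrA -expRD addNr expR0 mul1r; nra.
have yy : `|y t| * `|y t| <= 4.
  have y2 : `|y t| <= 2 by rewrite (le_trans yle)// -[leRHS]mulr1 ler_wpM2l.
  have -> : 4 = 2 * 2 :> R by ring.
  by rewrite ler_pM.
have yzle : `|y t| * `|z t| <= 4 * ((1 + (2 * k)^-1) * (1 + t)).
  rewrite (le_trans (ler_pM (normr_ge0 _) (normr_ge0 _) yle zle))//.
  by rewrite mulrACA; have := ekd; lra.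
have ki : 0 <= (2 * k)^-1 by rewrite invr_ge0 mulr_ge0.
have e1 : expR (- t) <= 1 by rewrite expR_le1 oppr_le0 ltW.
have em := expR_gt0 (- t).
have hsum : `|y t * (a * y t + b * z t)| <= `|a| * 4 + `|b| * (4 * ((1 + (2 * k)^-1) * (1 + t))).
  rewrite mulrDr (le_trans (ler_normD _ _))// lerD// !normrM.
    by rewrite mulrCA ler_wpM2l.
  by rewrite mulrCA ler_wpM2l.
rewrite (le_trans (ler_wpM2l (ltW em) hsum))//.
set ka := 1 + (2 * k)^-1 in hsum *.
have -> : expR (- t) * (`|a| * 4 + `|b| * (4 * (ka * (1 + t)))) =
   (4 * `|a|) * expR (- t) + (4 * `|b| * ka) * (expR (- t) * (1 + t)) by ring.
rewrite lerD// -[leRHS]mulr1 ler_wpM2l// !mulr_ge0//.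
by rewrite /ka addr_ge0.
Qed.

End RightBasis.

(* u / y has derivative - b / y^2 and is positive near +oo. *)
Lemma positive_backwards Q y dy u du (b T : R) : sol Q y dy -> sol Q u du ->
  (forall t, 0 < y t) -> 0 < b -> (forall t, y t * du t - dy t * u t = - b) ->
  (forall t, T <= t -> 0 < u t) -> forall t, 0 < u t.
Proof.
move=> [hy _] [hu _] y0 b0 Wb uT t; rewrite ltNge; apply/negP => ut.
pose t1 := Num.max (t + 1) T; have tt1 : t < t1 by rewrite lt_max ltrDl ltr01.
have ut1 : 0 < u t1 by apply: uT; rewrite le_max lexx orbT.
have : - (u t / y t) < - (u t1 / y t1).
  apply: (lt_der (f := fun t => - (u t / y t)) (df := fun t => b / y t ^+ 2)) => // s _.
    have ys : y s != 0 by rewrite gt_eqF.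
    by der => //; rewrite -[b]opprK -(Wb s); field.
  by rewrite divr_gt0// exprn_gt0.
rewrite ltrN2 => h; have h1 : 0 < u t1 / y t1 by rewrite divr_gt0.
by have h2 : u t / y t <= 0; [rewrite pmulr_lle0// invr_gt0|lra].
Qed.

End Bases.

(** * Criticality of radial potentials *)

Section Criticality.
Context {R : realType} {N : nat}.
Implicit Types (V y dy z dz u du w : R -> R).

Definition log_pot V (t : R) : R := ((N%:R - 2) / 2) ^+ 2 + expR (2 * t) * V (expR t).

Lemma expR_cont : continuous (@expR R).
Proof. by move=> t; apply: (der_cont (a := expR t)). Qed.

Lemma expR2_cont : continuous (fun t : R => expR (2 * t)).
Proof. by move=> t; apply: (der_cont (a := 2 * expR (2 * t))); der; ring. Qed.

Lemma log_pot_cont V : (forall r : R, 0 < r -> {for r, continuous V}) ->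
  continuous (log_pot V).
Proof.
move=> cV; suff h t : {for t, continuous (log_pot V)} by exact: h.
apply: for_D; first exact: for_cst; apply: for_M; first exact: expR2_cont.
apply: (continuous_comp_for (f := expR) (g := V)); first exact: expR_cont.
exact/cV/expR_gt0.
Qed.

Lemma radial_cont V : (forall r : R, 0 < r -> {for r, continuous V}) ->
  forall x : 'rV[R]_N, x != 0 -> {for x, continuous (radial N V)}.
Proof.
move=> cV x x0; apply: (continuous_comp_for (g := V)); last exact/cV/enorm_gt0.
apply: (continuous_comp_for (f := r2) (g := Num.sqrt)); first exact: r2_cont.
exact: sqrt_continuous.
Qed.

Lemma log_pot_form V : (0 < N)%N -> (forall r : R, 0 < r -> {for r, continuous V}) ->
  nonnegative (radial N V) -> form_ge0 (log_pot V).
Proof.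
by move=> N0 cV hV eta deta F a b ab heta cdeta ea eb hF;
   apply: (radial_form_ge0 N0 cV hV ab heta cdeta ea eb _ hF).
Qed.

Lemma C0infty_bound W : C0infty [set: 'rV[R]_N] W -> exists M B : R,
  [/\ 0 < M, 0 < B, forall x, W x <= M & forall x, B < r2 x -> W x = 0].
Proof.
move=> hW; have [A WA] := C0infty_supp hW.
have [|M M0 WM] := cc_bounded (f := W); first by split; [exact: C0infty_cont hW|exists A].
exists M, (N%:R * A ^+ 2 + 1); split => // [|x|x Bx].
- by rewrite ltr_wpDl// mulr_ge0// sqr_ge0.
- by rewrite (le_trans (ler_norm _)).
- case: (pselect (exists i, A < `|x ord0 i|)) => [[i /WA//]|nA].
  suff : r2 x <= N%:R * A ^+ 2 by lra.
  rewrite /r2 (le_trans (ler_sum _ (fun i _ => _ : _ <= A ^+ 2)))//.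
    move=> i; have xA : `|x ord0 i| <= A by rewrite leNgt; apply/negP => h; apply: nA; exists i.
    by rewrite -(real_normK (num_real (x ord0 i))) lerXn2r ?nnegrE// (le_trans _ xA).
  by rewrite sumr_const card_ord mulr_natl.
Qed.

(* With p = y'/y and q = u'/u, the function b = (p + q)/2 satisfies
   b' + b^2 = Q - (p - q)^2 / 4, which leaves room for a perturbation. *)
Lemma subcritical_pair V y dy u du (c : R) :
  (forall r : R, 0 < r -> {for r, continuous V}) -> nonnegative (radial N V) ->
  sol (log_pot V) y dy -> sol (log_pot V) u du -> (forall t, 0 < y t) ->
  (forall t, 0 < u t) -> c != 0 -> (forall t, y t * du t - dy t * u t = c) ->
  (forall B, exists C, forall t, t <= B -> expR t * `|y t * u t| <= C) ->
  subcritical (radial N V).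
Proof.
move=> cV hV hy hu y0 u0 c0 Wc hC; split=> // W hW.
have cQ := log_pot_cont cV; have [M [B [M0 B0 WM WB]]] := C0infty_bound hW.
have [C1 hC1] := hC (ln B / 2); pose C := `|C1| + 1.
have C0 : 0 < C by rewrite ltr_wpDl.
have c2 : 0 < c ^+ 2 by rewrite exprn_even_gt0.
(* The difference of logarithmic derivatives is [c / (y * u)] up to sign, so the room is c^2 / (4 (y
   u)^2). On the support of [W], e^{2t} (y u)^2 <= C^2 and [W <= M]. *)
exists (c ^+ 2 / (4 * C ^+ 2 * M)) => [|eps /andP[e0]].
  by rewrite divr_gt0// !mulr_gt0// exprn_gt0.
rewrite ltr_pdivlMr ?mulr_gt0 ?exprn_gt0// => he.
case: hy hu => [hy hdy] [hu hdu].
have yn t : y t != 0 by rewrite gt_eqF.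
have un t : u t != 0 by rewrite gt_eqF.
pose be t := (dy t / y t + du t / u t) / 2.
pose dbe t := log_pot V t - ((dy t / y t) ^+ 2 + (du t / u t) ^+ 2) / 2.
have cdbe : continuous dbe.
  suff h t : {for t, continuous dbe} by exact: h.
  have h1 : {for t, continuous (fun t => dy t / y t)}.
    apply: (der_cont (a := log_pot V t - (dy t / y t) ^+ 2)); der => //; field; exact: yn.
  have h2 : {for t, continuous (fun t => du t / u t)}.
    apply: (der_cont (a := log_pot V t - (du t / u t) ^+ 2)); der => //; field; exact: un.
  have -> : dbe = (fun t => log_pot V t + - 2^-1 * ((dy t / y t) ^+ 2 + (du t / u t) ^+ 2)).
    by apply/funext => s; rewrite /dbe mulNr [2^-1 * _]mulrC.
  apply: for_D; first exact: cQ; apply: for_M; first exact: for_cst.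
  by apply: for_D; exact: for_X.
apply: (nonnegative_riccati (be := be) (dbe := dbe)) => //.
- move=> x x0; apply: (for_D (f := radial N V) (g := fun x => - (eps * W x))).
    exact: radial_cont.
  have -> : (fun x => - (eps * W x)) = (fun x => - eps * W x).
    by apply/funext => x1; rewrite mulNr.
  by apply: for_M; [exact: for_cst|exact: C0infty_cont hW _].
- by move=> t; rewrite /be /dbe; der => //; field; rewrite yn un.
move=> x x0; set t := ln (r2 x) / 2; have r0 := r2_gt0 x0.
have et : expR (2 * t) = r2 x by exact: expR_ln_enorm.
have et1 : expR t = enorm x by rewrite /t -ln_enorm// lnK// posrE enorm_gt0.
have -> : dbe t + be t ^+ 2 = log_pot V t - (c / (y t * u t)) ^+ 2 / 4.
  by rewrite /dbe /be -(Wc t); field; rewrite yn un.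
rewrite /log_pot et et1 /radial mulrBr addrA lerD2l lerN2.
have [W0|W0] := leP (W x) 0.
  rewrite (@le_trans _ _ 0)//; last by rewrite divr_ge0// sqr_ge0.
  by rewrite pmulr_rle0// pmulr_rle0.
have tB : t <= ln B / 2.
  rewrite ler_pM2r ?invr_gt0// ler_ln ?posrE// leNgt; apply/negP => /WB W1.
  by rewrite W1 ltxx in W0.
have yu : 0 < y t * u t by rewrite mulr_gt0.
have hc : r2 x * (y t * u t) ^+ 2 <= C ^+ 2.
  rewrite -et (_ : 2 * t = t + t) ?expRD; last by ring.
  rewrite -expr2 -exprMn lerXn2r ?nnegrE ?(ltW C0)//; first by rewrite mulr_ge0 ?expR_ge0// ltW.
  have := hC1 t tB; rewrite gtr0_norm//; have := ler_norm C1; rewrite /C; lra.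
rewrite expr_div_n -mulrA -invfM ler_pdivlMr ?mulr_gt0 ?exprn_gt0//.
have h1 : eps * W x * (4 * C ^+ 2) <= c ^+ 2.
  apply: le_trans (ltW he); rewrite -mulrA ler_wpM2l ?(ltW e0)// mulrC ler_wpM2l//.
  by rewrite mulr_ge0// sqr_ge0.
apply: le_trans h1; rewrite (_ : r2 x * (eps * W x) * ((y t * u t) ^+ 2 * 4) =
  eps * W x * 4 * (r2 x * (y t * u t) ^+ 2)); last by ring.
by rewrite -(mulrA (eps * W x) 4) ler_wpM2l ?mulr_ge0 ?(ltW e0) ?(ltW W0)// ler_wpM2l.
Qed.

(** The perturbation tested is a fixed annular bump [f (r2 x)], equal to 1 for 2 <= |x|^2 <= 3 and 0
    outside 1 <= |x|^2 <= 4. In the variable [t] it becomes [expR (2 * t) * f (expR (2 * t))], to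
    which [not_form_ge0] applies. *)
Lemma not_subcritical V y dy z dz : (0 < N)%N ->
  (forall r : R, 0 < r -> {for r, continuous V}) ->
  sol (log_pot V) y dy -> sol (log_pot V) z dz ->
  (forall t, y t * dz t - dy t * z t = 1) -> (forall t, 0 < y t) ->
  (forall M T, exists2 a, a < T & z a <= M * y a) ->
  (forall M T, exists2 a, T < a & M * y a <= z a) -> ~ subcritical (radial N V).
Proof.
move=> N0 cV hy hz W1 y0 zl zr [_ hW].
have [Th [dTh [sTh hTh _ _ [Th0 Th1 Th01 _ _]]]] := @step_exists R.
have cTh := prim_cont hTh.
pose f s := Th (1 * s + - 1) * Th (-1 * s + 4).
have sf : sm f by apply: sm_mul; exact: sm_aff.
have cf := sm_cont sf.
have f0 s : 0 <= f s.
  by rewrite mulr_ge0//; [case/andP: (Th01 (1 * s + - 1))|case/andP: (Th01 (-1 * s + 4))].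
have fl s : s <= 1 -> f s = 0 by move=> s1; rewrite /f Th0 ?mul0r//; lra.
have fr s : 4 <= s -> f s = 0 by move=> s1; rewrite /f mulrC Th0 ?mul0r//; lra.
have f1 s : 2 <= s <= 3 -> f s = 1.
  by move=> /andP[s2 s3]; rewrite /f !Th1 ?mulr1//; lra.
have [eps0 e0 he] := hW _ (radial_C0infty sf fr).
pose eps := eps0 / 2; have epos : 0 < eps by rewrite divr_gt0.
pose V1 r := V r - eps * f (r ^+ 2).
have cV1 r : 0 < r -> {for r, continuous V1}.
  move=> r0; have h1 : {for r, continuous (fun r : R => f (r ^+ 2))}.
    apply: (continuous_comp_for (f := fun r : R => r ^+ 2) (g := f)); last exact: cf.
    exact: exprn_continuous.
  exact: (cvgB (cV r r0) (cvgM (cvg_cst eps) h1)).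
have hV1 : nonnegative (radial N V1).
  have -> : radial N V1 = (fun x => radial N V x - eps * f (r2 x)).
    by apply/funext => x; rewrite /radial /V1 /enorm sqr_sqrtr// r2_ge0.
  by apply: he; rewrite epos /eps; lra.
have fQ := log_pot_form N0 cV1 hV1.
have e2 (a : R) : 0 < a -> expR (2 * (ln a / 2)) = a.
  by move=> a0; rewrite mulrC divfK// lnK.
have le2 (s t : R) : s <= t -> expR (2 * s) <= expR (2 * t) by move=> st; rewrite ler_expR ler_pM2l.
apply: (not_form_ge0 (w := fun t => expR (2 * t) * f (expR (2 * t))) (eps := eps)
  (t1 := 0) (s1 := ln 2 / 2) (s2 := ln 3 / 2) (t2 := ln 4 / 2)
  (log_pot_cont cV) hy hz W1 y0 zl zr) => //.
- suff h (t : R) : {for t, continuous (fun t : R => expR (2 * t) * f (expR (2 * t)))} by exact: h.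
  apply: for_M; first exact: expR2_cont.
  by apply: (continuous_comp_for (g := f)); [exact: expR2_cont|exact: cf].
- by rewrite divr_ge0// ln_ge0//; lra.
- by rewrite ltr_pM2r ?invr_gt0// ltr_ln ?posrE//; lra.
- by rewrite ler_pM2r ?invr_gt0// ler_ln ?posrE//; lra.
- by move=> t; rewrite mulr_ge0// expR_ge0.
- move=> t /andP[/le2 h1 /le2 h2]; rewrite !e2 in h1 h2; try lra.
  by rewrite f1 ?mulr1 ?expR_gt0// h1.
- by move=> t /le2; rewrite mulr0 expR0 => /fl ->; rewrite mulr0.
- by move=> t /le2; rewrite e2; [move/fr ->; rewrite mulr0|lra].
- move: fQ; congr form_ge0; apply/funext => t; rewrite /log_pot /V1.
  by rewrite -expRM_natl -mulr_natl; ring.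
Qed.

Lemma left_basis_pos Q (k : R) y dy z dz : left_basis Q k y dy z dz ->
  exists T, forall t, t <= T -> 0 < y t.
Proof.
move=> /right_basis_pos[T hT]; exists (- T) => t tT.
by rewrite -[t]opprK hT// lerNr.
Qed.

Lemma left_basis_unbounded Q (k : R) y dy z dz M T : left_basis Q k y dy z dz ->
  exists2 a, a < T & z a <= M * y a.
Proof.
move=> /right_basis_unbounded/(_ (- M) (- T))[a Ta h]; exists (- a); first by rewrite ltrNl.
by rewrite -lerN2 -mulNr.
Qed.

(** The tail at -oo is the reflected [right_basis_product], and the rest of the half-line up to [B]
    is a compact interval. *)
Lemma left_basis_product Q (k : R) y dy z dz u du : continuous Q -> 0 <= k ->
  left_basis Q k y dy z dz -> sol Q u du ->
  forall B, exists C, forall t, t <= B -> expR t * `|y t * u t| <= C.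
Proof.
move=> cQ k0 yz [hu hdu] B; have [hy hz W1] := left_basis_sol yz.
have [a [b [ue _]]] := sol_span cQ hy hz (conj hu hdu) (W1 0).
have [C [T hC]] := right_basis_product k0 yz a (- b).
pose B1 := Num.max B (- T); have TB : - T <= B1 by rewrite le_max lexx orbT.
have cf : continuous (fun t => expR t * (y t * u t)).
  move=> t; exact: (cvgM (expR_cont (x := t)) (cvgM (prim_cont hy.1 (x := t)) (prim_cont hu (x := t)))).
have [M M0 hM] := bounded_seg TB cf.
exists (Num.max C M) => t tB; case: (leP t (- T)) => [tT|/ltW tT].
  rewrite le_max; apply/orP; left; have := hC (- t); rewrite opprK ue mulrNN; apply.
  by rewrite lerNr.
rewrite le_max; apply/orP; right; rewrite -[X in X * _]ger0_norm ?expR_ge0// -normrM hM//.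
by rewrite tT le_max tB.
Qed.

(** The sign of the dominant coefficient [b] decides. A negative [b] would make [y] negative at +oo.
    If [b > 0], [y] and [u] are independent positive solutions; if [b = 0], [y] is recessive at both
    ends. *)
Lemma criticality_dichotomy V (k1 k2 a b : R) y dy z dz u du v dv : (0 < N)%N ->
  (forall r : R, 0 < r -> {for r, continuous V}) -> nonnegative (radial N V) -> 0 <= k1 ->
  left_basis (log_pot V) k1 y dy z dz -> right_basis (log_pot V) k2 u du v dv ->
  y = (fun t => a * u t + b * v t) -> dy = (fun t => a * du t + b * dv t) ->
  (forall t, 0 < y t) /\
  (0 < b /\ subcritical (radial N V) \/ [/\ b = 0, 0 < a & ~ subcritical (radial N V)]).
Proof.
move=> N0 cV hV k0 yz uv ye dye; have cQ := log_pot_cont cV.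
have [hy hz W1] := left_basis_sol yz; have [hu hv W2 _ _] := uv.
have [T yT] := left_basis_pos yz; have fQ := log_pot_form N0 cV hV.
have y0 : forall t, 0 < y t.
  apply: (form_ge0_pos cQ fQ hy hz W1 yT) => M; exact: (left_basis_unbounded M T yz).
split=> //; have [T2 uT] := right_basis_pos uv.
have [b0|bn] := eqVneq b 0; [right|left].
  have yu t : y t = a * u t by rewrite ye b0 mul0r addr0.
  have a0 : 0 < a by have := y0 T2; rewrite yu pmulr_lgt0// uT.
  split=> //; apply: (not_subcritical N0 cV hy hz W1 y0) => M T1.
    exact: (left_basis_unbounded M T1 yz).
  have [c [d [ze dze]]] := right_basis_span uv cQ hz.
  (* The Wronskian of [y = a * u] and [z = c * u + d * v] is [a * d], and equals 1. *)
  have d0 : 0 < d.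
    rewrite -(pmulr_rgt0 _ a0) (_ : a * d = 1) ?ltr01//.
    have := W1 0; rewrite ye dye ze dze b0 !mul0r !addr0 => <-.
    by rewrite -[LHS]mulr1 -(W2 0); ring.
  have [t Tt h] := right_basis_unbounded uv ((M * a - c) / d) T1; exists t => //.
  rewrite yu ze mulrA -lerBlDl -mulrBl -ler_pdivrMl//.
  by rewrite mulrC mulrAC.
have b0 : 0 < b.
  rewrite lt0r bn /= leNgt; apply/negP => bneg.
  have [T3 h] := right_basis_dominates uv (- a / b).
  have := y0 T3; rewrite ltNge ye => /negP; apply.
  have := h T3 (lexx _); rewrite -(ler_nM2l bneg).
  by rewrite (_ : b * (- a / b * u T3) = - a * u T3); [lra|field].
split=> //.
have Wyu t : y t * du t - dy t * u t = - b.
  by rewrite ye dye -[RHS]mulr1 -(W2 t); ring.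
apply: (subcritical_pair cV hV hy hu y0 _ _ Wyu); last 2 first.
- by rewrite oppr_eq0.
- exact: left_basis_product yz hu.
- exact: (positive_backwards hy hu y0 b0 Wyu uT).
Qed.

End Criticality.

(** * Logarithmic change of variables *)

Section LogVariable.
Context {R : realType} {N : nat}.
Implicit Types (V U y dy f : R -> R) (P : R -> Prop).

Local Notation m := ((N%:R - 2) / 2 : R).

Definition to_log U (t : R) := expR (m * t) * U (expR t).

Definition dto_log U (t : R) :=
  expR (m * t) * (m * U (expR t) + expR t * derive1 U (expR t)).

Definition from_log y (r : R) := expR (- m * ln r) * y (ln r).

Lemma from_logK y t : to_log (from_log y) t = y t.
Proof. by rewrite /to_log /from_log expRK mulrA -expRD mulNr subrr expR0 mul1r. Qed.

Lemma to_logE U t : U (expR t) = expR (- (m * t)) * to_log U t.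
Proof. by rewrite /to_log mulrA -expRD addNr expR0 mul1r. Qed.

Lemma sol_to_log V U : ode_solution N V U -> sol (log_pot (N := N) V) (to_log U) (dto_log U).
Proof.
move=> hU; split=> t; have [h1 h2 h3] := hU _ (expR_gt0 t);
  have dexp := is_derive_expR t.
  have hU1 := der_comp (f := U) (g := expR) (derivable1_is_derive h1 erefl) dexp.
  by rewrite /to_log /dto_log; der; ring.
have hU1 := der_comp (f := U) (g := expR) (derivable1_is_derive h1 erefl) dexp.
have hU2 := der_comp (f := derive1 U) (g := expR) (derivable1_is_derive h2 erefl) dexp.
have en : expR t != 0 by rewrite gt_eqF// expR_gt0.
have e2 : derive1 (derive1 U) (expR t) =
    V (expR t) * U (expR t) - (N%:R - 1) / expR t * derive1 U (expR t).
  by rewrite -[LHS]subr0 -[X in _ - X]h3; ring.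
rewrite /dto_log; der; rewrite e2 /log_pot /to_log (_ : 2 * t = t + t) ?expRD; last ring.
by field.
Qed.

Lemma ode_from_log V y dy : sol (log_pot (N := N) V) y dy -> ode_solution N V (from_log y).
Proof.
move=> [hy hdy].
pose U1 (r : R) := expR (- m * ln r) * ((dy (ln r) - m * y (ln r)) / r).
have d1 (r : R) : 0 < r -> is_derive r 1 (from_log y) (U1 r).
  move=> r0; have rn : r != 0 by rewrite gt_eqF.
  by rewrite /from_log /U1; der => //; field.
move=> r r0; have rn : r != 0 by rewrite gt_eqF.
(* The formula [U1] holds only on (0,oo), so the second derivative is taken through equality near
   [r]. *)
have e : \forall s \near r, U1 s = derive1 (from_log y) s.
  have : \forall s \near r, 0 < s by exact: lt_nbhsr.
  by apply: filterS => s /d1[_ <-]; rewrite derive1E.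
have d2 : is_derive r 1 (derive1 (from_log y)) (expR (- m * ln r) *
    ((log_pot (N := N) V (ln r) * y (ln r) - m * dy (ln r)
      - (m + 1) * (dy (ln r) - m * y (ln r))) / r ^+ 2)).
  apply: (@near_eq_is_derive _ _ _ U1); first exact: e.
  by rewrite /U1; der => //; field.
have [dU _] := d1 r r0; have [dU1 eU1] := d2.
split; [exact: dU|exact: dU1|].
rewrite derive1E eU1 -(nbhs_singleton e) /U1 /from_log /log_pot.
rewrite (_ : 2 * ln r = ln r + ln r) ?expRD ?lnK ?posrE//; last ring.
by field.
Qed.

Lemma near0_expR P : (\forall r \near 0^'+, P r) <-> exists T, forall t, T <= t -> P (expR (- t)).
Proof.
split=> [|[T hT]].
  rewrite near_withinE => /nbhs_ballP[d /= d0 hd]; exists (1 - ln d) => t ht.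
  have h : expR (- t) < d by rewrite -[ltRHS]lnK ?posrE// ltr_expR; lra.
  apply: hd; last exact: expR_gt0.
  by rewrite /ball /= sub0r normrN gtr0_norm ?expR_gt0.
rewrite near_withinE; apply/nbhs_ballP; exists (expR (- T)) => /=; first exact: expR_gt0.
move=> r; rewrite /ball /= sub0r normrN => rT r0; rewrite -[r]lnK ?posrE// -[ln r]opprK.
apply: hT; rewrite lerNr -ler_expR lnK ?posrE// ltW//.
by rewrite gtr0_norm in rT.
Qed.

Lemma nearoo_expR P : (\forall r \near +oo, P r) <-> exists T, forall t, T <= t -> P (expR t).
Proof.
rewrite near_pinftyP; split=> [[T hT]|[T hT]].
  by exists T => t Tt; apply: hT; rewrite (le_trans Tt)// (le_trans _ (expR_ge1Dx _))// lerDr.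
exists (expR T) => r hr; have r0 : 0 < r by exact: lt_le_trans (expR_gt0 T) hr.
by rewrite -[r]lnK ?posrE//; apply: hT; rewrite -ler_expR lnK.
Qed.

Lemma cvg0_expR f (l : R) : f r @[r --> 0^'+] --> l <-> f (expR (- t)) @[t --> +oo] --> l.
Proof.
rewrite cvg_pinfty_le; split=> [/cvgrPdist_le h e /h/near0_expR[T hT]|h].
  by exists T => t /hT; rewrite distrC.
by apply/cvgrPdist_le => e /h[T hT]; apply/near0_expR; exists T => t /hT; rewrite distrC.
Qed.

Lemma cvgoo_expR f (l : R) : f r @[r --> +oo] --> l <-> f (expR t) @[t --> +oo] --> l.
Proof.
rewrite (cvg_pinfty_le (fun t => f (expR t))); split=> [/cvgrPdist_le h e /h/nearoo_expR[T hT]|h].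
  by exists T => t /hT; rewrite distrC.
by apply/cvgrPdist_le => e /h[T hT]; apply/nearoo_expR; exists T => t /hT; rewrite distrC.
Qed.

Lemma powR_expR (t A : R) : expR t `^ A = expR (A * t).
Proof. by rewrite /powR gt_eqF ?expR_gt0// expRK. Qed.

Definition kappa (lambda : R) := Num.sqrt (discr N lambda) / 2.

Lemma kappa_ge0 lambda : 0 <= kappa lambda.
Proof. by rewrite divr_ge0// sqrtr_ge0. Qed.

Lemma AplusE lambda : Aplus N lambda = - m + kappa lambda.
Proof. by rewrite /Aplus /kappa; field. Qed.

Lemma AminusE lambda : Aminus N lambda = - m - kappa lambda.
Proof. by rewrite /Aminus /kappa; field. Qed.

Lemma kappa_sqr lambda : lambda_star N <= lambda -> kappa lambda ^+ 2 = m ^+ 2 + lambda.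
Proof.
rewrite /lambda_star => h; rewrite /kappa expr_div_n sqr_sqrtr /discr; last lra.
by field.
Qed.

Lemma kappa_eq0 lambda : lambda_star N <= lambda ->
  (kappa lambda == 0) = (lambda == lambda_star N).
Proof.
move=> h; rewrite -sqrf_eq0 kappa_sqr// -(subr_eq0 lambda) /lambda_star.
by congr (_ == _); field.
Qed.

Lemma log_pot_left V (th lambda : R) : lambda_star N <= lambda ->
  r `^ (- th) * `|r ^+ 2 * V r - lambda| @[r --> 0^'+] --> (0 : R) ->
  exists T, forall t, T <= t ->
    `|log_pot (N := N) V (- t) - kappa lambda ^+ 2| <= 1 * expR (- th * t).
Proof.
move=> hl /cvg0_expR/cvg_pinfty_le/(_ 1 ltr01)[T hT]; exists T => t /hT.
rewrite subr0 normrM normr_id powR_expR ger0_norm ?expR_ge0// mulrNN -expRM_natl.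
move=> h; rewrite (_ : log_pot V (- t) - _ = expR (2 * - t) * V (expR (- t)) - lambda).
  have -> : 1 * expR (- th * t) = 1 / expR (th * t) by rewrite mulNr expRN.
  by rewrite ler_pdivlMr ?expR_gt0// mulrC.
by rewrite kappa_sqr// /log_pot; ring.
Qed.

Lemma log_pot_right V (th lambda : R) : lambda_star N <= lambda ->
  r `^ th * `|r ^+ 2 * V r - lambda| @[r --> +oo] --> (0 : R) ->
  exists T, forall t, T <= t ->
    `|log_pot (N := N) V t - kappa lambda ^+ 2| <= 1 * expR (- th * t).
Proof.
move=> hl /cvgoo_expR/cvg_pinfty_le/(_ 1 ltr01)[T hT]; exists T => t /hT.
rewrite subr0 normrM normr_id powR_expR ger0_norm ?expR_ge0// -expRM_natl.
move=> h; rewrite (_ : log_pot V t - _ = expR (2 * t) * V (expR t) - lambda).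
  have -> : 1 * expR (- th * t) = 1 / expR (th * t) by rewrite mulNr expRN.
  by rewrite ler_pdivlMr ?expR_gt0// mulrC.
by rewrite kappa_sqr// /log_pot; ring.
Qed.

Lemma asymp0_to_log U (lambda : R) : asymp 0^'+ U (fun r => r `^ Aplus N lambda) <->
  expR (kappa lambda * t) * to_log U (- t) @[t --> +oo] --> (1 : R).
Proof.
rewrite /asymp cvg0_expR; suff -> : (fun t => U (expR (- t)) / expR (- t) `^ Aplus N lambda) =
  (fun t => expR (kappa lambda * t) * to_log U (- t)) by [].
apply/funext => t; rewrite to_logE powR_expR AplusE -expRN mulrAC -expRD.
by congr (expR _ * _); ring.
Qed.

Lemma asympoo_to_log U (A c : R) :
  to_log U t / (c * expR ((m + A) * t)) @[t --> +oo] --> (1 : R) ->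
  asymp +oo U (fun r => c * r `^ A).
Proof.
move=> h; apply/cvgoo_expR; apply: cvg_trans h; apply: near_eq_cvg; near=> t => /=.
by rewrite (to_logE U) powR_expR [(m + A) * t]mulrDl expRD expRN !invfM; ring.
Unshelve. all: by end_near. Qed.

Lemma asympoo_ln_to_log U (A c : R) :
  to_log U t / (c * expR ((m + A) * t) * t) @[t --> +oo] --> (1 : R) ->
  asymp +oo U (fun r => c * r `^ A * ln r).
Proof.
move=> h; apply/cvgoo_expR; apply: cvg_trans h; apply: near_eq_cvg; near=> t => /=.
by rewrite (to_logE U) powR_expR expRK [(m + A) * t]mulrDl expRD expRN !invfM; ring.
Unshelve. all: by end_near. Qed.

(** Both conditions say that [w] is negligible against the dominant solution at the origin: |ln r|
    is [t] in the degenerate case, and otherwise the power is [2 * kappa] times [dominant], which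
    [D] absorbs. *)
Lemma littleo_to_log w (lambda : R) : lambda_star N <= lambda ->
  (lambda_star N < lambda -> w =o_ (0^'+) (fun r => r `^ Aminus N lambda)) ->
  (lambda = lambda_star N ->
     w =o_ (0^'+) (fun r => r `^ (- (N%:R - 2) / 2) * `|ln r|)) ->
  to_log w (- t) / dominant (kappa lambda) t @[t --> +oo] --> (0 : R).
Proof.
move=> hl hgt heq; have k0 := kappa_ge0 lambda.
suff [D D0 hD] : exists2 D, 0 < D & forall e, 0 < e -> exists T, forall t, T <= t ->
    `|to_log w (- t)| <= e * (D * dominant (kappa lambda) t).
  apply/cvg_pinfty_le => e e0; have [|T hT] := hD (e / D); first by rewrite divr_gt0.
  exists (Num.max 1 T) => t; rewrite ge_max => /andP[t1 /hT ht].
  have d0 : 0 < dominant (kappa lambda) t by apply: dominant_gt0 => //; exact: lt_le_trans t1.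
  rewrite subr0 normf_div (gtr0_norm d0) ler_pdivrMr// (le_trans ht)// mulrA divfK//.
  by rewrite gt_eqF.
have norm_to_log t : `|to_log w (- t)| = expR (- (m * t)) * `|w (expR (- t))|.
  by rewrite /to_log normrM ger0_norm ?expR_ge0// mulrN.
move: hl; rewrite le_eqVlt => /orP[/eqP e|h].
  have kz : kappa lambda == 0 by rewrite kappa_eq0 -e.
  exists 1; first exact: ltr01.
  move=> d d0; have /eqoP/(_ d d0)/near0_expR[T hT] := heq (esym e).
  exists (Num.max 0 T) => t; rewrite ge_max => /andP[t0 /hT].
  rewrite powR_expR expRK normrN (ger0_norm t0) normrM (ger0_norm t0).
  rewrite (ger0_norm (expR_ge0 (- (N%:R - 2) / 2 * - t))) => h.
  rewrite /dominant kz mul1r norm_to_log.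
  rewrite expRN mulrC ler_pdivrMr ?expR_gt0// (le_trans h)//.
  rewrite (_ : - (N%:R - 2) / 2 * - t = m * t); last by ring.
  by rewrite le_eqVlt; apply/orP; left; apply/eqP; ring.
have kn : kappa lambda != 0 by rewrite kappa_eq0 ?(ltW h)// gt_eqF.
exists (2 * kappa lambda) => [|d d0]; first by rewrite mulr_gt0// lt0r kn.
have /eqoP/(_ d d0)/near0_expR[T hT] := hgt h; exists T => t /hT.
rewrite powR_expR norm_to_log [X in _ <= d * X]ger0_norm ?expR_ge0// AminusE => h1.
have k2n : 2 * kappa lambda != 0 by rewrite mulf_neq0// pnatr_eq0.
rewrite /dominant (negbTE kn) [2 * kappa lambda * _]mulrC divfK//.
rewrite expRN mulrC ler_pdivrMr ?expR_gt0// (le_trans h1)// -mulrA -expRD.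
by rewrite le_eqVlt; apply/orP; left; apply/eqP; congr (_ * expR _); ring.
Qed.

End LogVariable.

(** * Behaviour of the solutions of (O) at the origin and at infinity *)

Section Solutions.
Context {R : realType} {N : nat}.
Implicit Types (V U w y dy z dz u du v dv : R -> R).

Local Notation m := ((N%:R - 2) / 2 : R).
Local Notation log_pot := (log_pot (N := N)).
Local Notation to_log := (to_log (N := N)).
Local Notation from_log := (from_log (N := N)).
Local Notation kappa := (kappa (N := N)).

Lemma left_basis_recessive Q (k : R) y dy z dz w dw : continuous Q -> 0 <= k ->
  left_basis Q k y dy z dz -> sol Q w dw ->
  w (- t) / dominant k t @[t --> +oo] --> (0 : R) -> exists a, w = (fun t => a * y t).
Proof.
move=> cQ k0 yz hw w0; have [hy hz W1] := left_basis_sol yz.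
have [a [b [we _]]] := sol_span cQ hy hz hw (W1 0); exists a.
have := right_basis_coef yz a (b := - b).
under eq_fun do rewrite mulrNN; rewrite we in w0 * => h.
have bN0 : - b = 0 by exact: (cvg_unique _ h w0).
by apply/funext => t; rewrite -(opprK b) bN0 oppr0 mul0r addr0.
Qed.

(** Being equivalent to [y], [to_log w] is negligible against the dominant solution, hence a
    multiple of [y]; comparing the limits gives factor 1. *)
Lemma origin_unique V (lambda : R) y dy z dz w :
  continuous (log_pot V) -> left_basis (log_pot V) (kappa lambda) y dy z dz ->
  ode_solution N V w -> asymp 0^'+ w (fun r => r `^ Aplus N lambda) ->
  forall r, 0 < r -> w r = from_log y r.
Proof.
move=> cQ yz /sol_to_log hw /asymp0_to_log w1 r r0.
have k0 := kappa_ge0 (N := N) lambda; have [_ _ _ y1 _] := yz.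
have yd : y (- t) / dominant (kappa lambda) t @[t --> +oo] --> (0 : R).
  by have := right_basis_coef yz 1 (b := 0); under eq_fun do rewrite mul1r mul0r addr0.
have wd : to_log w (- t) / dominant (kappa lambda) t @[t --> +oo] --> (0 : R).
  have h : (expR (kappa lambda * t) * to_log w (- t)) * (expR (kappa lambda * t) * y (- t))^-1
      * (y (- t) / dominant (kappa lambda) t) @[t --> +oo] --> 1 * 1^-1 * (0 : R).
    by apply: cvgM yd; apply: cvgM w1 _; apply: cvgV y1; exact: oner_neq0.
  rewrite mulr0 in h; apply: cvg_trans h; apply: near_eq_cvg.
  have [T hT] := right_basis_pos yz; apply/near_pinftyP; exists T => t /hT yt.
  have [d0|dn] := eqVneq (dominant (kappa lambda) t) 0; first by rewrite d0 invr0 !mulr0.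
  by field; rewrite dn !gt_eqF ?expR_gt0.
have [a wa] := left_basis_recessive cQ k0 yz hw wd.
have a1 : a = 1.
  have h : a * (expR (kappa lambda * t) * y (- t)) @[t --> +oo] --> a * 1.
    exact: (cvgM (cvg_cst a) y1).
  rewrite mulr1 in h; move: w1; rewrite wa; under eq_fun do rewrite mulrCA.
  by move=> w1; exact: (cvg_unique _ h w1).
have wr := to_logE (N := N) w (ln r); rewrite lnK// in wr.
by rewrite wr wa a1 mul1r /from_log mulNr.
Qed.

Lemma origin_recessive V (lambda : R) y dy z dz w : lambda_star N <= lambda ->
  continuous (log_pot V) -> left_basis (log_pot V) (kappa lambda) y dy z dz ->
  ode_solution N V w ->
  (lambda_star N < lambda -> w =o_ (0^'+) (fun r => r `^ Aminus N lambda)) ->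
  (lambda = lambda_star N ->
     w =o_ (0^'+) (fun r => r `^ (- (N%:R - 2) / 2) * `|ln r|)) ->
  exists c : R, forall r, 0 < r -> w r = c * from_log y r.
Proof.
move=> hl cQ yz /sol_to_log hw hgt heq; have k0 := kappa_ge0 (N := N) lambda.
have [a wa] := left_basis_recessive cQ k0 yz hw (littleo_to_log hl hgt heq).
exists a => r r0; have wr := to_logE (N := N) w (ln r); rewrite lnK// in wr.
by rewrite wr wa /from_log mulNr mulrCA.
Qed.

(** The constant must serve four implications at once; the dichotomy fixes whether [H] is
    subcritical, and the implications for the opposite case become vacuous. *)
Lemma infinity_asymp V (k1 lambda : R) y dy z dz : (0 < N)%N -> 0 <= k1 ->
  (forall r : R, 0 < r -> {for r, continuous V}) -> lambda_star N <= lambda ->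
  left_basis (log_pot V) k1 y dy z dz ->
  (exists u du v dv, right_basis (log_pot V) (kappa lambda) u du v dv) ->
  nonnegative (radial N V) ->
  (forall r, 0 < r -> 0 < from_log y r) /\
  exists c : R,
    [/\ 0 < c,
        (subcritical (radial N V) -> lambda_star N < lambda ->
          asymp +oo (from_log y) (fun r => c * r `^ Aplus N lambda)),
        (critical (radial N V) -> lambda_star N < lambda ->
          asymp +oo (from_log y) (fun r => c * r `^ Aminus N lambda)),
        (subcritical (radial N V) -> lambda = lambda_star N ->
          asymp +oo (from_log y) (fun r => c * r `^ (- (N%:R - 2) / 2) * ln r)) &
        (critical (radial N V) -> lambda = lambda_star N ->
          asymp +oo (from_log y) (fun r => c * r `^ (- (N%:R - 2) / 2)))].
Proof.
move=> N0 k10 cV hl yz [u [du [v [dv uv]]]] hV; have cQ := log_pot_cont (N := N) cV.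
have [hy _ _] := left_basis_sol yz; have k0 := kappa_ge0 (N := N) lambda.
have [a [b [ye dye]]] := right_basis_span uv cQ hy.
have [y0 dich] := criticality_dichotomy N0 cV hV k10 yz uv ye dye.
split=> [r r0|]; first by rewrite mulr_gt0 ?expR_gt0.
have kgt : lambda_star N < lambda -> kappa lambda != 0.
  by move=> h; rewrite kappa_eq0// gt_eqF.
have keq : lambda = lambda_star N -> kappa lambda = 0.
  by move=> e; apply/eqP; rewrite kappa_eq0// e.
have yK t : to_log (from_log y) t = y t by exact: from_logK.
have mE : m + - (N%:R - 2) / 2 = 0 by ring.
case: dich => [[b0 sub]|[b0 a0 nsub]].
  have yd : y t / dominant (kappa lambda) t / b @[t --> +oo] --> (1 : R).
    have := right_basis_coef uv a (b := b); rewrite ye => h.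
    have bn : b != 0 by rewrite gt_eqF.
    have h2 : (a * u t + b * v t) / dominant (kappa lambda) t / b @[t --> +oo] --> b / b.
      exact: (cvgM h (cvg_cst b^-1)).
    by rewrite divff in h2.
  (* The coefficient [b] is relative to [dominant], which carries the factor 1/(2 kappa) when kappa
     is nonzero. *)
  pose c := if kappa lambda == 0 then b else b / (2 * kappa lambda).
  have c0 : 0 < c.
    rewrite /c; case: eqP => // /eqP kn.
    by rewrite divr_gt0// mulr_gt0// lt0r kn.
  exists c; split=> // [_ /kgt kn|[_ //]|_ /keq kz|[_ //]].
  - apply: (asympoo_to_log (N := N)); apply: cvg_trans yd; apply: near_eq_cvg; near=> t.
    rewrite yK AplusE addNKr /c /dominant (negbTE kn); field.
    by rewrite kn !gt_eqF ?expR_gt0.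
  - apply: (asympoo_ln_to_log (N := N)); apply: cvg_trans yd; apply: near_eq_cvg; near=> t.
    by rewrite yK mE mul0r expR0 mulr1 /c /dominant kz eqxx invfM; ring.
have yu : expR (kappa lambda * t) * y t / a @[t --> +oo] --> (1 : R).
  have [_ _ _ u1 _] := uv.
  apply: cvg_trans u1; apply: near_eq_cvg; near=> t.
  by rewrite ye b0; field; rewrite gt_eqF.
exists a; split=> // [_ _|_ /keq kz].
- apply: (asympoo_to_log (N := N)); apply: cvg_trans yu; apply: near_eq_cvg; near=> t.
  by rewrite yK AminusE addrA subrr add0r mulNr expRN invfM invrK; ring.
- apply: (asympoo_to_log (N := N)); apply: cvg_trans yu; apply: near_eq_cvg; near=> t.
  by rewrite yK mE kz !mul0r expR0 mul1r mulr1.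
Unshelve. all: by end_near. Qed.

End Solutions.

(** * The critical coupling constant *)

Section Coupling.
Context {R : realType} {N : nat}.
Implicit Types (q w W phi : 'rV[R]_N -> R) (V : R -> R).

Definition continuous_off0 q := forall x, x != 0 -> {for x, continuous q}.

Definition form q phi : R :=
  intN (fun x => \sum_i partial i phi x ^+ 2 + q x * phi x ^+ 2).

Lemma nonnegative_formP q : continuous_off0 q ->
  nonnegative q <-> forall phi, C0infty [set x | x != 0] phi -> 0 <= form q phi.
Proof.
by move=> cq; split=> h phi hphi; have := h phi hphi; rewrite energyE// lee_fin.
Qed.

Lemma continuous_off0B q w (t : R) : continuous_off0 q -> continuous_off0 w ->
  continuous_off0 (fun x => q x - t * w x).
Proof. by move=> cq cw x x0; exact: (cvgB (cq x x0) (cvgM (cvg_cst t) (cw x x0))). Qed.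

Lemma C0infty_continuous_off0 W : C0infty setT W -> continuous_off0 W.
Proof. by move=> hW x _; exact: C0infty_cont hW x. Qed.

Lemma formB q w (t : R) phi : continuous_off0 q -> continuous_off0 w -> C0infty [set x | x != 0] phi ->
  form (fun x => q x - t * w x) phi = form q phi - t * intN (fun x => w x * phi x ^+ 2).
Proof.
move=> cq cw hphi; have h1 := cc_pot cw hphi.
rewrite -intNZ// -intNB; [|exact: energy_cc|exact: ccZ].
by apply: eq_intN => x; ring.
Qed.

Lemma le_nonnegative q w : continuous_off0 q -> continuous_off0 w -> (forall x, q x <= w x) ->
  nonnegative q -> nonnegative w.
Proof.
move=> cq cw qw /(nonnegative_formP cq) h; apply/nonnegative_formP => // phi hphi.
rewrite (le_trans (h _ hphi))//; apply: le_intN; [exact: energy_cc..|] => x.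
by rewrite lerD2l ler_wpM2r// sqr_ge0.
Qed.

Lemma nonnegative_convex q w (s : R) : continuous_off0 q -> continuous_off0 w -> 0 <= s <= 1 ->
  nonnegative q -> nonnegative w -> nonnegative (fun x => (1 - s) * q x + s * w x).
Proof.
move=> cq cw /andP[s0 s1] /(nonnegative_formP cq) hq /(nonnegative_formP cw) hw.
apply/nonnegative_formP => [x x0|phi hphi].
  by exact: (cvgD (cvgM (cvg_cst _) (cq x x0)) (cvgM (cvg_cst _) (cw x x0))).
have -> : form (fun x => (1 - s) * q x + s * w x) phi = (1 - s) * form q phi + s * form w phi.
  have h1 := energy_cc cq hphi; have h2 := energy_cc cw hphi.
  rewrite -!intNZ// -intND; [|exact: ccZ..].
  by apply: eq_intN => x; ring.
by rewrite addr_ge0// mulr_ge0 ?hq ?hw// subr_ge0.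
Qed.

(** The smooth majorant [wd] of [w] is admissible in the definition of subcriticality: applied to
    [q] it shows that [S] contains a positive number, applied at the supremum that the supremum
    could be exceeded. *)
Lemma critical_coupling q w wd : continuous_off0 q -> continuous_off0 w -> (forall x, 0 <= w x) ->
  C0infty setT wd -> (forall x, w x <= wd x) -> subcritical q ->
  (exists2 phi, C0infty [set x | x != 0] phi & 0 < intN (fun x => w x * phi x ^+ 2)) ->
  exists2 mus : R, 0 < mus & forall mu,
    [/\ mu < mus -> subcritical (fun x => q x - mu * w x),
        mu = mus -> critical (fun x => q x - mu * w x) &
        mus < mu -> supercritical (fun x => q x - mu * w x)].
Proof.
move=> cq cw w0 hwd wwd [hq0 hq1] [phi0 hphi0 B0].
have cqw (t : R) : continuous_off0 (fun x => q x - t * w x) by exact: continuous_off0B.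
pose S : set R := [set mu | nonnegative (fun x => q x - mu * w x)].
have Sdown (s t : R) : s <= t -> S t -> S s.
  move=> st; apply: le_nonnegative => // x.
  by rewrite lerD2l lerN2 ler_wpM2r.
have perturb q' (eps : R) : continuous_off0 q' ->
    nonnegative (fun x => q' x - eps * wd x) -> 0 <= eps -> nonnegative (fun x => q' x - eps * w x).
  move=> cq' h e0; apply: le_nonnegative h => [||x]; [|exact: continuous_off0B|].
    by apply: continuous_off0B => //; exact: C0infty_continuous_off0.
  by rewrite lerD2l lerN2 ler_wpM2l.
have [e1 e1pos he1] := hq1 wd hwd.
have Se1 : S (e1 / 2).
  by apply: perturb => //; [apply: he1; apply/andP; split; lra|lra].
have Sub : has_ubound S.
  exists (form q phi0 / intN (fun x => w x * phi0 x ^+ 2)) => mu.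
  move=> /(nonnegative_formP (cqw mu))/(_ _ hphi0); rewrite formB// subr_ge0.
  by rewrite ler_pdivlMr.
have hS : has_sup S by split => //; exists (e1 / 2).
have le_sup t : S t -> t <= sup S by move=> St; exact: ub_le_sup.
have pos : 0 < sup S by rewrite (lt_le_trans _ (le_sup _ Se1))// divr_gt0.
(* For a fixed test function the form is affine in the coupling, so nonnegativity passes to the
   supremum. *)
have Ssup : S (sup S).
  apply/nonnegative_formP => // phi hphi; rewrite formB// subr_ge0.
  have : 0 <= intN (fun x => w x * phi x ^+ 2).
    by apply: intN_ge0 => x; rewrite mulr_ge0// sqr_ge0.
  rewrite le_eqVlt => /predU1P[<-|B1].
    by rewrite mulr0; have := (nonnegative_formP cq).1 hq0 _ hphi.
  rewrite -ler_pdivlMr// leNgt; apply/negP => h.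
  have [t St ht] := sup_gt (ex_intro _ _ Se1) h.
  move: St => /(nonnegative_formP (cqw t))/(_ _ hphi); rewrite formB// subr_ge0.
  by rewrite -ler_pdivlMr// leNgt ht.
exists (sup S) => // mu; split=> [mult|->|mult].
- split=> [|W hW]; first exact: (Sdown mu (sup S) (ltW mult)).
  have cW := C0infty_continuous_off0 hW; have [e0 e0pos he0] := hq1 W hW.
  (* A negative coupling only raises the potential above [q]. *)
  have [mu0|mu0] := ltP mu 0.
    exists e0 => // eps he; apply: le_nonnegative (he0 eps he) => [||x].
    + exact: continuous_off0B.
    + by apply: continuous_off0B.
    + by rewrite lerD2r lerDl oppr_ge0 mulr_le0_ge0// ltW.
  (* The potential q - mu w - eps W is the combination with weights 1 - s and s of q - (eps / (1 -
     s)) W and q - (sup S) w. *)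
  pose s := mu / sup S; have s0 : 0 <= s by rewrite divr_ge0// ltW.
  have s1 : s < 1 by rewrite ltr_pdivrMr// mul1r.
  have s1' : 0 < 1 - s by rewrite subr_gt0.
  exists ((1 - s) * e0) => [|eps /andP[e0' he]]; first by rewrite mulr_gt0.
  have h1 : nonnegative (fun x => q x - eps / (1 - s) * W x).
    by apply: he0; rewrite divr_gt0//= ltr_pdivrMr// mulrC.
  have cqW : continuous_off0 (fun x => q x - eps / (1 - s) * W x) by exact: continuous_off0B.
  have := nonnegative_convex (s := s) cqW (cqw (sup S)) _ h1 Ssup.
  rewrite s0 ltW// => /(_ isT); congr nonnegative; apply/funext => x.
  rewrite (_ : mu = s * sup S); last by rewrite /s divfK// gt_eqF.
  by field; rewrite gt_eqF.
- split=> // -[_ /(_ wd hwd)[eps0 epos he]].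
  have h1 : S (sup S + eps0 / 2).
    have := perturb _ (eps0 / 2) (cqw (sup S)) _ _.
    rewrite /S /= (_ : (fun x => q x - (sup S + eps0 / 2) * w x) =
      (fun x => q x - sup S * w x - eps0 / 2 * w x)); last by apply/funext => x; ring.
    by apply; [apply: he; apply/andP; split; lra|lra].
  by have := le_sup _ h1; lra.
- by move=> /le_sup; rewrite leNgt mult.
Qed.

Lemma C0_halfline_bound (W : R -> R) : C0_halfline W -> (forall r, 0 <= r -> 0 <= W r) ->
  exists M B : R, [/\ 0 < M, 0 < B, forall r, 0 <= r -> W r <= M &
                      forall r, B < r -> W r = 0].
Proof.
move=> [cW /compact_bounded[B0 [_ hB]]] W0; pose B := `|B0| + 1.
have B1 : 0 < B by rewrite ltr_wpDl.
have WB r : B < r -> W r = 0.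
  move=> Br; apply/eqP/negPn/negP => Wr.
  have r0 : 0 <= r by rewrite (le_trans (ltW B1))// ltW.
  have B0B : B0 < B by rewrite /B (le_lt_trans (ler_norm _))// ltrDl.
  have : `|r| <= B by apply: (hB _ B0B); apply: subset_closure; split.
  by rewrite ger0_norm// leNgt Br.
have [||c cB hc] := @EVT_max R W 0 B; first exact: ltW.
  by apply: continuous_subspaceW cW => r /=; rewrite !in_itv /= andbT => /andP[].
exists (`|W c| + 1), B; split=> // r r0.
have [Br|rB] := ltP B r; first by rewrite WB// addr_ge0.
rewrite (@le_trans _ _ (W c))//; first by apply: hc; rewrite in_itv /= r0.
by rewrite (le_trans (ler_norm _))// lerDl.
Qed.

(** Test functions vanish near the origin, so a point with [r > 0] is required; if [W] is known to
    be nonzero only at 0, right continuity moves the point. *)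
Lemma C0_halfline_pos (W : R -> R) : C0_halfline W -> (forall r, 0 <= r -> 0 <= W r) ->
  (exists2 r, 0 <= r & W r != 0) -> exists2 r, 0 < r & 0 < W r.
Proof.
move=> [/continuous_within_itvcyP[_ W0] _] Wpos [r r0 Wr].
have Wr0 : 0 < W r by rewrite lt0r Wr Wpos.
move: r0; rewrite le_eqVlt => /predU1P[r0|r0]; last by exists r.
rewrite -r0 in Wr0; have : \forall s \near 0^'+, 0 < W s by move/cvgr_gt: W0; apply.
rewrite near_withinE => /nbhs_ballP[d /= d0 hd]; exists (d / 2); first by rewrite divr_gt0.
apply: hd; last by rewrite divr_gt0.
by rewrite /ball /= sub0r normrN gtr0_norm ?divr_gt0//; lra.
Qed.

Lemma radial_test (r1 : R) : (0 < N)%N -> 0 < r1 -> exists2 phi : 'rV[R]_N -> R,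
  C0infty [set x | x != 0] phi & exists2 x, enorm x = r1 & phi x = 1.
Proof.
move=> N0 r0; have [Th [dTh [sTh _ _ _ [Th0 Th1 _ _ _]]]] := @step_exists R.
have r20 : 0 < r1 ^+ 2 by rewrite exprn_gt0.
(* The argument [k * s - 1] of the step runs from 0 at [s = r1 ^+ 2 / 2] to 1 at [s = r1 ^+ 2]. *)
pose k := 2 / r1 ^+ 2; have k0 : 0 < k by rewrite divr_gt0.
pose f s := Th (k * s + - 1) * Th (-1 * s + (r1 ^+ 2 + 1)).
have sf : sm f by apply: sm_mul; exact: sm_aff.
have h2 : k * (r1 ^+ 2) = 2 by rewrite /k divfK// gt_eqF.
exists (fun x => f (r2 x)).
  apply: (radial_C0infty_off0 (a := r1 ^+ 2 / 2) (b := r1 ^+ 2 + 1)) => //.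
  - by rewrite divr_gt0.
  - move=> s hs; rewrite /f Th0 ?mul0r//.
    have : k * s <= k * (r1 ^+ 2 / 2) by rewrite ler_pM2l.
    by rewrite mulrA h2; lra.
  - by move=> s hs; rewrite /f mulrC Th0 ?mul0r//; lra.
pose i0 : 'I_N := Ordinal N0; exists (r1 *: delta_mx ord0 i0).
  have -> : r1 *: delta_mx ord0 i0 = (0 : 'rV[R]_N) + r1 *: delta_mx ord0 i0 by rewrite add0r.
  rewrite /enorm -/(r2 _) r2_line r2_0 !mxE mulr0 mul0r !add0r sqrtr_sqr gtr0_norm//.
have -> : r1 *: delta_mx ord0 i0 = (0 : 'rV[R]_N) + r1 *: delta_mx ord0 i0 by rewrite add0r.
rewrite r2_line r2_0 !mxE mulr0 mul0r !add0r /f h2 !Th1 ?mulr1//; lra.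
Qed.

Lemma radial_critical_coupling V (W : R -> R) : (0 < N)%N ->
  (forall r : R, 0 < r -> {for r, continuous V}) ->
  subcritical (radial N V) -> C0_halfline W -> (forall r, 0 <= r -> 0 <= W r) ->
  (exists2 r, 0 <= r & W r != 0) ->
  exists2 mu_star : R, 0 < mu_star & forall mu : R,
    [/\ mu < mu_star -> subcritical (radial N (fun r => V r - mu * W r)),
        mu = mu_star -> critical (radial N (fun r => V r - mu * W r)) &
        mu_star < mu -> supercritical (radial N (fun r => V r - mu * W r))].
Proof.
move=> N0 cV hV hW W0 Wn.
have cW r : 0 < r -> {for r, continuous W}.
  by case: hW => /continuous_within_itvcyP[h _] _ r0; apply: h; rewrite in_itv /= r0.
have [M [B [M0 B0 WM WB]]] := C0_halfline_bound hW W0.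
have [Th [dTh [sTh _ _ _ [Th0 Th1 Th01 _ _]]]] := @step_exists R.
(* The smooth majorant: equal to [M] on the ball of radius [B] that carries [W], and 0 once |x|^2 >=
   B^2 + 1. *)
pose f s := M * Th (-1 * s + (B ^+ 2 + 1)).
have sf : sm f by apply: sm_mul; [exact: sm_cst|exact: sm_aff].
have fb s : B ^+ 2 + 1 <= s -> f s = 0 by move=> hs; rewrite /f Th0 ?mulr0//; lra.
have e0 (x : 'rV[R]_N) : 0 <= enorm x by exact: sqrtr_ge0.
apply: (critical_coupling (w := radial N W) (radial_cont cV) (radial_cont cW) _
  (radial_C0infty sf fb) _ hV).
- by move=> x; exact: W0.
- move=> x; rewrite /radial /f; have [xB|xB] := ltP B (enorm x).
    by rewrite WB// mulr_ge0 ?(ltW M0)//; case/andP: (Th01 (-1 * r2 x + (B ^+ 2 + 1))).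
  rewrite Th1 ?mulr1 ?WM//.
  suff : r2 x <= B ^+ 2 by lra.
  by rewrite -[r2 x]sqr_sqrtr ?r2_ge0// lerXn2r ?nnegrE// ltW.
have [r1 r10 Wr1] := C0_halfline_pos hW W0 Wn.
have [phi hphi [x xr phix]] := radial_test N0 r10; exists phi => //.
apply: (intN_gt0 (x0 := x)).
- exact: cc_pot (radial_cont cW) hphi.
- by move=> y; rewrite mulr_ge0 ?sqr_ge0// W0.
- by rewrite /radial xr phix expr1n mulr1.
Qed.

End Coupling.

Theorem theorem1p1 (R : realType) (N : nat) (hN : (2 <= N)%N)
  (V : R -> R) (theta lambda1 lambda2 : R)
  (hV : {in `]0, +oo[, continuous V})
  (htheta : 0 < theta)
  (hlambda1 : lambda_star N <= lambda1)
  (hlambda2 : lambda_star N <= lambda2)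
  (hV0 : r `^ (- theta) * `|r ^+ 2 * V r - lambda1| @[r --> 0^'+] --> (0 : R))
  (hVoo : r `^ theta * `|r ^+ 2 * V r - lambda2| @[r --> +oo] --> (0 : R)) :
  (exists U : R -> R,
    [/\ ode_solution N V U,
        asymp 0^'+ U (fun r => r `^ Aplus N lambda1) &
        forall U' : R -> R, ode_solution N V U' ->
          asymp 0^'+ U' (fun r => r `^ Aplus N lambda1) ->
          forall r, 0 < r -> U' r = U r] /\
    (forall w : R -> R, ode_solution N V w ->
      (lambda_star N < lambda1 ->
        w =o_ (0^'+) (fun r => r `^ Aminus N lambda1)) ->
      (lambda1 = lambda_star N ->
        w =o_ (0^'+) (fun r => r `^ (- (N%:R - 2) / 2) * `|ln r|)) ->
      exists c : R, forall r, 0 < r -> w r = c * U r) /\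
    (nonnegative (radial N V) ->
      (forall r, 0 < r -> 0 < U r) /\
      exists c : R,
        [/\ 0 < c,
            (subcritical (radial N V) -> lambda_star N < lambda2 ->
              asymp +oo U (fun r => c * r `^ Aplus N lambda2)),
            (critical (radial N V) -> lambda_star N < lambda2 ->
              asymp +oo U (fun r => c * r `^ Aminus N lambda2)),
            (subcritical (radial N V) -> lambda2 = lambda_star N ->
              asymp +oo U (fun r => c * r `^ (- (N%:R - 2) / 2) * ln r)) &
            (critical (radial N V) -> lambda2 = lambda_star N ->
              asymp +oo U (fun r => c * r `^ (- (N%:R - 2) / 2)))])) /\
  (subcritical (radial N V) ->
    forall W : R -> R, C0_halfline W ->
      (forall r, 0 <= r -> 0 <= W r) ->
      (exists2 r, 0 <= r & W r != 0) ->
      exists2 mu_star : R, 0 < mu_star &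
        forall mu : R,
          [/\ mu < mu_star -> subcritical (radial N (fun r => V r - mu * W r)),
              mu = mu_star -> critical (radial N (fun r => V r - mu * W r)) &
              mu_star < mu ->
                supercritical (radial N (fun r => V r - mu * W r))]).
Proof.
have N0 : (0 < N)%N by exact: leq_trans hN.
have cV (r : R) : 0 < r -> {for r, continuous V}.
  by move=> r0; apply: hV; rewrite in_itv /= r0.
have cQ := log_pot_cont (N := N) cV.
split; last by move=> sub W; exact: radial_critical_coupling.
have [T1 hl] := log_pot_left (N := N) hlambda1 hV0; have [T2 hr] := log_pot_right (N := N) hlambda2 hVoo.
have [y [dy [z [dz yz]]]] := left_basis_exists (kappa_ge0 (N := N) lambda1) htheta ler01 cQ hl.
have uv := right_basis_exists (kappa_ge0 (N := N) lambda2) htheta ler01 cQ hr.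
have [hy _ _] := left_basis_sol yz; exists (from_log (N := N) y); split.
  split; first exact: ode_from_log hy.
    apply/asymp0_to_log; have [_ _ _ y1 _] := yz.
    by under eq_fun do rewrite from_logK.
  by move=> U' hU' U'1; exact: origin_unique cQ yz hU' U'1.
split; first by move=> w hw hgt heq; exact: origin_recessive hlambda1 cQ yz hw hgt heq.
exact: infinity_asymp N0 (kappa_ge0 (N := N) lambda1) cV hlambda2 yz uv.
Qed.
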